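(* Let $\mathcal{C},\mathcal{D}$ be unitary multifusion categories and $\mathcal{M}$ a $\mathcal{C}|\mathcal{D}$-bimodule category. The domain wall tube algebra $$\mathbf{Tube}({}_{\mathcal{C}}\mathcal{M}_{\mathcal{D}})=\bigoplus_{a\in\mathrm{Irr}(\mathcal{C}),\,b\in\mathrm{Irr}(\mathcal{D}),\,c,e,f,h\in\mathrm{Irr}(\mathcal{M})}\mathrm{Hom}_{\mathcal{M}}(c,a\otimes e\otimes b)\otimes\mathrm{Hom}_{\mathcal{M}}(a\otimes f\otimes b,h)$$ is a $C^*$ weak Hopf algebra with the following structure ($v\in\mathrm{Hom}(c,a\otimes e\otimes b)$, $w\in\mathrm{Hom}(a\otimes f\otimes b,h)$): unit $1=\sum_{x,y}\mathrm{id}_y\otimes\mathrm{id}_x$, over pairs $x,y\in\mathrm{Irr}(\mathcal{M})$ lying in a common component $\mathbf{1}^{\mathcal{C}}_i\otimes\mathcal{M}\otimes\mathbf{1}^{\mathcal{D}}_j$ (the summand has $a=\mathbf{1}^{\mathcal{C}}_i$, $b=\mathbf{1}^{\mathcal{D}}_j$, $c=e=y$, $f=h=x$); multiplication $(v\otimes w)(v'\otimes w')=\delta_{f,h'}\delta_{e,c'}\langle\!\langle(\mathrm{id}_a\otimes v'\otimes\mathrm{id}_b)v,\;w(\mathrm{id}_a\otimes w'\otimes\mathrm{id}_b)\rangle\!\rangle$; counit $\varepsilon(v\otimes w)\,\mathrm{id}_h=\delta_{e,f}\delta_{c,h}\,w\circ v$; comultiplication $\Delta(v\otimes w)=\sum_{i,k\in\mathrm{Irr}(\mathcal{M})}\sum_p(v_p\otimes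 w)\otimes(v\otimes w_p)$, with $v_p$ a basis of $\mathrm{Hom}(k,a\otimes i\otimes b)$ and $w_p$ the dual basis of $\mathrm{Hom}(a\otimes i\otimes b,k)$, $w_p\circ v_q=\delta_{p,q}\mathrm{id}_k$; antipode $S(v\otimes w)=\frac{d_f}{d_h}\,w^\flat\otimes v^\sharp$; $*$-operation (antilinear) $(v\otimes w)^*=\frac{d_e}{d_c}\,(v^\dagger)^\flat\otimes(w^\dagger)^\sharp$.
   Context: A unitary multifusion category (UMFC) is a finite semisimple $\mathbb{C}$-linear rigid monoidal category with compatible unitary dagger structure; its unit decomposes as $\mathbf{1}=\bigoplus_i\mathbf{1}_i$ with $\mathbf{1}_i$ simple. UMFCs carry a spherical structure: for simple $x$ with dual $\bar x$ there are $\mathrm{coev}_x:\mathbf{1}\to x\otimes\bar x$, $\mathrm{ev}_x:\bar x\otimes x\to\mathbf{1}$ satisfying the zig-zag equations, the other pair of duality maps is $\mathrm{ev}_x^\dagger,\mathrm{coev}_x^\dagger$, and both $\mathrm{coev}_x^\dagger\mathrm{coev}_x$ and $\mathrm{ev}_x\mathrm{ev}_x^\dagger$ equal $d_x>0$ times the identity of the corresponding simple summand of $\mathbf{1}$. The bimodule category $\mathcal{M}$ is finite semisimple and unitary (dagger compatible with both actions) and carries a compatible bimodule trace: traces $\mathrm{tr}_m$ on $\mathrm{End}(m)$ with $\mathrm{tr}(fg)=\mathrm{tr}(gf)$ and $\mathrm{tr}_{a\otimes m\otimes b}(f)=\mathrm{tr}_m(\text{partial trace of }f\text{ over }a\text{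 and }b)$, and $d_m=\mathrm{tr}_m(\mathrm{id}_m)>0$ for simple $m$. Associators are suppressed; $\mathrm{Irr}$ denotes representatives of simples (containing all simple summands of the units). Elements are diagrams on an annulus: the vertical domain wall cut by a hole, lower part labelled $c$ outside, $e$ inside; upper part $f$ inside, $h$ outside; a left arc $a\in\mathcal{C}$ and a right arc $b\in\mathcal{D}$ join the two parts. The paper's basis $[a;b]_{c,d,e;\mu,\nu}^{f,g,h;\zeta,\gamma}$ ($\mu\in\mathrm{Hom}(c,d\otimes b)$, $\nu\in\mathrm{Hom}(d,a\otimes e)$, $\zeta\in\mathrm{Hom}(a\otimes f,g)$, $\gamma\in\mathrm{Hom}(g\otimes b,h)$) corresponds to $v=(\nu\otimes\mathrm{id}_b)\mu$, $w=\gamma(\zeta\otimes\mathrm{id}_b)$. For arbitrary objects $A\in\mathcal{C}$, $B\in\mathcal{D}$ and $v\in\mathrm{Hom}(c,A\otimes e\otimes B)$, $w\in\mathrm{Hom}(A\otimes f\otimes B,h)$, $\langle\!\langle v,w\rangle\!\rangle=\sum_{k\in\mathrm{Irr}(\mathcal{C}),s\in\mathrm{Irr}(\mathcal{D})}\sum_{p,q}((p^*\otimes\mathrm{id}_e\otimes q^* )v)\otimes(w(p\otimes\mathrm{id}_f\otimes q))$, with $p$ a basis of $\mathrm{Hom}(k,A)$, $p^*$ the dual basis of $\mathrm{Hom}(A,k)$ ($p^*p'=\delta_{p,p'}\mathrm{id}_k$), and $q,q^*$ likewise for $s,B$. In the product $A=a\otimes a'$, $B=b'\otimes b$. Bending: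 for $u\in\mathrm{Hom}(a\otimes x\otimes b,y)$, $u^\flat=(\mathrm{id}_{\bar a}\otimes u\otimes\mathrm{id}_{\bar b})(\mathrm{ev}_a^\dagger\otimes\mathrm{id}_x\otimes\mathrm{coev}_b)\in\mathrm{Hom}(x,\bar a\otimes y\otimes\bar b)$; for $u\in\mathrm{Hom}(y,a\otimes x\otimes b)$, $u^\sharp=(\mathrm{ev}_a\otimes\mathrm{id}_x\otimes\mathrm{coev}_b^\dagger)(\mathrm{id}_{\bar a}\otimes u\otimes\mathrm{id}_{\bar b})\in\mathrm{Hom}(\bar a\otimes y\otimes\bar b,x)$. A weak Hopf algebra is an algebra and coalgebra with $\Delta$ multiplicative, $(\Delta\otimes\mathrm{id})\Delta(1)=(\Delta(1)\otimes1)(1\otimes\Delta(1))=(1\otimes\Delta(1))(\Delta(1)\otimes1)$, $\varepsilon(xyz)=\sum\varepsilon(xy^{(1)})\varepsilon(y^{(2)}z)=\sum\varepsilon(xy^{(2)})\varepsilon(y^{(1)}z)$, and antipode $S$ with $\sum x^{(1)}S(x^{(2)})=\sum\varepsilon(1^{(1)}x)1^{(2)}$, $\sum S(x^{(1)})x^{(2)}=\sum1^{(1)}\varepsilon(x1^{(2)})$, $\sum S(x^{(1)})x^{(2)}S(x^{(3)})=S(x)$. It is a $C^*$ weak Hopf algebra if it also has an antilinear involution $*$ with $(xy)^*=y^*x^*$, $\Delta(x^* )=\Delta(x)^*$, and a faithful $*$-representation on a Hilbert space. *)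

(* Defs.v *)
From HB Require Import structures.
From mathcomp Require Import all_boot all_order all_algebra.
From mathcomp Require Import boolp.

Set Implicit Arguments.
Unset Strict Implicit.
Unset Printing Implicit Defensive.
Import Order.TTheory GRing.Theory Num.Theory.
Local Open Scope ring_scope.

Reserved Notation "g ∘ f" (at level 40, left associativity).
Reserved Notation "f ^†" (at level 1, left associativity, format "f ^†").
Reserved Notation "x ⊗ y" (at level 38, left associativity).
Reserved Notation "f ⊗' g" (at level 38, left associativity).
Reserved Notation "x ▷ m" (at level 37, right associativity).
Reserved Notation "f ▷' g" (at level 37, right associativity).
Reserved Notation "m ◁ y" (at level 38, left associativity).
Reserved Notation "f ◁' g" (at level 38, left associativity).
Reserved Notation "v ⊠ w" (at level 38, left associativity).

Section DirectSum.
Variables (K : fieldType) (I : finType) (V : I -> vectType K).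

Definition dsum := {dffun forall i : I, V i}.

HB.instance Definition _ := Choice.on dsum.

Let dadd (f g : dsum) : dsum := [ffun i => f i + g i].
Let dopp (f : dsum) : dsum := [ffun i => - f i].
Let dzero : dsum := [ffun i => 0].
Let dscale (a : K) (f : dsum) : dsum := [ffun i => a *: f i].

Fact dsum_addA : associative dadd.
Proof. by move=> f g h; apply/ffunP => i; rewrite !ffunE addrA. Qed.
Fact dsum_addC : commutative dadd.
Proof. by move=> f g; apply/ffunP => i; rewrite !ffunE addrC. Qed.
Fact dsum_add0 : left_id dzero dadd.
Proof. by move=> f; apply/ffunP => i; rewrite !ffunE add0r. Qed.
Fact dsum_addN : left_inverse dzero dopp dadd.
Proof. by move=> f; apply/ffunP => i; rewrite !ffunE addNr. Qed.

HB.instance Definition _ :=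
  GRing.isZmodule.Build dsum dsum_addA dsum_addC dsum_add0 dsum_addN.

Fact dsum_scaleA a b f : dscale a (dscale b f) = dscale (a * b) f.
Proof. by apply/ffunP => i; rewrite !ffunE scalerA. Qed.
Fact dsum_scale1 : left_id 1 dscale.
Proof. by move=> f; apply/ffunP => i; rewrite !ffunE scale1r. Qed.
Fact dsum_scaleDr : right_distributive dscale +%R.
Proof. by move=> a f g; apply/ffunP => i; rewrite !ffunE scalerDr. Qed.
Fact dsum_scaleDl f : {morph dscale^~ f : a b / a + b}.
Proof. by move=> a b; apply/ffunP => i; rewrite !ffunE scalerDl. Qed.

HB.instance Definition _ := GRing.Zmodule_isLmodule.Build K dsum
  dsum_scaleA dsum_scale1 dsum_scaleDr dsum_scaleDl.

Let coords := {i : I & 'I_(\dim {:V i})}.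

Fact dsum_vect_iso : Vector.axiom #|{: coords}| dsum.
Proof.
pose toR (f : dsum) : 'rV[K]_#|{: coords}| :=
  \row_k coord (vbasis fullv) (tagged (enum_val k)) (f (tag (enum_val k))).
pose ofR (r : 'rV[K]_#|{: coords}|) : dsum :=
  [ffun i => \sum_(j < \dim {:V i})
     r 0 (enum_rank (@Tagged I i (fun i => 'I_(\dim {:V i})) j))
       *: (vbasis {:V i})`_j].
exists toR; first by move=> a f g; apply/rowP => k; rewrite !mxE !ffunE linearP.
exists ofR.
  move=> f; apply/ffunP => i; rewrite ffunE.
  rewrite [RHS](coord_vbasis (memvf _)).
  by apply: eq_bigr => j _; rewrite mxE enum_rankK.
move=> r; apply/rowP => k; rewrite mxE ffunE coord_sum_free ?vbasisP //.
  by rewrite taggedK enum_valK.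
exact: basis_free (vbasisP _).
Qed.

HB.instance Definition _ := Lmodule_hasFinDim.Build K dsum dsum_vect_iso.

Definition dsum_in (i : I) (x : V i) : dsum :=
  [ffun j => @dfwith I V (fun k => 0) i x j].

End DirectSum.

Section Tensor.
Variable K : fieldType.

(* The tensor product in coordinates with respect to the bases [vbasis]. *)
Definition tens (V W : vectType K) : vectType K :=
  'M[K]_(\dim {:V}, \dim {:W}).

Definition pure (V W : vectType K) (v : V) (w : W) : tens V W :=
  \matrix_(i, j) (coord (vbasis fullv) i v * coord (vbasis fullv) j w).

(* Sweedler notation: [sw t B] is \sum B t1 t2, for the decomposition
   t = \sum t1 ⊗ t2 in which t1 ranges over the basis of V.  It does not depend
   on the decomposition as soon as B is biadditive and satisfies
   B (a *: v) w = B v (a *: w). *)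
Definition sw (V W : vectType K) (U : zmodType) (t : tens V W)
    (B : V -> W -> U) : U :=
  \sum_(i < \dim {:V})
    B (vbasis {:V})`_i (\sum_(j < \dim {:W}) t i j *: (vbasis {:W})`_j).

End Tensor.

Notation "v ⊠ w" := (pure v w) : ring_scope.

Section WeakHopf.
Variable K : numClosedFieldType.

Record wha_data (A : vectType K) := WHAData {
  hone : A;
  hmul : A -> A -> A;
  hcounit : A -> K;
  hcomul : A -> tens A A;
  hanti : A -> A;
  hstar : A -> A }.

Record is_weak_hopf (A : vectType K) (H : wha_data A) : Prop := IsWeakHopf {
  hmul_linl : forall y, linear (fun x => hmul H x y);
  hmul_linr : forall x, linear (hmul H x);
  hcounit_lin : scalar (hcounit H);
  hcomul_lin : linear (hcomul H);
  hanti_lin : linear (hanti H);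
  hmulA : associative (hmul H);
  hmul1l : left_id (hone H) (hmul H);
  hmul1r : right_id (hone H) (hmul H);
  hcomulA : forall x,
    sw (hcomul H x) (fun x1 x2 => sw (hcomul H x1) (fun x11 x12 =>
      x11 ⊠ (x12 ⊠ x2)))
    = sw (hcomul H x) (fun x1 x2 => sw (hcomul H x2) (fun x21 x22 =>
      x1 ⊠ (x21 ⊠ x22)));
  hcounitl : forall x, sw (hcomul H x) (fun x1 x2 => hcounit H x1 *: x2) = x;
  hcounitr : forall x, sw (hcomul H x) (fun x1 x2 => hcounit H x2 *: x1) = x;
  hcomulM : forall x y,
    hcomul H (hmul H x y)
    = sw (hcomul H x) (fun x1 x2 => sw (hcomul H y) (fun y1 y2 =>
        hmul H x1 y1 ⊠ hmul H x2 y2));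
  hcomul1l :
    sw (hcomul H (hone H)) (fun u v => sw (hcomul H u) (fun u1 u2 =>
      u1 ⊠ (u2 ⊠ v)))
    = sw (hcomul H (hone H)) (fun u v => sw (hcomul H (hone H)) (fun u' v' =>
      u ⊠ (hmul H v u' ⊠ v')));
  hcomul1r :
    sw (hcomul H (hone H)) (fun u v => sw (hcomul H u) (fun u1 u2 =>
      u1 ⊠ (u2 ⊠ v)))
    = sw (hcomul H (hone H)) (fun u v => sw (hcomul H (hone H)) (fun u' v' =>
      u ⊠ (hmul H u' v ⊠ v')));
  hcounitMl : forall x y z,
    hcounit H (hmul H (hmul H x y) z)
    = sw (hcomul H y) (fun y1 y2 =>
        hcounit H (hmul H x y1) * hcounit H (hmul H y2 z));
  hcounitMr : forall x y z,
    hcounit H (hmul H (hmul H x y) z)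
    = sw (hcomul H y) (fun y1 y2 =>
        hcounit H (hmul H x y2) * hcounit H (hmul H y1 z));
  hantir : forall x,
    sw (hcomul H x) (fun x1 x2 => hmul H x1 (hanti H x2))
    = sw (hcomul H (hone H)) (fun u v => hcounit H (hmul H u x) *: v);
  hantil : forall x,
    sw (hcomul H x) (fun x1 x2 => hmul H (hanti H x1) x2)
    = sw (hcomul H (hone H)) (fun u v => hcounit H (hmul H x v) *: u);
  hantim : forall x,
    sw (hcomul H x) (fun x1 y => sw (hcomul H y) (fun x2 x3 =>
      hmul H (hmul H (hanti H x1) x2) (hanti H x3))) = hanti H x }.

(* The faithful *-representation is by matrices acting on the finite-dimensional
   Hilbert space K^n with its standard inner product. *)
Record is_cstar_weak_hopf (A : vectType K) (H : wha_data A) : Prop :=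
  IsCstarWeakHopf {
  cwh_weak_hopf :> is_weak_hopf H;
  hstar_antilin : forall a x y,
    hstar H (a *: x + y) = a^* *: hstar H x + hstar H y;
  hstarK : involutive (hstar H);
  hstarM : forall x y, hstar H (hmul H x y) = hmul H (hstar H y) (hstar H x);
  hstar_comul : forall x,
    hcomul H (hstar H x)
    = sw (hcomul H x) (fun x1 x2 => hstar H x1 ⊠ hstar H x2);
  hstar_rep : exists n (rho : A -> 'M[K]_n),
    [/\ linear rho, injective rho, rho (hone H) = 1%:M,
        forall x y, rho (hmul H x y) = rho x *m rho y
      & forall x, rho (hstar H x) = (map_mx Num.conj (rho x))^T] }.

End WeakHopf.

(* The conditions [dag_eq0] and [dag_pos] say that a dagger category with
   finite-dimensional morphism spaces is a C*-category. *)
Record dagcat (K : numClosedFieldType) := DagCat {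
  ob :> Type;
  mor : ob -> ob -> vectType K;
  idm : forall x, mor x x;
  comp : forall x y z, mor y z -> mor x y -> mor x z;
  dag : forall x y, mor x y -> mor y x;
  compA : forall x y z t (h : mor z t) (g : mor y z) (f : mor x y),
    comp h (comp g f) = comp (comp h g) f;
  comp1m : forall x y (f : mor x y), comp (idm y) f = f;
  compm1 : forall x y (f : mor x y), comp f (idm x) = f;
  comp_linl : forall x y z (f : mor x y), linear (fun g : mor y z => comp g f);
  comp_linr : forall x y z (g : mor y z), linear (fun f : mor x y => comp g f);
  dag_antilin : forall x y a (f g : mor x y),
    dag (a *: f + g) = a^* *: dag f + dag g;
  dagK : forall x y (f : mor x y), dag (dag f) = f;
  dag_comp : forall x y z (g : mor y z) (f : mor x y),
    dag (comp g f) = comp (dag f) (dag g);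
  dag_eq0 : forall x y (f : mor x y), comp (dag f) f = 0 -> f = 0;
  dag_pos : forall x y (f : mor x y),
    exists g : mor x x, comp (dag f) f = comp (dag g) g }.

Arguments mor {K d} x y.
Arguments idm {K d} x.
Arguments comp {K d x y z} g f.
Arguments dag {K d x y} f.
Notation "g ∘ f" := (comp g f) : ring_scope.
Notation "f ^†" := (dag f) : ring_scope.

Section DagCatTheory.
Variables (K : numClosedFieldType) (C : dagcat K).

Definition unitary (x y : C) (u : mor x y) :=
  u^† ∘ u = idm x /\ u ∘ u^† = idm y.

Definition isomorphic (x y : C) :=
  exists (f : mor x y) (g : mor y x), g ∘ f = idm x /\ f ∘ g = idm y.

(* End(x) is one-dimensional, i.e. spanned by the nonzero morphism id_x. *)
Definition simple (x : C) := \dim {:@mor K C x x} = 1%N.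

Record orth_sum (J : finType) (s : J -> C) (x : C) (i : forall k, mor (s k) x)
    : Prop := OrthSum {
  orth_sum_isom : forall k, (i k)^† ∘ i k = idm (s k);
  orth_sum_orth : forall k l, k != l -> (i k)^† ∘ i l = 0;
  orth_sum_full : \sum_k (i k ∘ (i k)^†) = idm x }.

(* For simple x, a basis p of Hom(x,y) with its dual basis q of Hom(y,x). *)
Record dual_bases (x y : C) := DualBases {
  db_size : nat;
  db_vec : 'I_db_size -> mor x y;
  db_covec : 'I_db_size -> mor y x;
  db_basis : basis_of fullv [tuple db_vec i | i < db_size];
  db_dual : forall i j,
    db_covec i ∘ db_vec j = if i == j then idm x else 0 }.

End DagCatTheory.

Arguments db_vec {K C x y} d i.
Arguments db_covec {K C x y} d i.

(* Direct sums include the zero object (n = 0); Irr is part of the data. *)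
Record ucat (K : numClosedFieldType) := UCat {
  ucat_dagcat :> dagcat K;
  ucat_sums : forall n (s : 'I_n -> ucat_dagcat),
    exists (x : ucat_dagcat) (i : forall k, mor (s k) x), orth_sum i;
  ucat_semisimple : forall x : ucat_dagcat,
    exists n (s : 'I_n -> ucat_dagcat) (i : forall k, mor (s k) x),
      orth_sum i /\ forall k, simple (s k);
  irr : finType;
  rep : irr -> ucat_dagcat;
  rep_simple : forall i, simple (rep i);
  rep_inj : forall i j, isomorphic (rep i) (rep j) -> i = j;
  rep_surj : forall x : ucat_dagcat, simple x -> exists i, isomorphic x (rep i) }.

(* The constraint isomorphisms are unitary, so their inverses are daggers. *)
Record monoidal (K : numClosedFieldType) := Monoidal {
  mon_ucat :> ucat K;
  tensor : mon_ucat -> mon_ucat -> mon_ucat;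
  tensorm : forall x x' y y' : mon_ucat,
    mor x x' -> mor y y' -> mor (tensor x y) (tensor x' y');
  munit : mon_ucat;
  massoc : forall x y z, mor (tensor (tensor x y) z) (tensor x (tensor y z));
  mlunit : forall x, mor (tensor munit x) x;
  mrunit : forall x, mor (tensor x munit) x;
  tensorm1 : forall x y, tensorm (idm x) (idm y) = idm (tensor x y);
  tensorm_comp : forall x x' x'' y y' y'' (f' : mor x' x'') (f : mor x x')
      (g' : mor y' y'') (g : mor y y'),
    tensorm (f' ∘ f) (g' ∘ g) = tensorm f' g' ∘ tensorm f g;
  tensorm_linl : forall x x' y y' (g : mor y y'),
    linear (fun f : mor x x' => tensorm f g);
  tensorm_linr : forall x x' y y' (f : mor x x'),
    linear (fun g : mor y y' => tensorm f g);
  tensorm_dag : forall x x' y y' (f : mor x x') (g : mor y y'),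
    (tensorm f g)^† = tensorm f^† g^†;
  massoc_unitary : forall x y z, unitary (massoc x y z);
  mlunit_unitary : forall x, unitary (mlunit x);
  mrunit_unitary : forall x, unitary (mrunit x);
  massoc_nat : forall x x' y y' z z' (f : mor x x') (g : mor y y')
      (h : mor z z'),
    massoc x' y' z' ∘ tensorm (tensorm f g) h
    = tensorm f (tensorm g h) ∘ massoc x y z;
  mlunit_nat : forall x x' (f : mor x x'),
    mlunit x' ∘ tensorm (idm munit) f = f ∘ mlunit x;
  mrunit_nat : forall x x' (f : mor x x'),
    mrunit x' ∘ tensorm f (idm munit) = f ∘ mrunit x;
  mpentagon : forall x y z t,
    massoc x y (tensor z t) ∘ massoc (tensor x y) z t
    = tensorm (idm x) (massoc y z t) ∘ massoc x (tensor y z) t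
      ∘ tensorm (massoc x y z) (idm t);
  mtriangle : forall x y,
    tensorm (idm x) (mlunit y) ∘ massoc x munit y
    = tensorm (mrunit x) (idm y) }.

Arguments tensor {K m} x y.
Arguments tensorm {K m x x' y y'} f g.
Arguments munit {K m}.
Arguments massoc {K m} x y z.
Arguments mlunit {K m} x.
Arguments mrunit {K m} x.
Notation "x ⊗ y" := (tensor x y) : ring_scope.
Notation "f ⊗' g" := (tensorm f g) : ring_scope.

Definition zigzag (K : numClosedFieldType) (C : monoidal K) (x xd : C)
    (ev : mor (xd ⊗ x) munit) (coev : mor munit (x ⊗ xd)) :=
  mrunit x ∘ (idm x ⊗' ev) ∘ massoc x xd x ∘ (coev ⊗' idm x) ∘ (mlunit x)^†
    = idm x
  /\ mlunit xd ∘ (ev ⊗' idm xd) ∘ (massoc xd x xd)^† ∘ (idm xd ⊗' coev)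
       ∘ (mrunit xd)^† = idm xd.

(* The unit object is the orthogonal direct sum of the representatives
   [rep (uirr i)]; the dual of a representative is taken to be the
   representative of the dual. *)
Record umfc (K : numClosedFieldType) := UMFC {
  umfc_mon :> monoidal K;
  umfc_rigid : forall x : umfc_mon,
    exists (xd : umfc_mon) (ev : mor (xd ⊗ x) munit)
      (coev : mor munit (x ⊗ xd)), zigzag ev coev;
  uidx : finType;
  uirr : uidx -> irr umfc_mon;
  uinc : forall i, mor (rep (uirr i)) munit;
  uinc_sum : orth_sum uinc;
  dual : irr umfc_mon -> irr umfc_mon;
  ev : forall x, mor (rep (dual x) ⊗ rep x) munit;
  coev : forall x, mor munit (rep x ⊗ rep (dual x));
  ev_coev : forall x, zigzag (ev x) (coev x);
  qdim : irr umfc_mon -> K;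
  qdim_gt0 : forall x, 0 < qdim x;
  coev_norm : forall x, exists i,
    (coev x)^† ∘ coev x = qdim x *: (uinc i ∘ (uinc i)^†);
  ev_norm : forall x, exists j,
    ev x ∘ (ev x)^† = qdim x *: (uinc j ∘ (uinc j)^†) }.

Record bimodcat (K : numClosedFieldType) (C D : monoidal K) := BimodCat {
  bimod_ucat :> ucat K;
  lact : C -> bimod_ucat -> bimod_ucat;
  lactm : forall (a a' : C) (m m' : bimod_ucat),
    mor a a' -> mor m m' -> mor (lact a m) (lact a' m');
  ract : bimod_ucat -> D -> bimod_ucat;
  ractm : forall (m m' : bimod_ucat) (b b' : D),
    mor m m' -> mor b b' -> mor (ract m b) (ract m' b');
  lassoc : forall a a' m, mor (lact (a ⊗ a') m) (lact a (lact a' m));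
  rassoc : forall m b b', mor (ract (ract m b) b') (ract m (b ⊗ b'));
  cassoc : forall a m b, mor (ract (lact a m) b) (lact a (ract m b));
  lunit : forall m, mor (lact munit m) m;
  runit : forall m, mor (ract m munit) m;
  lactm1 : forall a m, lactm (idm a) (idm m) = idm (lact a m);
  lactm_comp : forall a a' a'' m m' m'' (f' : mor a' a'') (f : mor a a')
      (g' : mor m' m'') (g : mor m m'),
    lactm (f' ∘ f) (g' ∘ g) = lactm f' g' ∘ lactm f g;
  lactm_linl : forall a a' m m' (g : mor m m'),
    linear (fun f : mor a a' => lactm f g);
  lactm_linr : forall a a' m m' (f : mor a a'),
    linear (fun g : mor m m' => lactm f g);
  lactm_dag : forall a a' m m' (f : mor a a') (g : mor m m'),
    (lactm f g)^† = lactm f^† g^†;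
  ractm1 : forall m b, ractm (idm m) (idm b) = idm (ract m b);
  ractm_comp : forall m m' m'' b b' b'' (g' : mor m' m'') (g : mor m m')
      (f' : mor b' b'') (f : mor b b'),
    ractm (g' ∘ g) (f' ∘ f) = ractm g' f' ∘ ractm g f;
  ractm_linl : forall m m' b b' (f : mor b b'),
    linear (fun g : mor m m' => ractm g f);
  ractm_linr : forall m m' b b' (g : mor m m'),
    linear (fun f : mor b b' => ractm g f);
  ractm_dag : forall m m' b b' (g : mor m m') (f : mor b b'),
    (ractm g f)^† = ractm g^† f^†;
  lassoc_unitary : forall a a' m, unitary (lassoc a a' m);
  rassoc_unitary : forall m b b', unitary (rassoc m b b');
  cassoc_unitary : forall a m b, unitary (cassoc a m b);
  lunit_unitary : forall m, unitary (lunit m);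
  runit_unitary : forall m, unitary (runit m);
  lassoc_nat : forall a a1 a' a1' m m1 (f : mor a a1) (f' : mor a' a1')
      (g : mor m m1),
    lassoc a1 a1' m1 ∘ lactm (f ⊗' f') g
    = lactm f (lactm f' g) ∘ lassoc a a' m;
  rassoc_nat : forall m m1 b b1 b' b1' (g : mor m m1) (f : mor b b1)
      (f' : mor b' b1'),
    rassoc m1 b1 b1' ∘ ractm (ractm g f) f'
    = ractm g (f ⊗' f') ∘ rassoc m b b';
  cassoc_nat : forall a a1 m m1 b b1 (f : mor a a1) (g : mor m m1)
      (h : mor b b1),
    cassoc a1 m1 b1 ∘ ractm (lactm f g) h
    = lactm f (ractm g h) ∘ cassoc a m b;
  lunit_nat : forall m m' (g : mor m m'),
    lunit m' ∘ lactm (idm munit) g = g ∘ lunit m;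
  runit_nat : forall m m' (g : mor m m'),
    runit m' ∘ ractm g (idm munit) = g ∘ runit m;
  lpentagon : forall a a' a'' m,
    lassoc a a' (lact a'' m) ∘ lassoc (a ⊗ a') a'' m
    = lactm (idm a) (lassoc a' a'' m) ∘ lassoc a (a' ⊗ a'') m
      ∘ lactm (massoc a a' a'') (idm m);
  ltriangle : forall a m,
    lactm (idm a) (lunit m) ∘ lassoc a munit m = lactm (mrunit a) (idm m);
  rpentagon : forall m b b' b'',
    rassoc m b (b' ⊗ b'') ∘ rassoc (ract m b) b' b''
    = ractm (idm m) (massoc b b' b'') ∘ rassoc m (b ⊗ b') b''
      ∘ ractm (rassoc m b b') (idm b'');
  rtriangle : forall m b,
    ractm (idm m) (mlunit b) ∘ rassoc m munit b = ractm (runit m) (idm b);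
  cpentagonl : forall a a' m b,
    lassoc a a' (ract m b) ∘ cassoc (a ⊗ a') m b
    = lactm (idm a) (cassoc a' m b) ∘ cassoc a (lact a' m) b
      ∘ ractm (lassoc a a' m) (idm b);
  cpentagonr : forall a m b b',
    cassoc a m (b ⊗ b') ∘ rassoc (lact a m) b b'
    = lactm (idm a) (rassoc m b b') ∘ cassoc a (ract m b) b'
      ∘ ractm (cassoc a m b) (idm b');
  ctrianglel : forall m b,
    lunit (ract m b) ∘ cassoc munit m b = ractm (lunit m) (idm b);
  ctriangler : forall a m,
    lactm (idm a) (runit m) ∘ cassoc a m munit = runit (lact a m) }.

Arguments lact {K C D b} a m : rename.
Arguments ract {K C D b} m b : rename.
Arguments lactm {K C D b a a' m m'} f g : rename.
Arguments ractm {K C D b m m' b b'} g f : rename.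
Arguments lassoc {K C D b} a a' m : rename.
Arguments rassoc {K C D b} m b b' : rename.
Arguments cassoc {K C D b} a m b : rename.
Arguments lunit {K C D b} m : rename.
Arguments runit {K C D b} m : rename.
Notation "a ▷ m" := (lact a m) : ring_scope.
Notation "m ◁ b" := (ract m b) : ring_scope.
Notation "f ▷' g" := (lactm f g) : ring_scope.
Notation "g ◁' f" := (ractm g f) : ring_scope.

Section TwoSided.
Variables (K : numClosedFieldType) (C D : monoidal K) (M : bimodcat C D).

(* a ⊗ m ⊗ b stands for (a ⊗ m) ⊗ b. *)
Definition bact (a : C) (m : M) (b : D) : M := (a ▷ m) ◁ b.

Definition bactm (a a' : C) (m m' : M) (b b' : D)
    (f : mor a a') (g : mor m m') (h : mor b b') :
  mor (bact a m b) (bact a' m' b') := (f ▷' g) ◁' h.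

Definition bassoc (a a' : C) (m : M) (b' b : D) :
  mor (bact a (bact a' m b') b) (bact (a ⊗ a') m (b' ⊗ b)) :=
  rassoc ((a ⊗ a') ▷ m) b' b
  ∘ ((((lassoc a a' m)^† ◁' idm b') ∘ (cassoc a (a' ▷ m) b')^†) ◁' idm b).

Definition bunit (m : M) : mor (bact munit m munit) m :=
  lunit m ∘ runit (munit ▷ m).

End TwoSided.

Arguments bact {K C D M} a m b.
Arguments bactm {K C D M a a' m m' b b'} f g h.
Arguments bassoc {K C D M} a a' m b' b.
Arguments bunit {K C D M} m.

Section Bending.
Variables (K : numClosedFieldType) (C D : umfc K) (M : bimodcat C D).
Implicit Types (a : irr C) (b : irr D) (x y : M).

(* cap is ev_a ⊗ id_x ⊗ coev_b^†. *)
Definition cap a x b :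
  mor (bact (rep (dual a)) (bact (rep a) x (rep b)) (rep (dual b))) x :=
  bunit x ∘ bactm (ev a) (idm x) (coev b)^†
  ∘ bassoc (rep (dual a)) (rep a) x (rep b) (rep (dual b)).

Definition flat a x b y (u : mor (bact (rep a) x (rep b)) y) :
  mor x (bact (rep (dual a)) y (rep (dual b))) :=
  bactm (idm _) u (idm _) ∘ (cap a x b)^†.

Definition sharp a x b y (u : mor y (bact (rep a) x (rep b))) :
  mor (bact (rep (dual a)) y (rep (dual b))) x :=
  cap a x b ∘ bactm (idm _) u (idm _).

Definition ptrace a x b (f : mor (bact (rep a) x (rep b))
    (bact (rep a) x (rep b))) : mor x x :=
  cap a x b ∘ bactm (idm _) f (idm _) ∘ (cap a x b)^†.

End Bending.

Record bimod (K : numClosedFieldType) (C D : umfc K) := Bimod {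
  bimod_cat :> bimodcat C D;
  tr : forall m : bimod_cat, mor m m -> K;
  tr_lin : forall m, scalar (@tr m);
  tr_cyclic : forall m n (f : mor n m) (g : mor m n), tr (f ∘ g) = tr (g ∘ f);
  tr_ptrace : forall (a : irr C) m (b : irr D)
      (f : mor (bact (rep a) m (rep b)) (bact (rep a) m (rep b))),
    tr f = tr (ptrace f);
  tr_gt0 : forall m : bimod_cat, simple m -> 0 < tr (idm m) }.

Section Tube.
Variables (K : numClosedFieldType) (C D : umfc K) (M : bimod C D).

(* Labels ((a, b), (c, e), (f, h)). *)
Definition tube_label : finType :=
  ((irr C * irr D) * (irr M * irr M) * (irr M * irr M))%type.

Definition tube_summand (l : tube_label) : vectType K :=
  let: ((a, b), (c, e), (f, h)) := l in
  tens (mor (rep c) (bact (rep a) (rep e) (rep b)))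
       (mor (bact (rep a) (rep f) (rep b)) (rep h)).

Definition tube : vectType K := dsum tube_summand.

(* v ⊗ w, placed in the summand determined by the types of v and w. *)
Definition tb (a : irr C) (b : irr D) (c e f h : irr M)
    (v : mor (rep c) (bact (rep a) (rep e) (rep b)))
    (w : mor (bact (rep a) (rep f) (rep b)) (rep h)) : tube :=
  @dsum_in K tube_label tube_summand ((a, b), (c, e), (f, h)) (v ⊠ w).

(* <<v, w>>, computed with bases P of the spaces Hom(k,A) and Q of the spaces
   Hom(s,B). *)
Definition tb_reduce (A : C) (B : D) (c e f h : irr M)
    (v : mor (rep c) (bact A (rep e) B)) (w : mor (bact A (rep f) B) (rep h))
    (P : forall k : irr C, dual_bases (rep k) A)
    (Q : forall s : irr D, dual_bases (rep s) B) : tube :=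
  \sum_k \sum_s \sum_(i < db_size (P k)) \sum_(j < db_size (Q s))
    tb (bactm (db_covec (P k) i) (idm (rep e)) (db_covec (Q s) j) ∘ v)
       (w ∘ bactm (db_vec (P k) i) (idm (rep f)) (db_vec (Q s) j)).

Definition qdimM (m : irr M) : K := tr (idm (rep m)).

Definition in_component (i : uidx C) (j : uidx D) (x : M) :=
  exists m : M, isomorphic x (bact (rep (uirr i)) m (rep (uirr j))).

(* The identification 1_i ⊗ x ⊗ 1_j = x for x in the component (i, j). *)
Definition comp_unit (i : uidx C) (j : uidx D) (x : M) :
  mor (bact (rep (uirr i)) x (rep (uirr j))) x :=
  bunit x ∘ bactm (uinc i) (idm x) (uinc j).

Definition tube_unit : tube :=
  \sum_(i : uidx C) \sum_(j : uidx D)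
  \sum_(x : irr M | `[< in_component i j (rep x) >])
  \sum_(y : irr M | `[< in_component i j (rep y) >])
    tb (comp_unit i j (rep y))^† (comp_unit i j (rep x)).

Definition tube_mul_spec (mul : tube -> tube -> tube) : Prop :=
  (forall (a a' : irr C) (b b' : irr D) (c e f h e' f' : irr M)
      (v : mor (rep c) (bact (rep a) (rep e) (rep b)))
      (w : mor (bact (rep a) (rep f) (rep b)) (rep h))
      (v' : mor (rep e) (bact (rep a') (rep e') (rep b')))
      (w' : mor (bact (rep a') (rep f') (rep b')) (rep f))
      (P : forall k : irr C, dual_bases (rep k) (rep a ⊗ rep a'))
      (Q : forall s : irr D, dual_bases (rep s) (rep b' ⊗ rep b)),
    mul (tb v w) (tb v' w') =
      tb_reduce
        (bassoc (rep a) (rep a') (rep e') (rep b') (rep b)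
         ∘ bactm (idm (rep a)) v' (idm (rep b)) ∘ v)
        (w ∘ bactm (idm (rep a)) w' (idm (rep b))
         ∘ (bassoc (rep a) (rep a') (rep f') (rep b') (rep b))^†) P Q)
  /\ (forall (a a' : irr C) (b b' : irr D) (c e f h c' e' f' h' : irr M)
      (v : mor (rep c) (bact (rep a) (rep e) (rep b)))
      (w : mor (bact (rep a) (rep f) (rep b)) (rep h))
      (v' : mor (rep c') (bact (rep a') (rep e') (rep b')))
      (w' : mor (bact (rep a') (rep f') (rep b')) (rep h')),
    (f != h') || (e != c') -> mul (tb v w) (tb v' w') = 0).

Definition tube_counit_spec (counit : tube -> K) : Prop :=
  (forall (a : irr C) (b : irr D) (e h : irr M)
      (v : mor (rep h) (bact (rep a) (rep e) (rep b)))
      (w : mor (bact (rep a) (rep e) (rep b)) (rep h)),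
    counit (tb v w) *: idm (rep h) = w ∘ v)
  /\ (forall (a : irr C) (b : irr D) (c e f h : irr M)
      (v : mor (rep c) (bact (rep a) (rep e) (rep b)))
      (w : mor (bact (rep a) (rep f) (rep b)) (rep h)),
    (e != f) || (c != h) -> counit (tb v w) *: idm (rep h) = 0).

Definition tube_comul_spec (comul : tube -> tens tube tube) : Prop :=
  forall (a : irr C) (b : irr D) (c e f h : irr M)
    (v : mor (rep c) (bact (rep a) (rep e) (rep b)))
    (w : mor (bact (rep a) (rep f) (rep b)) (rep h))
    (P : forall i k : irr M,
       dual_bases (rep k) (bact (rep a) (rep i) (rep b))),
  comul (tb v w) =
    \sum_i \sum_k \sum_(p < db_size (P i k))
      tb (db_vec (P i k) p) w ⊠ tb v (db_covec (P i k) p).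

Definition tube_anti_spec (anti : tube -> tube) : Prop :=
  forall (a : irr C) (b : irr D) (c e f h : irr M)
    (v : mor (rep c) (bact (rep a) (rep e) (rep b)))
    (w : mor (bact (rep a) (rep f) (rep b)) (rep h)),
  anti (tb v w) = (qdimM f / qdimM h) *: tb (flat w) (sharp v).

Definition tube_star_spec (star : tube -> tube) : Prop :=
  forall (a : irr C) (b : irr D) (c e f h : irr M)
    (v : mor (rep c) (bact (rep a) (rep e) (rep b)))
    (w : mor (bact (rep a) (rep f) (rep b)) (rep h)),
  star (tb v w) = (qdimM e / qdimM c) *: tb (flat v^†) (sharp w^†).

End Tube.

(* Main.v *)
Require Import Defs.
From mathcomp Require Import all_boot all_order all_algebra.
From mathcomp Require Import boolp ring reals complex.

Set Implicit Arguments.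
Unset Strict Implicit.
Unset Printing Implicit Defensive.
Import Order.TTheory GRing.Theory Num.Theory.
Import Defs.
Local Open Scope ring_scope.

(* Write T m = a ⊗ m ⊗ b.  The tube algebra is the coend, over all objects a and b,
   of Hom(c, T e) ⊗ Hom(T f, h): an element v ⊗ w may be written over an arbitrary
   composite T of the action functors, subject to v ⊗ w t = t v ⊗ w for every natural
   transformation t induced by morphisms of C and D.  Since these functors compose
   strictly, the axioms of a weak bialgebra become identities between composites of
   v's and w's, the sums over bases being Casimir elements that slide along morphisms.
   For the antipode, the trace property shows that w_p^flat and (d_i/d_k) v_p^sharp are
   dual bases, and S (v ⊗ w) = d_f/d_h w^flat ⊗ v^sharp then holds over every T with a
   dual compatible with the trace; dualities being stable under composition and
   reversal, S is antimultiplicative and the involution, which is S after the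
   multiplicative map v ⊗ w |-> w^† ⊗ v^†, is an involution.  Finally the coefficient
   phi of the unit object satisfies phi(x^* x) = \sum N d_h/d_f |x_pq|^2 on orthonormal
   bases, so that left multiplication is a faithful *-representation. *)

(** * Linear maps and orthonormal bases *)

(** The obstacle is that the antipode and the involution are prescribed on irreducible labels with
    chosen duals, while a product of two labels breaks up into simple summands whose chosen duals
    bear no direct relation to the reversed product of the duals. [tanti_dual] removes the choice:
    the identity of a dual functor is a sum over simple summands of mates of the embeddings
    ([mate_sum]), and these mates cross the bracket by dinaturality. Accordingly the record
    [duality] keeps exactly what composition and reversal preserve, namely the zig-zag equations and
    a trace identity.

    The weights come from that trace identity: tr(w v) = tr(v w) compares a scalar on h with a
    partial trace, which is a scalar on f, whence d_f/d_h.

    The number N of the positive form arises because, by transposition and Schur's lemma, every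
    induced transformation from ā ⊗ (a ⊗ m ⊗ b) ⊗ b̄ to m is a multiple of [cap]; N adds up the
    squared moduli of the multiples that factor through simple summands of the two unit objects. *)

Section LinearFunctions.
Variable K : fieldType.

Lemma lin_D (U V : lmodType K) (f : U -> V) :
  linear f -> forall x y, f (x + y) = f x + f y.
Proof. by move=> Hf x y; have := Hf 1 x y; rewrite !scale1r. Qed.

Lemma lin_0 (U V : lmodType K) (f : U -> V) : linear f -> f 0 = 0.
Proof. by move=> Hf; apply: (@addrI _ (f 0)); rewrite -lin_D // !addr0. Qed.

Lemma lin_Z (U V : lmodType K) (f : U -> V) :
  linear f -> forall a x, f (a *: x) = a *: f x.
Proof. by move=> Hf a x; have := Hf a x 0; rewrite (lin_0 Hf) !addr0. Qed.

Lemma lin_N (U V : lmodType K) (f : U -> V) : linear f -> forall x, f (- x) = - f x.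
Proof. by move=> Hf x; rewrite -scaleN1r lin_Z // scaleN1r. Qed.

Lemma lin_B (U V : lmodType K) (f : U -> V) :
  linear f -> forall x y, f (x - y) = f x - f y.
Proof. by move=> Hf x y; rewrite lin_D // lin_N. Qed.

Lemma lin_sum (U V : lmodType K) (f : U -> V) : linear f ->
  forall I (r : seq I) P F, f (\sum_(i <- r | P i) F i) = \sum_(i <- r | P i) f (F i).
Proof.
move=> Hf I r P F; apply: (big_morph f); first exact: lin_D.
exact: lin_0.
Qed.

Definition bilin (U V W : lmodType K) (B : U -> V -> W) :=
  (forall v, linear (B^~ v)) /\ (forall u, linear (B u)).

Lemma lin_comp (U V W : lmodType K) (g : V -> W) (f : U -> V) :
  linear g -> linear f -> linear (fun x => g (f x)).
Proof. by move=> Hg Hf a x y; rewrite Hf Hg. Qed.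

Lemma lin_id (U : lmodType K) : linear (fun x : U => x).
Proof. by []. Qed.

Lemma lin_scale (U V : lmodType K) (f : U -> V) c : linear f -> linear (fun x => c *: f x).
Proof. by move=> Hf a x y; rewrite Hf scalerDr !scalerA mulrC. Qed.

Lemma lin_scalel (U V : lmodType K) (f : U -> K) (v : V) :
  scalar f -> linear (fun x => f x *: v).
Proof. by move=> Hf a x y; rewrite Hf scalerDl scalerA. Qed.

Lemma lin_bigsum (U V : lmodType K) I (r : seq I) P (f : I -> U -> V) :
  (forall i, linear (f i)) -> linear (fun x => \sum_(i <- r | P i) f i x).
Proof.
move=> Hf a x y; rewrite scaler_sumr -big_split /=.
by apply: eq_bigr => i _; rewrite Hf.
Qed.

End LinearFunctions.

Section Orthonormal.
Variables (K : numClosedFieldType) (V : vectType K) (h : V -> V -> K).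
Hypothesis h_lin : forall x, scalar (h x).
Hypothesis h_herm : forall x y, h y x = (h x y)^*.
Hypothesis h_pos : forall x, x != 0 -> 0 < h x x.

Let h_sum x I (r : seq I) P F :
  h x (\sum_(i <- r | P i) F i) = \sum_(i <- r | P i) h x (F i).
Proof. exact: (@lin_sum _ V K^o). Qed.

Let hZr x a y : h x (a *: y) = a * h x y.
Proof. exact: (@lin_Z _ V K^o). Qed.

Let hZl x a y : h (a *: x) y = a^* * h x y.
Proof. by rewrite (h_herm y) hZr rmorphM (h_herm y x). Qed.

Let hBr x y z : h x (y - z) = h x y - h x z.
Proof. exact: (@lin_B _ V K^o). Qed.

Definition orthonormal_fam n (b : 'I_n -> V) := forall i j, h (b i) (b j) = (i == j)%:R.

Let resid n (b : 'I_n -> V) x := x - \sum_i h (b i) x *: b i.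

Let resid_orth n (b : 'I_n -> V) x i : orthonormal_fam b -> h (b i) (resid b x) = 0.
Proof.
move=> Hb; rewrite hBr h_sum (bigD1 i) //= hZr Hb eqxx mulr1 big1 ?addr0 ?subrr //.
by move=> j ji; rewrite hZr Hb eq_sym (negbTE ji) mulr0.
Qed.

(** One Gram-Schmidt step: the nonzero residual is orthogonal to b and is divided by its norm. *)
Let extend n (b : 'I_n -> V) x : orthonormal_fam b -> resid b x != 0 ->
  exists b' : 'I_n.+1 -> V, orthonormal_fam b'.
Proof.
move=> Hb; set y := resid b x => y0.
have hy := h_pos y0.
pose u := (sqrtC (h y y))^-1 *: y.
have hu : h u u = 1.
  rewrite hZl hZr mulrA.
  have sr : sqrtC (h y y) \is Num.real by rewrite ger0_real // sqrtC_ge0 ltW.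
  rewrite (CrealP _); last by rewrite realV.
  by rewrite -invfM -expr2 sqrtCK mulVf // gt_eqF.
have hbu i : h (b i) u = 0 by rewrite hZr resid_orth // mulr0.
exists (fun i => if unlift ord_max i is Some j then b j else u) => i j.
case: unliftP => [i'|] ->; case: unliftP => [j'|] ->.
- by rewrite Hb (inj_eq lift_inj).
- by rewrite hbu eq_sym (negbTE (neq_lift _ _)).
- by rewrite (h_herm (b _)) hbu conjC0 (negbTE (neq_lift _ _)).
- by rewrite hu eqxx.
Qed.

Let orthonormal_free n (b : 'I_n -> V) : orthonormal_fam b -> free [tuple b i | i < n].
Proof.
move=> Hb; apply/freeP => k; under eq_bigr do rewrite -tnth_nth tnth_mktuple.
move=> H0 i; have : h (b i) (\sum_i k i *: b i) = 0 by rewrite H0 -(scale0r 0) hZr mul0r.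
rewrite h_sum (bigD1 i) //= hZr Hb eqxx mulr1 big1 ?addr0 // => j ji.
by rewrite hZr Hb eq_sym (negbTE ji) mulr0.
Qed.

Let orthonormal_size n (b : 'I_n -> V) : orthonormal_fam b -> (n <= \dim {:V})%N.
Proof.
move/orthonormal_free; rewrite /free => /eqP; rewrite size_tuple => <-.
by apply: dimvS; apply: subvf.
Qed.

Lemma orthonormal_basis_exists : exists b : 'I_(\dim {:V}) -> V,
  orthonormal_fam b /\ forall x, x = \sum_i h (b i) x *: b i.
Proof.
have main n : (n <= \dim {:V})%N -> exists b : 'I_n -> V, orthonormal_fam b.
  elim: n => [|n IH] nV; first by exists (fun=> 0) => -[].
  have [b Hb] := IH (ltnW nV).
  have [x xb] : exists x, x \notin <<[tuple b i | i < n]>>%VS.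
    apply/not_existsP => H; move: nV; apply/negP; rewrite -leqNgt.
    have /dimvS sV : (fullv <= <<[tuple b i | i < n]>>)%VS.
      by apply/subvP => x _; have /negP := H x; rewrite negbK.
    by apply: leq_trans sV _; rewrite (leq_trans (dim_span _)) // size_tuple.
  apply: (@extend n b x Hb); apply: contra xb; rewrite subr_eq0 => /eqP ->.
  apply: memv_suml => i _; apply: memvZ; apply: memv_span.
  by apply/mapP; exists i; rewrite ?mem_enum.
have [b Hb] := main _ (leqnn _); exists b; split=> // x.
(* A nonzero residual would give one more orthonormal, hence free, vector than the dimension
   allows. *)
apply/eqP; rewrite -subr_eq0; apply/negPn/negP => /(extend Hb) [b' /orthonormal_size].
by rewrite ltnn.
Qed.

End Orthonormal.

(** * Semisimple dagger categories *)

Section DagCatLemmas.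
Variables (K : numClosedFieldType) (C : dagcat K).
Implicit Types x y z : C.

Lemma compZl x y z a (g : mor y z) (f : mor x y) : (a *: g) ∘ f = a *: (g ∘ f).
Proof. by rewrite (lin_Z (comp_linl f)). Qed.
Lemma compZr x y z a (g : mor y z) (f : mor x y) : g ∘ (a *: f) = a *: (g ∘ f).
Proof. by rewrite (lin_Z (comp_linr g)). Qed.
Lemma comp0l x y z (f : mor x y) : (0 : mor y z) ∘ f = 0.
Proof. exact: (lin_0 (comp_linl f)). Qed.
Lemma comp0r x y z (g : mor y z) : g ∘ (0 : mor x y) = 0.
Proof. exact: (lin_0 (comp_linr g)). Qed.
Lemma compBr x y z (g : mor y z) (f f' : mor x y) : g ∘ (f - f') = g ∘ f - g ∘ f'.
Proof. exact: (lin_B (comp_linr g)). Qed.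
Lemma comp_suml x y z I (r : seq I) P (F : I -> mor y z) (f : mor x y) :
  (\sum_(i <- r | P i) F i) ∘ f = \sum_(i <- r | P i) (F i ∘ f).
Proof. exact: (lin_sum (comp_linl f)). Qed.
Lemma comp_sumr x y z I (r : seq I) P (F : I -> mor x y) (g : mor y z) :
  g ∘ (\sum_(i <- r | P i) F i) = \sum_(i <- r | P i) (g ∘ F i).
Proof. exact: (lin_sum (comp_linr g)). Qed.

Lemma dagD x y (f g : mor x y) : (f + g)^† = f^† + g^†.
Proof. by have := dag_antilin 1 f g; rewrite scale1r conjC1 scale1r. Qed.
Lemma dag0 x y : (0 : mor x y)^† = 0.
Proof. by apply: (@addrI _ (0^†)); rewrite -dagD !addr0. Qed.
Lemma dagZ x y a (f : mor x y) : (a *: f)^† = a^* *: f^†.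
Proof. by have := dag_antilin a f 0; rewrite dag0 !addr0. Qed.
Lemma dag_id x : (idm x)^† = idm x.
Proof. by rewrite -[LHS]comp1m -{1}[idm x]dagK -dag_comp comp1m dagK. Qed.
Lemma dag_sum x y I (r : seq I) P (F : I -> mor x y) :
  (\sum_(i <- r | P i) F i)^† = \sum_(i <- r | P i) (F i)^†.
Proof. by apply: big_morph; [exact: dagD | exact: dag0]. Qed.
Lemma dag_inj x y : injective (@dag K C x y).
Proof. exact: can_inj (@dagK _ _ _ _). Qed.
Lemma dag_eq0r x y (f : mor x y) : f ∘ f^† = 0 -> f = 0.
Proof. by rewrite -{1}[f]dagK => /dag_eq0 H; rewrite -[f]dagK H dag0. Qed.

Lemma comp_id0 x y (f : mor x y) : idm x = 0 -> f = 0.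
Proof. by move=> H; rewrite -[f]compm1 H comp0r. Qed.

(** Taken as a coordinate, so that it is linear for every x; it recovers f when x is simple
    ([scE]). *)
Definition sc x (f : mor x x) : K := coord [tuple idm x] ord0 f.

Lemma sc_lin x : scalar (@sc x).
Proof. by move=> a u v; rewrite /sc linearP. Qed.

Section Simple.
Variables (x : C) (sx : simple x).

Lemma simple_id_neq0 : idm x != 0.
Proof.
apply/eqP => H; have := sx; rewrite /simple.
suff -> : fullv = 0%VS :> {vspace mor x x} by rewrite dimv0.
by apply/eqP; rewrite -subv0; apply/subvP => f _; rewrite (comp_id0 f H) mem0v.
Qed.

Lemma simple_line : fullv = <[idm x]>%VS.
Proof.
apply/esym/eqP; rewrite -(geq_leqif (dimv_leqif_eq (subvf _))).
by rewrite dim_vline simple_id_neq0 sx.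
Qed.

Lemma scE (f : mor x x) : f = sc f *: idm x.
Proof.
have Hf : f \in <<[tuple idm x]>>%VS by rewrite /= span_seq1 -simple_line memvf.
by rewrite {1}(coord_span Hf) big_ord1.
Qed.

Lemma sc_inj a b : a *: idm x = b *: idm x -> a = b.
Proof.
move/eqP; rewrite -subr_eq0 -scalerBl scaler_eq0 (negbTE simple_id_neq0) orbF.
by rewrite subr_eq0 => /eqP.
Qed.

Lemma sc_scale a : sc (a *: idm x) = a.
Proof. by apply: sc_inj; rewrite -scE. Qed.

Lemma sc_dag (f : mor x x) : sc f^† = (sc f)^*.
Proof. by rewrite {1}(scE f) dagZ dag_id sc_scale. Qed.

Lemma sc_comp (f g : mor x x) : sc (f ∘ g) = sc f * sc g.
Proof. by rewrite {1}(scE f) {1}(scE g) compZl compZr comp1m scalerA sc_scale. Qed.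

(** [dag_pos] replaces f by an endomorphism g of the simple object x, and g^† g is the scalar |sc
    g|^2. *)
Lemma sc_ge0 y (f : mor x y) : 0 <= sc (f^† ∘ f).
Proof.
have [g ->] := dag_pos f.
by rewrite (scE g) dagZ dag_id compZl compZr comp1m scalerA sc_scale mulrC mul_conjC_ge0.
Qed.

Lemma sc_gt0 y (f : mor x y) : f != 0 -> 0 < sc (f^† ∘ f).
Proof.
move=> f0; rewrite lt_neqAle sc_ge0 andbT eq_sym; apply: contra f0 => /eqP H.
by apply/eqP; apply: dag_eq0; rewrite (scE (_ ∘ _)) H scale0r.
Qed.

End Simple.

End DagCatLemmas.

Section UCatLemmas.
Variables (K : numClosedFieldType) (C : ucat K).
Implicit Types (x y z : C) (i j k : irr C).

Let sI i := rep_simple i.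

(** Both f^† f and f f^† are scalars, equal because f f^† f can be read in two ways. If f is nonzero
    this scalar is positive, and f^† divided by it inverts f. *)
Lemma schur i j (f : mor (rep i) (rep j)) : i != j -> f = 0.
Proof.
move=> /eqP ij; apply/eqP; apply/negPn/negP => f0; apply: ij; apply: rep_inj.
have l0 := sc_gt0 (sI i) f0.
have m0 : sc (f ∘ f^†) = sc (f^† ∘ f).
  apply/eqP; rewrite -subr_eq0.
  have : sc (f ∘ f^†) *: f - sc (f^† ∘ f) *: f = 0.
    have -> : sc (f ∘ f^†) *: f = f ∘ f^† ∘ f.
      by rewrite [in RHS](scE (sI j) (f ∘ f^†)) compZl comp1m.
    have -> : sc (f^† ∘ f) *: f = f ∘ (f^† ∘ f).
      by rewrite [in RHS](scE (sI i) (f^† ∘ f)) compZr compm1.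
    by rewrite compA subrr.
  by move/eqP; rewrite -scalerBl scaler_eq0 (negbTE f0) orbF.
exists f, ((sc (f^† ∘ f))^-1 *: f^†); rewrite compZl compZr; split.
  by rewrite {2}(scE (sI i) (_ ∘ _)) scalerA mulVf ?scale1r // gt_eqF.
by rewrite (scE (sI j) (_ ∘ _)) m0 scalerA mulVf ?scale1r // gt_eqF.
Qed.

(* The identity of [rep i] if i = j, and 0 otherwise: composing with [dl i j]
   replaces Kronecker deltas together with the transports they would require. *)
Definition dl i j : mor (rep i) (rep j) :=
  match i =P j with
  | ReflectT e => eq_rect i (fun k => mor (rep i) (rep k)) (idm (rep i)) j e
  | ReflectF _ => 0
  end.

Lemma dl_id i : dl i i = idm (rep i).
Proof. by rewrite /dl; case: eqP => // e; rewrite (eq_axiomK e). Qed.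
Lemma dl_neq i j : i != j -> dl i j = 0.
Proof. by rewrite /dl; case: eqP. Qed.

Lemma dl_dag i j : (dl i j)^† = dl j i.
Proof.
have [->|ij] := eqVneq i j; first by rewrite dl_id dag_id.
by rewrite !dl_neq ?dag0 // eq_sym.
Qed.

Definition scd i j (f : mor (rep i) (rep j)) : K := sc (dl j i ∘ f).

Lemma scd_lin i j : scalar (@scd i j).
Proof. by move=> a f g; rewrite /scd comp_linr sc_lin. Qed.

Lemma scdE i j (f : mor (rep i) (rep j)) : f = scd f *: dl i j.
Proof.
have [ij|ij] := eqVneq i j; last by rewrite (schur f ij) dl_neq // scaler0.
by move: f; case: j / ij => f; rewrite dl_id /scd dl_id comp1m; apply: scE.
Qed.

Lemma scd_neq i j (f : mor (rep i) (rep j)) : i != j -> scd f = 0.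
Proof. by move=> ij; rewrite (schur f ij) (lin_0 (@scd_lin i j : linear (_ : _ -> K^o))). Qed.

Lemma scd_sc i (f : mor (rep i) (rep i)) : scd f = sc f.
Proof. by rewrite /scd dl_id comp1m. Qed.

Let onb_def i x : exists b : 'I_(\dim {:@mor K C (rep i) x}) -> mor (rep i) x,
  orthonormal_fam (fun u v => sc (u^† ∘ v)) b
  /\ forall f, f = \sum_p sc ((b p)^† ∘ f) *: b p.
Proof.
apply: orthonormal_basis_exists.
- by move=> u a f g; rewrite comp_linr sc_lin.
- by move=> u v; rewrite -sc_dag // dag_comp dagK.
- by move=> u; apply: sc_gt0.
Qed.

Definition onb_size i x := \dim {:@mor K C (rep i) x}.
Definition onb i x : 'I_(onb_size i x) -> mor (rep i) x := sval (cid (onb_def i x)).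

Lemma onb_orth i x p q : (@onb i x p)^† ∘ @onb i x q = (p == q)%:R *: idm (rep i).
Proof.
by rewrite (scE (sI i) (_ ∘ _)); congr (_ *: _); apply: (svalP (cid (onb_def i x))).1.
Qed.

Lemma onb_exp i x (f : mor (rep i) x) : f = \sum_p sc ((@onb i x p)^† ∘ f) *: onb p.
Proof. exact: (svalP (cid (onb_def i x))).2. Qed.

Lemma onb_coexp i x (f : mor x (rep i)) :
  f = \sum_p sc (f ∘ @onb i x p) *: (onb p)^†.
Proof.
apply: dag_inj; rewrite [LHS]onb_exp dag_sum; apply: eq_bigr => p _.
by rewrite dagZ dagK -sc_dag // dag_comp.
Qed.

(* The Casimir element \sum_p p ⊗ p^* of Hom(i,x) ⊗ Hom(x,i), seen through B. *)
Definition cas (U : zmodType) i x (B : mor (rep i) x -> mor x (rep i) -> U) : U :=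
  \sum_p B (@onb i x p) (onb p)^†.

(** Both sides expand into the matrix entries sc(q^† f p) of f. *)
Lemma cas_slide (U : lmodType K) i x y (f : mor x y)
    (B : mor (rep i) y -> mor x (rep i) -> U) : bilin B ->
  \sum_p B (@onb i y p) ((onb p)^† ∘ f) = \sum_p B (f ∘ @onb i x p) (onb p)^†.
Proof.
move=> [Bl Br]; transitivity (\sum_q \sum_p
    sc ((@onb i y q)^† ∘ f ∘ @onb i x p) *: B (onb q) (onb p)^†).
  apply: eq_bigr => q _; rewrite {1}[_ ∘ f]onb_coexp (lin_sum (Br _)).
  by apply: eq_bigr => p _; rewrite (lin_Z (Br _)).
rewrite exchange_big; apply: eq_bigr => p _.
rewrite [in RHS](onb_exp (f ∘ onb p)) (lin_sum (Bl _)).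
by apply: eq_bigr => q _; rewrite (lin_Z (Bl _)) compA.
Qed.

(** The reproducing identity alone characterises the Casimir element. This gives independence of the
    basis, and later admits families obtained by bending ([flat_resolve]) or from the summands of
    the unit ([cas_unit]). *)
Lemma cas_resolve (U : lmodType K) i x (B : mor (rep i) x -> mor x (rep i) -> U)
    (I : finType) (v : I -> mor (rep i) x) (w : I -> mor x (rep i)) :
  bilin B -> (forall f, f = \sum_p sc (w p ∘ f) *: v p) ->
  \sum_p B (v p) (w p) = cas B.
Proof.
move=> [Bl Br] H; transitivity (\sum_p \sum_q sc (w p ∘ onb q) *: B (v p) (onb q)^†).
  apply: eq_bigr => p _; rewrite {1}(onb_coexp (w p)) (lin_sum (Br _)).
  by apply: eq_bigr => q _; rewrite (lin_Z (Br _)).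
rewrite exchange_big; apply: eq_bigr => q _.
rewrite [X in B X _](H (onb q)) (lin_sum (Bl _)).
by apply: eq_bigr => p _; rewrite (lin_Z (Bl _)).
Qed.

Lemma cas_dual (U : lmodType K) i x (B : mor (rep i) x -> mor x (rep i) -> U)
    (P : dual_bases (rep i) x) : bilin B ->
  \sum_(p < db_size P) B (db_vec P p) (db_covec P p) = cas B.
Proof.
move=> HB; apply: cas_resolve => // f.
have -> : f = \sum_p coord [tuple db_vec P p | p < db_size P] p f *: db_vec P p.
  rewrite {1}(coord_basis (db_basis P) (memvf f)).
  by apply: eq_bigr => p _; rewrite -tnth_nth tnth_mktuple.
apply: eq_bigr => p _; congr (_ *: _).
rewrite comp_sumr (bigD1 p) //= compZr db_dual eqxx big1 ?addr0 ?sc_scale //.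
by move=> q qp; rewrite compZr db_dual eq_sym (negbTE qp) scaler0.
Qed.

Lemma cas_rep (U : lmodType K) i j (B : mor (rep i) (rep j) -> mor (rep j) (rep i) -> U) :
  bilin B -> cas B = B (dl i j) (dl j i).
Proof.
move=> [Bl Br]; have [ij|ij] := eqVneq i j; last first.
  rewrite (dl_neq ij) (lin_0 (Bl _)) /cas big1 // => p _.
  by rewrite (schur (onb p) ij) (lin_0 (Bl _)).
case: j / ij B Bl Br => B Bl Br; rewrite dl_id.
have E f : f = \sum_(p < 1) sc (idm (rep i) ∘ f) *: idm (rep i).
  by rewrite big_ord1 comp1m; apply: scE.
by rewrite -(cas_resolve (conj Bl Br) E) big_ord1.
Qed.

(** An isomorphism f onto a representative satisfies f^† = l g with g its inverse and l > 0;
    dividing f by the square root of l makes it unitary. *)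
Lemma simple_rep x : simple x -> exists i (u : mor x (rep i)), u^† ∘ u = idm x /\ u ∘ u^† = idm (rep i).
Proof.
move=> sx; have [i [f [g [gf fg]]]] := rep_surj sx; exists i.
have f0 : f != 0.
  by apply/eqP => H; have := simple_id_neq0 sx; rewrite -gf H comp0r eqxx.
have l0 := sc_gt0 sx f0; set l := sc _ in l0.
have E : f^† = l *: g by rewrite -[f^†]compm1 -fg compA (scE sx (f^† ∘ f)) compZl comp1m.
have sr : sqrtC l \is Num.real by rewrite ger0_real // sqrtC_ge0 ltW.
have lE : (sqrtC l)^-1 * (sqrtC l)^-1 * l = 1.
  by rewrite -invfM -expr2 sqrtCK mulVf // gt_eqF.
exists ((sqrtC l)^-1 *: f); rewrite dagZ (CrealP _) ?realV // E scalerA.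
by rewrite !(compZl, compZr) gf fg !scalerA mulrAC lE mulrA lE !scale1r.
Qed.

(** By semisimplicity it suffices to test on f : s → x with s simple, and s may be replaced by a
    representative i. The Casimir element of Hom(k, x) then slides along f to Hom(k, i), where only
    k = i contributes. *)
Lemma onb_full x : \sum_i \sum_p @onb i x p ∘ (onb p)^† = idm x.
Proof.
have main s (f : mor s x) : simple s -> (\sum_i \sum_p @onb i x p ∘ (onb p)^†) ∘ f = f.
  move=> ss; have [i [u [uu _]]] := simple_rep ss.
  have -> : f = (f ∘ u^†) ∘ u by rewrite -compA uu compm1.
  rewrite compA; congr (_ ∘ u); set g := f ∘ _; rewrite comp_suml.
  have E k : (\sum_p @onb k x p ∘ (onb p)^†) ∘ g = g ∘ dl k i ∘ dl i k.
    rewrite comp_suml; under eq_bigr do rewrite -compA.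
    rewrite (@cas_slide _ k _ _ g (fun a b => a ∘ b)); last first.
      by split=> ? ? ? ?; [apply: comp_linl | apply: comp_linr].
    apply: (@cas_rep _ k i (fun a b => g ∘ a ∘ b)).
    by split=> ? ? ? ?; [rewrite comp_linr comp_linl | apply: comp_linr].
  rewrite (bigD1 i) //= E dl_id !compm1 big1 ?addr0 // => k ki.
  by rewrite E dl_neq // comp0r comp0l.
have [n [s [io [[_ _ H] ss]]]] := ucat_semisimple x.
rewrite -[LHS]compm1 -{1 2}H comp_sumr; apply: eq_bigr => k _.
by rewrite compA main.
Qed.

End UCatLemmas.

Arguments onb {K C i x} p.

(** * Decomposition of an object into representatives *)

Section OrthonormalIndex.
Variables (K : numClosedFieldType) (C : ucat K).
Implicit Types x y : C.

(** The simple summands of x with multiplicity; [ov t] is the isometry of the summand t. *)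
Definition ix x : finType := {i : irr C & 'I_(onb_size i x)}.
Definition ov x (t : ix x) : mor (rep (tag t)) x := onb (tagged t).

Lemma ix_sum (U : zmodType) x (F : forall i, 'I_(onb_size i x) -> U) :
  \sum_i \sum_p F i p = \sum_(t : ix x) F (tag t) (tagged t).
Proof. exact: (@sig_big_dep U 0 +%R _ _ xpredT (fun _ => xpredT) F). Qed.

Lemma ov_full x : \sum_(t : ix x) ov t ∘ (ov t)^† = idm x.
Proof. by rewrite -[RHS]onb_full ix_sum. Qed.

Variable U : lmodType K.

Lemma ov_slide x y (f : mor x y) (B : forall i, mor (rep i) y -> mor x (rep i) -> U) :
  (forall i, bilin (B i)) ->
  \sum_(t : ix y) B _ (ov t) ((ov t)^† ∘ f) = \sum_(t : ix x) B _ (f ∘ ov t) (ov t)^†.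
Proof.
move=> HB; rewrite -(ix_sum (fun i p => B i (onb p) ((onb p)^† ∘ f))).
rewrite -(ix_sum (fun i p => B i (f ∘ onb p) (onb p)^†)).
by apply: eq_bigr => i _; apply: cas_slide.
Qed.

Lemma ov_dual x (P : forall i, dual_bases (rep i) x)
    (B : forall i, mor (rep i) x -> mor x (rep i) -> U) :
  (forall i, bilin (B i)) ->
  \sum_i \sum_(p < db_size (P i)) B i (db_vec (P i) p) (db_covec (P i) p)
  = \sum_(t : ix x) B _ (ov t) (ov t)^†.
Proof.
move=> HB; rewrite -(ix_sum (fun i p => B i (onb p) (onb p)^†)).
by apply: eq_bigr => i _; rewrite cas_dual.
Qed.

Lemma ov_rep j (B : forall i, mor (rep i) (rep j) -> mor (rep j) (rep i) -> U) :
  (forall i, bilin (B i)) ->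
  \sum_(t : ix (rep j)) B _ (ov t) (ov t)^† = B j (idm _) (idm _).
Proof.
move=> HB; rewrite -(ix_sum (fun i p => B i (onb p) (onb p)^†)).
rewrite (bigD1 j) //= -/(cas (B j)) cas_rep // dl_id big1 ?addr0 // => i ij.
by rewrite -/(cas (B i)) cas_rep // dl_neq // (lin_0 ((HB i).1 _)).
Qed.

End OrthonormalIndex.

(** * Coherence of the two-sided action *)

Section Coherence.
Variables (K : numClosedFieldType) (C D : monoidal K) (M : bimodcat C D).
Implicit Types (a : C) (b : D) (m : M).

Lemma unitary_comp (E : dagcat K) (x y z : E) (v : mor y z) (u : mor x y) :
  unitary v -> unitary u -> unitary (v ∘ u).
Proof.
move=> [v1 v2] [u1 u2]; rewrite /unitary !dag_comp; split.
  by rewrite compA -(compA _ v^†) v1 compm1.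
by rewrite compA -(compA v) u2 compm1.
Qed.

Lemma unitary_dag (E : dagcat K) (x y : E) (u : mor x y) : unitary u -> unitary u^†.
Proof. by case=> ? ?; split; rewrite dagK. Qed.

Lemma unitary_id (E : dagcat K) (x : E) : unitary (idm x).
Proof. by split; rewrite dag_id comp1m. Qed.

Lemma unitary_injl (E : dagcat K) (x y z : E) (u : mor y z) (f g : mor x y) :
  unitary u -> u ∘ f = u ∘ g -> f = g.
Proof. by move=> [u1 _] H; rewrite -[f]comp1m -u1 -compA H compA u1 comp1m. Qed.

Lemma unitary_injr (E : dagcat K) (x y z : E) (u : mor x y) (f g : mor y z) :
  unitary u -> f ∘ u = g ∘ u -> f = g.
Proof. by move=> [_ u2] H; rewrite -[f]compm1 -u2 compA H -compA u2 compm1. Qed.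

Lemma unitary_transpose (E : dagcat K) (x y y' z : E) (u : mor x y) (v : mor y' z)
    (f : mor x y') (g : mor y z) :
  unitary u -> unitary v -> v ∘ f = g ∘ u -> f ∘ u^† = v^† ∘ g.
Proof.
move=> [u1 u2] [v1 v2] H.
by rewrite -[f]comp1m -v1 -(compA v^†) H -?compA u2 compm1.
Qed.

(* Rewrites with f ∘ g = h inside a right-nested composite. *)
Lemma rea (E : dagcat K) (x y z t : E) (f : mor z t) (g : mor y z) (h : mor y t) :
  f ∘ g = h -> forall k : mor x y, f ∘ (g ∘ k) = h ∘ k.
Proof. by move=> <- k; rewrite compA. Qed.

Lemma lactm_unitary a a' m m' (f : mor a a') (g : mor m m') :
  unitary f -> unitary g -> unitary (f ▷' g).
Proof. by move=> [f1 f2] [g1 g2]; split; rewrite lactm_dag -lactm_comp ?(f1, f2, g1, g2) lactm1. Qed.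

Lemma ractm_unitary m m' b b' (g : mor m m') (f : mor b b') :
  unitary f -> unitary g -> unitary (g ◁' f).
Proof. by move=> [f1 f2] [g1 g2]; split; rewrite ractm_dag -ractm_comp ?(f1, f2, g1, g2) ractm1. Qed.

Lemma lactm_faithful m m' (f g : mor m m') :
  idm (munit : C) ▷' f = idm munit ▷' g -> f = g.
Proof.
by move=> H; apply: (unitary_injr (lunit_unitary (C := C) (D := D) m)); rewrite -!lunit_nat H.
Qed.

Lemma ractm_faithful m m' (f g : mor m m') :
  f ◁' idm (munit : D) = g ◁' idm munit -> f = g.
Proof.
by move=> H; apply: (unitary_injr (runit_unitary (C := C) (D := D) m)); rewrite -!runit_nat H.
Qed.

(* Kelly's argument: both sides agree after acting by the unit object and
   precomposing with the unitaries of the pentagon. *)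
Lemma lunit_lact a m : lunit (a ▷ m) ∘ lassoc munit a m = mlunit a ▷' idm m.
Proof.
apply: lactm_faithful.
apply: (@unitary_injr M _ _ _ (lassoc munit (munit ⊗ a) m ∘ (massoc munit munit a ▷' idm m))).
  apply: unitary_comp; first exact: lassoc_unitary.
  by apply: lactm_unitary; [exact: massoc_unitary | exact: unitary_id].
rewrite -?compA -[in LHS](comp1m (idm munit)) lactm_comp -?compA.
have := lpentagon (munit : C) munit a m; rewrite -?compA => <-.
rewrite (rea (ltriangle _ _)) -lactm1 -lassoc_nat.
by rewrite (rea (esym (lassoc_nat _ _ _))) -compA -lactm_comp comp1m mtriangle.
Qed.

(** The mirror image of [lunit_lact], from the right pentagon and triangle. *)
Lemma runit_ract m b : (idm m ◁' mrunit b) ∘ rassoc m b munit = runit (m ◁ b).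
Proof.
apply: ractm_faithful.
apply: (@unitary_injl M _ _ _ (rassoc m b munit)); first exact: rassoc_unitary.
rewrite -[in LHS](comp1m (idm munit)) ractm_comp.
rewrite -rtriangle -ractm1 !(rea (rassoc_nat _ _ _)) -?compA.
have := rpentagon m b (munit : D) munit; rewrite -?compA => ->.
by rewrite (rea (esym (ractm_comp _ _ _ _))) comp1m mtriangle.
Qed.

Lemma cassoc_nat_dag a a1 m m1 b b1 (f : mor a a1) (g : mor m m1) (h : mor b b1) :
  (cassoc a1 m1 b1)^† ∘ (f ▷' (g ◁' h)) = ((f ▷' g) ◁' h) ∘ (cassoc a m b)^†.
Proof.
by symmetry; apply: unitary_transpose; [exact: cassoc_unitary.. | exact: cassoc_nat].
Qed.

Lemma lactm_compr a m m' m'' (f : mor m' m'') (g : mor m m') :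
  idm a ▷' (f ∘ g) = (idm a ▷' f) ∘ (idm a ▷' g).
Proof. by rewrite -lactm_comp comp1m. Qed.

Lemma ractm_compl b m m' m'' (f : mor m' m'') (g : mor m m') :
  (f ∘ g) ◁' idm b = (f ◁' idm b) ∘ (g ◁' idm b).
Proof. by rewrite -ractm_comp comp1m. Qed.

(** [bassoc] combines three constraints, so its pentagon is glued from four: the left one (E1), the
    two mixed ones (E2, and H inside E3), and the right one at the end. The associator of D appears
    inverted because objects acting from the right compose in the opposite order. *)
Lemma bassoc_pentagon a a' a'' m b'' b' b :
  bassoc a (a' ⊗ a'') m (b'' ⊗ b') b ∘ bactm (idm a) (bassoc a' a'' m b'' b') (idm b)
  = bactm (massoc a a' a'') (idm m) (massoc b'' b' b)^†
    ∘ bassoc (a ⊗ a') a'' m b'' (b' ⊗ b) ∘ bassoc a a' (bact a'' m b'') b' b.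
Proof.
have E1 : (lassoc a (a' ⊗ a'') m)^† ∘ (idm a ▷' (lassoc a' a'' m)^†)
  = (massoc a a' a'' ▷' idm m) ∘ (lassoc (a ⊗ a') a'' m)^† ∘ (lassoc a a' (a'' ▷ m))^†.
  have := lpentagon a a' a'' m => /(congr1 dag); rewrite !dag_comp !lactm_dag !dag_id.
  move=> H; rewrite -?compA H compA -lactm_comp (massoc_unitary _ _ _).2 comp1m lactm1.
  by rewrite comp1m.
have E2 : ((lassoc a (a' ⊗ a'') m)^† ◁' idm b'') ∘ (cassoc a ((a' ⊗ a'') ▷ m) b'')^†
    ∘ (idm a ▷' (((lassoc a' a'' m)^† ◁' idm b'') ∘ (cassoc a' (a'' ▷ m) b'')^†))
  = ((massoc a a' a'' ▷' idm m) ◁' idm b'') ∘ ((lassoc (a ⊗ a') a'' m)^† ◁' idm b'')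
    ∘ (cassoc (a ⊗ a') (a'' ▷ m) b'')^† ∘ (lassoc a a' (bact a'' m b''))^†.
  have := cpentagonl a a' (a'' ▷ m) b'' => /(congr1 dag).
  rewrite !dag_comp !lactm_dag !ractm_dag !dag_id -?compA => ->.
  rewrite lactm_compr (rea (cassoc_nat_dag _ _ _)) -?compA.
  by rewrite !(rea (esym (ractm_compl _ _ _))) E1.
have E3 : ((lassoc a (a' ⊗ a'') m)^† ◁' idm (b'' ⊗ b'))
    ∘ (cassoc a ((a' ⊗ a'') ▷ m) (b'' ⊗ b'))^†
    ∘ (idm a ▷' bassoc a' a'' m b'' b')
  = ((massoc a a' a'' ▷' idm m) ◁' idm (b'' ⊗ b'))
    ∘ bassoc (a ⊗ a') a'' m b'' b' ∘ ((lassoc a a' (bact a'' m b''))^† ◁' idm b')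
    ∘ (cassoc a (a' ▷ bact a'' m b'') b')^†.
  rewrite /bassoc lactm_compr -?compA.
  have H : (cassoc a ((a' ⊗ a'') ▷ m) (b'' ⊗ b'))^† ∘ (idm a ▷' rassoc ((a' ⊗ a'') ▷ m) b'' b')
    = rassoc (a ▷ (a' ⊗ a'') ▷ m) b'' b' ∘ ((cassoc a ((a' ⊗ a'') ▷ m) b'')^† ◁' idm b')
      ∘ (cassoc a (((a' ⊗ a'') ▷ m) ◁ b'') b')^†.
    have [c1 c2] := cassoc_unitary a ((a' ⊗ a'') ▷ m) b''.
    have [c3 c4] := cassoc_unitary a (((a' ⊗ a'') ▷ m) ◁ b'') b'.
    have [c5 c6] := cassoc_unitary a ((a' ⊗ a'') ▷ m) (b'' ⊗ b').
    apply: (@unitary_injr M _ _ _ (cassoc a (((a' ⊗ a'') ▷ m) ◁ b'') b'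
      ∘ (cassoc a ((a' ⊗ a'') ▷ m) b'' ◁' idm b'))).
      apply: unitary_comp; first exact: cassoc_unitary.
      by apply: ractm_unitary; [exact: unitary_id | exact: cassoc_unitary].
    have := cpentagonr a ((a' ⊗ a'') ▷ m) b'' b'; rewrite -?compA => <-.
    rewrite compA c5 comp1m (compA _^† _ (_ ◁' _)) c3 comp1m.
    by rewrite -ractm_compl c1 ractm1 compm1.
  rewrite (rea H) -?compA (cassoc_nat_dag) -!tensorm1.
  rewrite (rea (esym (rassoc_nat _ _ _))) -?compA (rea (esym (rassoc_nat _ _ _))) -?compA.
  congr (_ ∘ _); rewrite !(rea (esym (ractm_compl _ _ _))).
  by rewrite E2 (ractm_compl b'').
rewrite {1}/bassoc /bactm -?compA -ractm_compl compA E3 -?compA.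
rewrite [bassoc a a' _ b' b]/bassoc.
rewrite !(ractm_compl b) -(tensorm1 b' b) (rea (esym (rassoc_nat _ _ _))) -?compA.
have := rpentagon ((a ⊗ a' ⊗ a'') ▷ m) b'' b' b.
move/(congr1 (fun f => (idm _ ◁' (massoc b'' b' b)^†) ∘ f)).
rewrite -?compA (rea (esym (ractm_comp _ _ _ _))) comp1m (massoc_unitary _ _ _).1.
rewrite ractm1 comp1m => H.
rewrite -[massoc a a' a'' ▷' idm m in RHS]compm1 -[(massoc b'' b' b)^†]comp1m ractm_comp.
rewrite -?compA (compA (rassoc _ b'' (b' ⊗ b))) (rea H) -?compA.
by rewrite -(tensorm1 (b'' ⊗ b') b) (rea (esym (rassoc_nat _ _ _))) -?compA.
Qed.

Lemma lassoc_nat_dag a a1 a' a1' m m1 (f : mor a a1) (f' : mor a' a1') (g : mor m m1) :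
  (lassoc a1 a1' m1)^† ∘ (f ▷' (f' ▷' g)) = ((f ⊗' f') ▷' g) ∘ (lassoc a a' m)^†.
Proof.
by symmetry; apply: unitary_transpose; [exact: lassoc_unitary.. | exact: lassoc_nat].
Qed.

Lemma bassoc_nat a a1 a' a1' m m1 b b1 b' b1' (f : mor a a1) (f' : mor a' a1')
    (g : mor m m1) (h' : mor b' b1') (h : mor b b1) :
  bassoc a1 a1' m1 b1' b1 ∘ bactm f (bactm f' g h') h
  = bactm (f ⊗' f') g (h' ⊗' h) ∘ bassoc a a' m b' b.
Proof.
rewrite /bassoc /bactm -?compA -ractm_comp comp1m -?compA cassoc_nat_dag.
rewrite (rea (esym (ractm_comp _ _ _ _))) lassoc_nat_dag comp1m.
rewrite -[h' in LHS]compm1 ractm_comp -?compA -[h in LHS]compm1 ractm_comp.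
by rewrite (rea (rassoc_nat _ _ _)) -?compA.
Qed.

Lemma bassoc_unitary a a' m b' b : unitary (bassoc a a' m b' b).
Proof.
apply: unitary_comp; first exact: rassoc_unitary.
apply: (ractm_unitary (unitary_id _)); apply: unitary_comp.
  by apply: (ractm_unitary (unitary_id _)); apply: unitary_dag; apply: lassoc_unitary.
by apply: unitary_dag; apply: cassoc_unitary.
Qed.

Lemma bunit_unitary m : unitary (bunit m : mor _ m).
Proof. by apply: unitary_comp; [exact: lunit_unitary | exact: runit_unitary]. Qed.

Lemma bunit_nat m m' (g : mor m m') : bunit m' ∘ bactm (idm _) g (idm _) = g ∘ bunit m.
Proof. by rewrite /bunit /bactm -compA runit_nat compA lunit_nat -compA. Qed.

Lemma bunit_bact_r a m b :
  bactm (mrunit a) (idm m) (mlunit b) ∘ bassoc a munit m munit b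
  = bactm (idm a) (bunit m) (idm b).
Proof.
have rn (x x' : M) (f : mor x x') :
    (f ◁' mlunit b) ∘ rassoc x munit b = (f ∘ runit x) ◁' idm b.
  by rewrite ractm_compl -rtriangle compA -ractm_comp compm1 comp1m.
rewrite /bassoc /bactm (rea (rn _ _ _)) -ractm_compl; congr (_ ◁' _).
rewrite -?compA (rea (runit_nat _)) -ltriangle -ctriangler /bunit lactm_compr -?compA.
have [_ ->] := cassoc_unitary a (munit ▷ m) (munit : D).
by rewrite compm1 (compA (lassoc _ _ _)) (lassoc_unitary _ _ _).2 comp1m.
Qed.

Lemma bunit_bact_l a m b :
  bactm (mlunit a) (idm m) (mrunit b) ∘ bassoc munit a m b munit = bunit (bact a m b).
Proof.
have rn (x x' : M) (f : mor x x') :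
    (f ◁' mrunit b) ∘ rassoc x b munit = (f ◁' idm b) ∘ runit (x ◁ b).
  by rewrite -runit_ract compA -ractm_comp comp1m compm1.
rewrite /bassoc /bactm (rea (rn _ _ _)) -?compA runit_nat -?compA.
rewrite (rea (esym (ractm_compl _ _ _))) -lunit_lact -?compA.
rewrite (lassoc_unitary _ _ _).2 compm1 -ctrianglel -?compA.
by rewrite (compA (cassoc _ _ _)) (cassoc_unitary _ _ _).2 comp1m.
Qed.

Lemma bactm_comp a a' a'' m m' m'' b b' b'' (f' : mor a' a'') (f : mor a a')
    (g' : mor m' m'') (g : mor m m') (h' : mor b' b'') (h : mor b b') :
  bactm (f' ∘ f) (g' ∘ g) (h' ∘ h) = bactm f' g' h' ∘ bactm f g h.
Proof. by rewrite /bactm lactm_comp ractm_comp. Qed.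

Lemma bactm_comp2 a m m' m'' b (g' : mor m' m'') (g : mor m m') :
  bactm (idm a) (g' ∘ g) (idm b) = bactm (idm a) g' (idm b) ∘ bactm (idm a) g (idm b).
Proof. by rewrite -bactm_comp !comp1m. Qed.

Lemma bactm1 a m b : bactm (idm a) (idm m) (idm b) = idm _.
Proof. by rewrite /bactm lactm1 ractm1. Qed.

Lemma bactm_dag a a' m m' b b' (f : mor a a') (g : mor m m') (h : mor b b') :
  (bactm f g h)^† = bactm f^† g^† h^†.
Proof. by rewrite /bactm ractm_dag lactm_dag. Qed.

Lemma bactm_lin1 a a' m m' b b' (g : mor m m') (h : mor b b') :
  linear (fun f : mor a a' => bactm f g h).
Proof. exact: (lin_comp (ractm_linl h) (lactm_linl g)). Qed.

Lemma bactm_lin2 a a' m m' b b' (f : mor a a') (h : mor b b') :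
  linear (fun g : mor m m' => bactm f g h).
Proof. exact: (lin_comp (ractm_linl h) (lactm_linr f)). Qed.

Lemma bactm_lin3 a a' m m' b b' (f : mor a a') (g : mor m m') :
  linear (fun h : mor b b' => bactm f g h).
Proof. exact: ractm_linr. Qed.

Lemma bactm_unitary a a' m m' b b' (f : mor a a') (g : mor m m') (h : mor b b') :
  unitary f -> unitary g -> unitary h -> unitary (bactm f g h).
Proof. by move=> *; apply: ractm_unitary => //; apply: lactm_unitary. Qed.

(* Locked copies, which rewriting with associativity cannot unfold. *)
Definition bas a a' m b' b : mor (bact a (bact a' m b') b) (bact (a ⊗ a') m (b' ⊗ b)) :=
  locked (bassoc a a' m b' b).
Definition bun m : mor (bact munit m munit) m := locked (bunit m).

Lemma basE a a' m b' b : bas a a' m b' b = bassoc a a' m b' b.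
Proof. by rewrite /bas -lock. Qed.
Lemma bunE m : bun m = bunit m. Proof. by rewrite /bun -lock. Qed.

Lemma bas_unitary a a' m b' b : unitary (bas a a' m b' b).
Proof. rewrite basE; exact: bassoc_unitary. Qed.
Lemma bun_unitary m : unitary (bun m).
Proof. rewrite bunE; exact: bunit_unitary. Qed.

Lemma bas_pentagon a a' a'' m b'' b' b :
  bas a (a' ⊗ a'') m (b'' ⊗ b') b ∘ bactm (idm a) (bas a' a'' m b'' b') (idm b)
  = bactm (massoc a a' a'') (idm m) (massoc b'' b' b)^†
    ∘ (bas (a ⊗ a') a'' m b'' (b' ⊗ b) ∘ bas a a' (bact a'' m b'') b' b).
Proof. by rewrite !basE bassoc_pentagon -compA. Qed.

Lemma bas_nat a a1 a' a1' m m1 b b1 b' b1' (f : mor a a1) (f' : mor a' a1')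
    (g : mor m m1) (h' : mor b' b1') (h : mor b b1) :
  bas a1 a1' m1 b1' b1 ∘ bactm f (bactm f' g h') h
  = bactm (f ⊗' f') g (h' ⊗' h) ∘ bas a a' m b' b.
Proof. by rewrite !basE bassoc_nat. Qed.

Lemma bun_nat m m' (g : mor m m') : bun m' ∘ bactm (idm _) g (idm _) = g ∘ bun m.
Proof. by rewrite !bunE bunit_nat. Qed.

Lemma bun_bact_r a m b :
  bactm (mrunit a) (idm m) (mlunit b) ∘ bas a munit m munit b
  = bactm (idm a) (bun m) (idm b).
Proof. by rewrite basE bunE bunit_bact_r. Qed.

Lemma bun_bact_l a m b :
  bactm (mlunit a) (idm m) (mrunit b) ∘ bas munit a m b munit = bun (bact a m b).
Proof. by rewrite basE bunE bunit_bact_l. Qed.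

End Coherence.

(** * Functors given by the action *)

Section Functors.
Variables (K : numClosedFieldType) (C D : monoidal K) (M : bimodcat C D).
Implicit Types m : M.

(* Endofunctors of M isomorphic to the action of some objects of C and D.
   Their composition is strict, which keeps associators out of sight. *)
Record efun := EFun {
  eA : C;
  eB : D;
  eob :> M -> M;
  emor : forall m m', mor m m' -> mor (eob m) (eob m');
  ekap : forall m, mor (eob m) (bact eA m eB);
  ekap_unitary : forall m, unitary (ekap m);
  ekap_nat : forall m m' (f : mor m m'),
    ekap m' ∘ emor f = bactm (idm eA) f (idm eB) ∘ ekap m }.

Implicit Types F G H : efun.

Lemma emorE F m m' (f : mor m m') :
  emor F f = (ekap F m')^† ∘ bactm (idm _) f (idm _) ∘ ekap F m.
Proof. by rewrite -compA -ekap_nat compA (ekap_unitary _ _).1 comp1m. Qed.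

Lemma emor_comp F m m' m'' (g : mor m' m'') (f : mor m m') :
  emor F (g ∘ f) = emor F g ∘ emor F f.
Proof.
apply: (unitary_injl (ekap_unitary F m'')).
by rewrite compA !ekap_nat -?compA ekap_nat compA -bactm_comp !comp1m.
Qed.

Lemma emor_id F m : emor F (idm m) = idm (F m).
Proof. by apply: (unitary_injl (ekap_unitary F m)); rewrite ekap_nat bactm1 comp1m compm1. Qed.

Lemma emor_lin F m m' : linear (@emor F m m').
Proof. by move=> a f g; rewrite !emorE bactm_lin2 comp_linr comp_linl. Qed.

Lemma emor_dag F m m' (f : mor m m') : (emor F f)^† = emor F f^†.
Proof. by rewrite !emorE !dag_comp bactm_dag dagK !dag_id compA. Qed.

Lemma emorZ F m m' a (f : mor m m') : emor F (a *: f) = a *: emor F f.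
Proof. exact: (lin_Z (@emor_lin F m m')). Qed.

Lemma emor0 F m m' : emor F (0 : mor m m') = 0.
Proof. exact: (lin_0 (@emor_lin F m m')). Qed.

Lemma emor_sum F m m' I (r : seq I) P (f : I -> mor m m') :
  emor F (\sum_(i <- r | P i) f i) = \sum_(i <- r | P i) emor F (f i).
Proof. exact: (lin_sum (@emor_lin F m m')). Qed.

Definition ebact (a : C) (b : D) : efun.
Proof.
refine (@EFun a b (fun m => bact a m b) (fun m m' f => bactm (idm a) f (idm b))
  (fun m => idm _) _ _); first by move=> m; apply: unitary_id.
by move=> m m' f; rewrite comp1m compm1.
Defined.

Definition eid : efun.
Proof.
refine (@EFun munit munit (fun m => m) (fun m m' f => f) (fun m => (bun m)^†) _ _).
  by move=> m; apply: unitary_dag; apply: bun_unitary.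
move=> m m' f; apply/esym; apply: unitary_transpose; [exact: bun_unitary.. | ].
exact: bun_nat.
Defined.

Definition ecomp F G : efun.
Proof.
refine (@EFun (eA F ⊗ eA G) (eB G ⊗ eB F) (fun m => F (G m))
  (fun m m' f => emor F (emor G f))
  (fun m => bas (eA F) (eA G) m (eB G) (eB F)
     ∘ bactm (idm _) (ekap G m) (idm _) ∘ ekap F (G m)) _ _).
  move=> m; apply: unitary_comp; last exact: ekap_unitary.
  apply: unitary_comp; first exact: bas_unitary.
  by apply: bactm_unitary; [exact: unitary_id | exact: ekap_unitary | exact: unitary_id].
move=> m m' f; rewrite -?compA ekap_nat (rea (esym (bactm_comp _ _ _ _ _ _))).
rewrite ekap_nat bactm_comp -?compA (rea (bas_nat _ _ _ _ _)) !tensorm1 -?compA.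
by [].
Defined.

(** t is the transformation induced by f and g. As [ekap] is unitary, f and g determine t, so
    equations between transformations can be checked in C and D. *)
Definition enat F G (f : mor (eA F) (eA G)) (g : mor (eB F) (eB G))
    (t : forall m, mor (F m) (G m)) :=
  forall m, ekap G m ∘ t m = bactm f (idm m) g ∘ ekap F m.

Lemma enat_natural F G f g t : @enat F G f g t ->
  forall m m' (u : mor m m'), t m' ∘ emor F u = emor G u ∘ t m.
Proof.
move=> Ht m m' u; apply: (unitary_injl (ekap_unitary G m')).
rewrite compA Ht -?compA ekap_nat (rea (esym (bactm_comp _ _ _ _ _ _))).
rewrite (rea (ekap_nat G u)) -?compA Ht (rea (esym (bactm_comp _ _ _ _ _ _))).
by rewrite !compm1 !comp1m.
Qed.

Lemma enat_comp F G H f g t f' g' t' :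
  @enat G H f' g' t' -> @enat F G f g t ->
  @enat F H (f' ∘ f) (g' ∘ g) (fun m => t' m ∘ t m).
Proof.
move=> Ht' Ht m; rewrite compA Ht' -?compA Ht compA -bactm_comp.
by rewrite comp1m.
Qed.

Lemma enat_dag F G f g t : @enat F G f g t -> @enat G F f^† g^† (fun m => (t m)^†).
Proof.
move=> Ht m; apply: (unitary_injr (unitary_dag (ekap_unitary G m))).
rewrite -compA -dag_comp Ht dag_comp compA (ekap_unitary _ _).2 comp1m.
by rewrite bactm_dag dag_id -compA (ekap_unitary _ _).2 compm1.
Qed.

Lemma enat_whiskerl H F G f g t : @enat F G f g t ->
  @enat (ecomp H F) (ecomp H G) (idm (eA H) ⊗' f) (g ⊗' idm (eB H))
    (fun m => emor H (t m)).
Proof.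
move=> Ht m /=; rewrite -?compA ekap_nat (rea (esym (bactm_comp _ _ _ _ _ _))).
rewrite Ht bactm_comp -?compA (rea (bas_nat _ _ _ _ _)) -?compA.
by [].
Qed.

Lemma enat_whiskerr H F G f g t : @enat F G f g t ->
  @enat (ecomp F H) (ecomp G H) (f ⊗' idm (eA H)) (idm (eB H) ⊗' g)
    (fun m => t (H m)).
Proof.
move=> Ht m /=; rewrite -?compA Ht (rea (esym (bactm_comp _ _ _ _ _ _))).
rewrite compm1 !comp1m (rea (esym (bas_nat _ _ _ _ _))) bactm1 -?compA.
by rewrite (rea (esym (bactm_comp _ _ _ _ _ _))) !compm1 comp1m.
Qed.

(** The components are identities because composition is strict; the associators survive only in the
    inducing morphisms, where [bas_pentagon] accounts for them. *)
Lemma enat_assoc F G H :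
  @enat (ecomp (ecomp F G) H) (ecomp F (ecomp G H)) (massoc _ _ _) (massoc _ _ _)^†
    (fun m => idm (F (G (H m)))).
Proof.
move=> m /=; rewrite compm1 !bactm_comp2 -?compA (rea (bas_pentagon _ _ _ _ _ _ _)) -?compA.
rewrite -(tensorm1 (eA F) (eA G)) -(tensorm1 (eB G) (eB F)).
by rewrite (rea (esym (bas_nat _ _ _ _ _))) -?compA.
Qed.

Lemma enat_unitr F : @enat (ecomp F eid) F (mrunit _) (mlunit _) (fun m => idm (F m)).
Proof.
move=> m /=; rewrite compm1 -?compA (rea (bun_bact_r _ _ _)) (rea (esym (bactm_comp _ _ _ _ _ _))).
by rewrite (bun_unitary _).2 !comp1m bactm1 comp1m.
Qed.

Lemma enat_unitl F : @enat (ecomp eid F) F (mlunit _) (mrunit _) (fun m => idm (F m)).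
Proof.
move=> m /=; rewrite compm1 -?compA.
have -> : bactm (idm munit) (ekap F m) (idm munit) ∘ (bun (F m))^†
    = (bun (bact (eA F) m (eB F)))^† ∘ ekap F m.
  by apply: unitary_transpose (bun_nat _); exact: bun_unitary.
rewrite (rea (bun_bact_l _ _ _)) compA (bun_unitary _).2 comp1m.
by [].
Qed.

End Functors.

Arguments emor {K C D M} e {m m'} f.
Arguments ekap {K C D M} e m.
Arguments enat {K C D M} F G f g t.

Section ENatural.
Variables (K : numClosedFieldType) (C D : monoidal K) (M : bimodcat C D).
Implicit Types F G H : efun M.

(** Hides the inducing morphisms where their existence suffices, so that chains of whiskerings need
    not display them. *)
Definition isE F G (t : forall m : M, mor (F m) (G m)) := exists f g, enat F G f g t.

Lemma isE_ext F G t t' : @isE F G t -> (forall m, t m = t' m) -> isE t'.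
Proof. by move=> [f [g H]] E; exists f, g => m; rewrite -E. Qed.

Lemma isE_comp F G H t t' : @isE G H t' -> @isE F G t -> @isE F H (fun m => t' m ∘ t m).
Proof. by move=> [? [? H1]] [? [? H2]]; do 2 eexists; apply: enat_comp H1 H2. Qed.

Lemma isE_dag F G t : @isE F G t -> @isE G F (fun m => (t m)^†).
Proof. by move=> [? [? H1]]; do 2 eexists; apply: enat_dag H1. Qed.

Lemma isE_whiskerl H F G t : @isE F G t -> @isE (ecomp H F) (ecomp H G) (fun m => emor H (t m)).
Proof. by move=> [? [? H1]]; do 2 eexists; apply: enat_whiskerl H1. Qed.

Lemma isE_whiskerr H F G t : @isE F G t -> @isE (ecomp F H) (ecomp G H) (fun m => t (H m)).
Proof. by move=> [? [? H1]]; do 2 eexists; apply: enat_whiskerr H1. Qed.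

Lemma isE_assoc F G H : @isE (ecomp (ecomp F G) H) (ecomp F (ecomp G H)) (fun m => idm (F (G (H m)))).
Proof. by do 2 eexists; apply: enat_assoc. Qed.

Lemma isE_assocV F G H : @isE (ecomp F (ecomp G H)) (ecomp (ecomp F G) H) (fun m => idm (F (G (H m)))).
Proof. by apply: isE_ext (isE_dag (isE_assoc F G H)) _ => m; apply: dag_id. Qed.

Lemma isE_unitr F : @isE (ecomp F (eid M)) F (fun m => idm (F m)).
Proof. by do 2 eexists; apply: enat_unitr. Qed.
Lemma isE_unitl F : @isE (ecomp (eid M) F) F (fun m => idm (F m)).
Proof. by do 2 eexists; apply: enat_unitl. Qed.
Lemma isE_unitlV F : @isE F (ecomp (eid M) F) (fun m => idm (F m)).
Proof. by apply: isE_ext (isE_dag (isE_unitl F)) _ => m; apply: dag_id. Qed.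

Lemma isE_natural F G t : @isE F G t ->
  forall m m' (u : mor m m'), t m' ∘ emor F u = emor G u ∘ t m.
Proof. by move=> [? [? H]]; apply: enat_natural H. Qed.

Lemma isE_bactm (a : C) (b : D) G (f : mor a (eA G)) (g : mor b (eB G)) :
  @enat _ _ _ _ (ebact M a b) G f g (fun m => (ekap G m)^† ∘ bactm f (idm m) g).
Proof. by move=> m; rewrite compA (ekap_unitary _ _).2 comp1m compm1. Qed.

End ENatural.

(** * Zig-zag equations for the action functors *)

Section Duality.
Variables (K : numClosedFieldType) (C D : umfc K) (M : bimodcat C D).
Implicit Types (a : irr C) (b : irr D) (m : M).

Definition T a b : efun M := ebact M (rep a) (rep b).
Definition Td a b : efun M := T (dual a) (dual b).

Definition lcap a b m : mor (Td a b (T a b m)) m := locked (cap a m b).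
Lemma lcapE a b m : lcap a b m = cap a m b.
Proof. by rewrite /lcap -lock. Qed.

(** Since b acts from the right, its second pair of duality maps is used: ev_b^† here and coev_b^†
    in [cap]. *)
Definition cup a b m : mor m (T a b (Td a b m)) :=
  locked ((bas _ _ m _ _)^† ∘ bactm (coev a) (idm m) (ev b)^† ∘ (bun m)^†).

Lemma lcap_enat a b :
  @enat _ _ _ _ (ecomp (Td a b) (T a b)) (eid M) (ev a) (coev b)^† (lcap a b).
Proof.
move=> m; rewrite lcapE /cap -bunE -basE /=.
by rewrite -?compA (compA _^†) (bun_unitary m).1 comp1m bactm1 !compm1.
Qed.

Lemma cup_enat a b :
  @enat _ _ _ _ (eid M) (ecomp (T a b) (Td a b)) (coev a) (ev b)^† (cup a b).
Proof.
move=> m; rewrite /cup -lock /= bactm1 !compm1 -?compA compA (bas_unitary _ _ _ _ _).2.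
by rewrite comp1m.
Qed.

(** The inducing morphisms compose to a zig-zag of a in C and the dagger of the same zig-zag of b in
    D, both identities. *)
Lemma cap_cup a b m : emor (T a b) (lcap a b m) ∘ cup a b (T a b m) = idm (T a b m).
Proof.
have H := enat_comp (enat_unitr (T a b)) (enat_comp (enat_whiskerl (T a b) (lcap_enat a b))
  (enat_comp (enat_assoc (T a b) (Td a b) (T a b)) (enat_comp (enat_whiskerr (T a b) (cup_enat a b))
  (enat_dag (enat_unitl (T a b)))))).
have {H} := H m; rewrite dag_id compm1 !comp1m => H.
apply: (unitary_injl (ekap_unitary (T a b) m)); rewrite H compm1.
have [E1 _] := ev_coev a; have [E2 _] := ev_coev b.
move/(congr1 dag): E2; rewrite !dag_comp !tensorm_dag !dag_id !dagK => E2.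
rewrite -?compA in E1 E2; rewrite E1 E2.
by rewrite bactm1 /= !comp1m.
Qed.

Lemma cup_cap a b m : lcap a b (Td a b m) ∘ emor (Td a b) (cup a b m) = idm (Td a b m).
Proof.
have H := enat_comp (enat_unitl (Td a b)) (enat_comp (enat_whiskerr (Td a b) (lcap_enat a b))
  (enat_comp (enat_dag (enat_assoc (Td a b) (T a b) (Td a b))) (enat_comp (enat_whiskerl (Td a b) (cup_enat a b))
  (enat_dag (enat_unitr (Td a b)))))).
have {H} := H m; rewrite !dag_id compm1 !comp1m => H.
apply: (unitary_injl (ekap_unitary (Td a b) m)); rewrite H compm1.
have [_ E1] := ev_coev a; have [_ E2] := ev_coev b.
move/(congr1 dag): E2; rewrite !dag_comp !tensorm_dag !dag_id => E2.
rewrite -?compA in E1 E2; rewrite E1; rewrite dagK in E2; rewrite E2.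
by rewrite bactm1 /= !comp1m.
Qed.

End Duality.

(** * Traces and dualities *)

Section Trace.
Variables (K : numClosedFieldType) (C D : umfc K) (M : bimod C D).
Implicit Types (x y : M) (i : irr M).

Lemma trZ x a (f : mor x x) : tr (a *: f) = a * tr f.
Proof. exact: (@lin_Z _ _ K^o _ (@tr_lin _ _ _ _ x)). Qed.
Lemma trB x (f g : mor x x) : tr (f - g) = tr f - tr g.
Proof. exact: (@lin_B _ _ K^o _ (@tr_lin _ _ _ _ x)). Qed.
Lemma tr_sum x I (r : seq I) P (f : I -> mor x x) :
  tr (\sum_(i <- r | P i) f i) = \sum_(i <- r | P i) tr (f i).
Proof. exact: (@lin_sum _ _ K^o _ (@tr_lin _ _ _ _ x)). Qed.

Lemma qdimM_gt0 i : 0 < qdimM i.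
Proof. by apply: tr_gt0; apply: rep_simple. Qed.
Lemma qdimM_neq0 i : qdimM i != 0.
Proof. by rewrite gt_eqF // qdimM_gt0. Qed.

Lemma tr_sc i (f : mor (rep i) (rep i)) : tr f = sc f * qdimM i.
Proof. by rewrite {1}(scE (rep_simple i) f) trZ. Qed.

(** Testing against g^† writes tr(g^† g) as a sum over the simple summands t of x of nonnegative
    terms, each the norm square of g ∘ [ov t] times a quantum dimension. *)
Lemma tr_nondegenerate x y (g : mor x y) : (forall f : mor y x, tr (f ∘ g) = 0) -> g = 0.
Proof.
move=> H; rewrite -[g]compm1 -ov_full comp_sumr big1 // => t _; rewrite compA.
suff /dag_eq0 -> : (g ∘ ov t)^† ∘ (g ∘ ov t) = 0 by rewrite comp0l.
have Hs : \sum_(t : ix x) sc ((g ∘ ov t)^† ∘ (g ∘ ov t)) * qdimM (tag t) = 0.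
  transitivity (tr (g^† ∘ g)); last exact: H.
  rewrite -[g^† ∘ g]compm1 -ov_full comp_sumr tr_sum.
  apply: eq_bigr => u _.
  by rewrite -tr_sc [in RHS]compA [in RHS]tr_cyclic dag_comp -?compA.
have P (u : ix x) : 0 <= sc ((g ∘ ov u)^† ∘ (g ∘ ov u)) * qdimM (tag u).
  by apply: mulr_ge0; [apply: sc_ge0; apply: rep_simple | rewrite ltW // qdimM_gt0].
have := Hs => /(psumr_eq0P (fun u _ => P u)) /(_ t isT) /eqP.
rewrite mulf_eq0 (negbTE (qdimM_neq0 _)) orbF => /eqP E.
by rewrite (scE (rep_simple _) (_ ∘ _)) E scale0r.
Qed.

(* The trace property [dtr] is stable under composition and reversal of dualities,
   and stands in for sphericality of C and D. *)
Record duality := Duality {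
  dG : efun M;
  dQ : efun M;
  dcap : forall m, mor (dQ (dG m)) m;
  dcup : forall m, mor m (dG (dQ m));
  dcapE : isE (F := ecomp dQ dG) (G := eid M) dcap;
  dcupE : isE (F := eid M) (G := ecomp dG dQ) dcup;
  dzig : forall m, emor dG (dcap m) ∘ dcup (dG m) = idm (dG m);
  dzag : forall m, dcap (dQ m) ∘ emor dQ (dcup m) = idm (dQ m);
  dtr : forall m (f : mor (dG m) (dG m)),
    tr f = tr (dcap m ∘ emor dQ f ∘ (dcap m)^†) }.

Lemma dcap_nat (d : duality) m m' (u : mor m m') :
  dcap d m' ∘ emor (dQ d) (emor (dG d) u) = u ∘ dcap d m.
Proof. exact: (isE_natural (dcapE d) u). Qed.

Lemma dcup_nat (d : duality) m m' (u : mor m m') :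
  dcup d m' ∘ u = emor (dG d) (emor (dQ d) u) ∘ dcup d m.
Proof. exact: (isE_natural (dcupE d) u). Qed.

Lemma dcap_natV (d : duality) m m' (u : mor m m') :
  emor (dQ d) (emor (dG d) u) ∘ (dcap d m)^† = (dcap d m')^† ∘ u.
Proof.
by apply: dag_inj; rewrite !dag_comp !emor_dag !dagK dcap_nat.
Qed.

Lemma dcup_natV (d : duality) m m' (u : mor m m') :
  u ∘ (dcup d m)^† = (dcup d m')^† ∘ emor (dG d) (emor (dQ d) u).
Proof. by apply: dag_inj; rewrite !dag_comp !emor_dag !dagK dcup_nat. Qed.

Lemma dzigV (d : duality) m :
  (dcup d (dG d m))^† ∘ emor (dG d) (dcap d m)^† = idm (dG d m).
Proof. by rewrite -emor_dag -dag_comp dzig dag_id. Qed.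

Lemma dzagV (d : duality) m :
  emor (dQ d) (dcup d m)^† ∘ (dcap d (dQ d m))^† = idm (dQ d m).
Proof. by rewrite -emor_dag -dag_comp dzag dag_id. Qed.

Definition dual_T (a : irr C) (b : irr D) : duality.
Proof.
refine (@Duality (T M a b) (Td M a b) (lcap a b) (cup a b) _ _ _ _ _).
- by do 2 eexists; apply: lcap_enat.
- by do 2 eexists; apply: cup_enat.
- exact: cap_cup.
- exact: cup_cap.
- by move=> m f; rewrite tr_ptrace /ptrace lcapE.
Defined.

(** Daggers exchange cap and cup. The trace property then concerns the partial trace on the other
    side; it follows from that of d by cyclicity and the zig-zag equations. *)
Definition dual_rev (d : duality) : duality.
Proof.
refine (@Duality (dQ d) (dG d) (fun m => (dcup d m)^†) (fun m => (dcap d m)^†) _ _ _ _ _).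
- exact: isE_dag (dcupE d).
- exact: isE_dag (dcapE d).
- exact: dzagV.
- exact: dzigV.
- move=> m f; rewrite dagK tr_cyclic dtr !emor_comp -?compA dcap_natV.
  by rewrite (rea (dzagV _ _)) comp1m compA dzag comp1m.
Defined.

Lemma dual_comp_cap (d1 d2 : duality) :
  isE (F := ecomp (ecomp (dQ d2) (dQ d1)) (ecomp (dG d1) (dG d2))) (G := eid M)
    (fun m => dcap d2 m ∘ emor (dQ d2) (dcap d1 (dG d2 m))).
Proof.
set G1 := dG d1; set G2 := dG d2; set Q1 := dQ d1; set Q2 := dQ d2.
have H := isE_comp (dcapE d2) (isE_comp (isE_whiskerl Q2 (isE_unitl G2))
  (isE_comp (isE_whiskerl Q2 (isE_whiskerr G2 (dcapE d1)))
  (isE_comp (isE_whiskerl Q2 (isE_assocV Q1 G1 G2)) (isE_assoc Q2 Q1 (ecomp G1 G2))))).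
by apply: isE_ext H _ => m; rewrite !emor_id comp1m !compm1.
Qed.

Lemma dual_comp_cup (d1 d2 : duality) :
  isE (F := eid M) (G := ecomp (ecomp (dG d1) (dG d2)) (ecomp (dQ d2) (dQ d1)))
    (fun m => emor (dG d1) (dcup d2 (dQ d1 m)) ∘ dcup d1 m).
Proof.
set G1 := dG d1; set G2 := dG d2; set Q1 := dQ d1; set Q2 := dQ d2.
have H := isE_comp (isE_assocV G1 G2 (ecomp Q2 Q1))
  (isE_comp (isE_whiskerl G1 (isE_assoc G2 Q2 Q1))
  (isE_comp (isE_whiskerl G1 (isE_whiskerr Q1 (dcupE d2)))
  (isE_comp (isE_whiskerl G1 (isE_unitlV Q1)) (dcupE d1)))).
by apply: isE_ext H _ => m; rewrite !emor_id !comp1m.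
Qed.

(** By naturality the cap of d1 moves past the cup of d2, after which the zig-zags of both apply in
    turn. *)
Definition dual_comp (d1 d2 : duality) : duality.
Proof.
refine (@Duality (ecomp (dG d1) (dG d2)) (ecomp (dQ d2) (dQ d1)) _ _
  (dual_comp_cap d1 d2) (dual_comp_cup d1 d2) _ _ _).
- move=> m /=; rewrite !emor_comp -?compA.
  have := congr1 (emor (dG d1)) (dcup_nat d2 (dcap d1 (dG d2 m))).
  rewrite !emor_comp => E; rewrite (rea (esym E)) -?compA dzig compm1.
  by rewrite -emor_comp dzig emor_id.
- move=> m /=; rewrite !emor_comp -?compA.
  have := congr1 (emor (dQ d2)) (dcap_nat d1 (dcup d2 (dQ d1 m))).
  rewrite !emor_comp => E; rewrite (rea E) -?compA -emor_comp dzag emor_id compm1.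
  by rewrite dzag.
- move=> m f /=; rewrite dtr dtr !emor_comp !dag_comp -?compA emor_dag.
  by [].
Defined.

End Trace.

Arguments dcap {K C D M} d m.
Arguments dcup {K C D M} d m.

(** * Tensor products and the tube space *)

Section SemiLinear.
Variables (K : numClosedFieldType) (s : {rmorphism K -> K}).

(** With s the identity or the conjugation, one lifting and one extensionality principle serve both
    the linear structure maps and the involution. *)
Definition slin (U V : lmodType K) (f : U -> V) :=
  forall a x y, f (a *: x + y) = s a *: f x + f y.

Definition sbilin (U V W : lmodType K) (B : U -> V -> W) :=
  (forall v, slin (B^~ v)) /\ (forall u, slin (B u)).

Lemma slin_D (U V : lmodType K) (f : U -> V) : slin f -> forall x y, f (x + y) = f x + f y.
Proof. by move=> H x y; have := H 1 x y; rewrite rmorph1 !scale1r. Qed.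

Lemma slin_0 (U V : lmodType K) (f : U -> V) : slin f -> f 0 = 0.
Proof. by move=> Hf; apply: (@addrI _ (f 0)); rewrite -slin_D // !addr0. Qed.

Lemma slin_Z (U V : lmodType K) (f : U -> V) :
  slin f -> forall a x, f (a *: x) = s a *: f x.
Proof. by move=> Hf a x; have := Hf a x 0; rewrite (slin_0 Hf) !addr0. Qed.

Lemma slin_sum (U V : lmodType K) (f : U -> V) : slin f ->
  forall I (r : seq I) P F, f (\sum_(i <- r | P i) F i) = \sum_(i <- r | P i) f (F i).
Proof.
move=> Hf I r P F; apply: (big_morph f); first exact: slin_D.
exact: slin_0.
Qed.

Lemma slin_bigsum (U V : lmodType K) I (r : seq I) P (f : I -> U -> V) :
  (forall i, slin (f i)) -> slin (fun x => \sum_(i <- r | P i) f i x).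
Proof.
move=> Hf a x y; rewrite scaler_sumr -big_split /=.
by apply: eq_bigr => i _; rewrite Hf.
Qed.

End SemiLinear.

Section TensorLemmas.
Variable K : numClosedFieldType.
Implicit Types V W : vectType K.

Lemma pure_linl V W (w : W) : linear (fun v : V => v ⊠ w).
Proof. by move=> a v v'; apply/matrixP => i j; rewrite !mxE linearP mulrDl mulrA. Qed.

Lemma pure_linr V W (v : V) : linear (fun w : W => v ⊠ w).
Proof. by move=> a w w'; apply/matrixP => i j; rewrite !mxE linearP mulrDr mulrCA. Qed.

(** s-linear for any function B; it takes pure tensors to the values of B once B is s-bilinear. *)
Definition tens_lift (s : {rmorphism K -> K}) V W (U : lmodType K) (B : V -> W -> U)
    (t : tens V W) : U :=
  \sum_i \sum_j s (t i j) *: B (vbasis {:V})`_i (vbasis {:W})`_j.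

Lemma tens_lift_slin s V W (U : lmodType K) (B : V -> W -> U) : slin s (tens_lift s B).
Proof.
apply: slin_bigsum => i; apply: slin_bigsum => j a t u.
by rewrite !mxE rmorphD rmorphM scalerDl scalerA.
Qed.

Lemma tens_lift_pure s V W (U : lmodType K) (B : V -> W -> U) v w :
  sbilin s B -> tens_lift s B (v ⊠ w) = B v w.
Proof.
move=> [Bl Br]; rewrite [in RHS](coord_vbasis (memvf v)) (slin_sum (Bl _)).
apply: eq_bigr => i _; rewrite (slin_Z (Bl _)).
rewrite [in RHS](coord_vbasis (memvf w)) (slin_sum (Br _)) scaler_sumr.
by apply: eq_bigr => j _; rewrite (slin_Z (Br _)) mxE rmorphM scalerA.
Qed.

Lemma tens_exp V W (t : tens V W) :
  t = \sum_i \sum_j t i j *: ((vbasis {:V})`_i ⊠ (vbasis {:W})`_j).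
Proof.
have vb (U : vectType K) (i k : 'I_(\dim {:U})) :
    coord (vbasis {:U}) i (vbasis {:U})`_k = (i == k)%:R.
  by rewrite coord_free ?(basis_free (vbasisP _)) // eq_sym.
apply/matrixP => i j; rewrite summxE (bigD1 i) //= summxE (bigD1 j) //=.
rewrite !mxE !vb !eqxx !mulr1 !big1 ?addr0 //.
  move=> k ki; rewrite summxE big1 // => l _.
  by rewrite !mxE vb eq_sym (negbTE ki) mul0r mulr0.
by move=> k kj; rewrite !mxE !vb [j == k]eq_sym (negbTE kj) !mulr0.
Qed.

(** A scalar moves from one leg to the other because both are s-linear, so [sw] is also independent
    of the decomposition for antilinear legs. *)
Lemma sw_pure s V W (U : lmodType K) (B : V -> W -> U) v w :
  sbilin s B -> sw (v ⊠ w) B = B v w.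
Proof.
move=> [Bl Br]; rewrite [in RHS](coord_vbasis (memvf v)) (slin_sum (Bl _)).
apply: eq_bigr => i _; rewrite (slin_Z (Bl _)) -(slin_Z (Br _)).
congr (B _ _); rewrite [in RHS](coord_vbasis (memvf w)) scaler_sumr.
by apply: eq_bigr => j _; rewrite mxE scalerA.
Qed.

Lemma sw_slin s V W (U : lmodType K) (B : V -> W -> U) :
  (forall v, slin s (B v)) -> slin s (fun t : tens V W => sw t B).
Proof.
move=> Br; apply: slin_bigsum => i a t u /=; rewrite -Br; congr (B _ _).
rewrite scaler_sumr -big_split /=; apply: eq_bigr => j _.
by rewrite !mxE scalerDl scalerA.
Qed.

Lemma sw_lin V W (U : lmodType K) (B : V -> W -> U) :
  (forall v, linear (B v)) -> linear (fun t : tens V W => sw t B).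
Proof. exact: (@sw_slin idfun). Qed.

Lemma sw_param_lin V W (U X : lmodType K) (t : tens V W) (B : X -> V -> W -> U) :
  (forall v w, linear (fun x => B x v w)) -> linear (fun x => sw t (B x)).
Proof. by move=> HB; apply: lin_bigsum => i; apply: HB. Qed.

End TensorLemmas.

Section TubeBasics.
Variables (K : numClosedFieldType) (C D : umfc K) (M : bimod C D).
Implicit Types (a : irr C) (b : irr D) (c e f h : irr M).

Section Lift.
Variables (s : {rmorphism K -> K}) (U : lmodType K).
Variable phi : forall a b c e f h, mor (rep c) (bact (rep a) (rep e) (rep b)) ->
  mor (bact (rep a) (rep f) (rep b)) (rep h) -> U.

Definition tube_lift_summand (l : tube_label M) : tube_summand l -> U :=
  match l return tube_summand l -> U with
  | ((a, b), (c, e), (f, h)) => tens_lift s (@phi a b c e f h)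
  end.

Definition tube_lift (x : tube M) : U := \sum_l tube_lift_summand (x l).

Lemma tube_lift_slin : slin s tube_lift.
Proof.
apply: slin_bigsum => -[[[a b] [c e]] [f h]] /= k x y.
by rewrite 2!ffunE; apply: tens_lift_slin.
Qed.

Lemma tube_lift_tb a b c e f h (v : mor (rep c) (bact (rep a) (rep e) (rep b)))
    (w : mor (bact (rep a) (rep f) (rep b)) (rep h)) :
  sbilin s (@phi a b c e f h) -> tube_lift (tb v w) = phi v w.
Proof.
move=> HB; rewrite /tube_lift /tb (bigD1 ((a, b), (c, e), (f, h))) //= ffunE dfwith_in.
rewrite tens_lift_pure // big1 ?addr0 // => l ll.
rewrite ffunE dfwith_out 1?eq_sym //.
case: l {ll} => [[[a' b'] [c' e']] [f' h']] /=.
exact: (slin_0 (@tens_lift_slin _ s _ _ _ _)).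
Qed.

End Lift.

Lemma dsum_in_lin l : linear (@dsum_in K (tube_label M) (@tube_summand _ _ _ M) l).
Proof.
move=> k x y; apply/ffunP => j; rewrite !ffunE.
have [<-|lj] := eqVneq l j; first by rewrite !dfwith_in.
by rewrite !dfwith_out // scaler0 addr0.
Qed.

Lemma tb_bilin a b c e f h : bilin (@tb _ _ _ M a b c e f h).
Proof.
split=> u; apply: (lin_comp (@dsum_in_lin ((a, b), (c, e), (f, h)))).
  exact: pure_linl.
exact: pure_linr.
Qed.

Lemma tube_ind (P : tube M -> Prop) :
  P 0 -> (forall k x y, P x -> P y -> P (k *: x + y)) ->
  (forall a b c e f h (v : mor (rep c) (bact (rep a) (rep e) (rep b)))
    (w : mor (bact (rep a) (rep f) (rep b)) (rep h)), P (tb v w)) ->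
  forall x, P x.
Proof.
move=> P0 PD Ptb x.
have Psum I (r : seq I) (F : I -> tube M) : (forall i, P (F i)) -> P (\sum_(i <- r) F i).
  move=> PF; elim: r => [|i r IH]; first by rewrite big_nil.
  by rewrite big_cons -[F i]scale1r; apply: PD.
have -> : x = \sum_l dsum_in (x l).
  apply/ffunP => j; rewrite (@lin_sum _ _ _ (fun y : tube M => y j)); last first.
    by move=> k u v; rewrite 2!ffunE.
  rewrite (bigD1 j) //= ffunE dfwith_in big1 ?addr0 // => l lj.
  by rewrite ffunE dfwith_out.
apply: (Psum) => l; move: (x l); case: l => [[[a b] [c e]] [f h]] /= t.
rewrite (tens_exp t) (lin_sum (@dsum_in_lin ((a, b), (c, e), (f, h)))).
apply: (Psum) => i; rewrite (lin_sum (@dsum_in_lin ((a, b), (c, e), (f, h)))).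
apply: (Psum) => j; rewrite (lin_Z (@dsum_in_lin ((a, b), (c, e), (f, h)))).
by rewrite -[_ *: _]addr0; apply: PD => //; apply: Ptb.
Qed.

Lemma tube_ext (U : lmodType K) (s : {rmorphism K -> K}) (F G : tube M -> U) :
  slin s F -> slin s G ->
  (forall a b c e f h (v : mor (rep c) (bact (rep a) (rep e) (rep b)))
    (w : mor (bact (rep a) (rep f) (rep b)) (rep h)), F (tb v w) = G (tb v w)) ->
  forall x, F x = G x.
Proof.
move=> HF HG H; apply: tube_ind => //; first by rewrite (slin_0 HF) (slin_0 HG).
by move=> k x y Hx Hy; rewrite HF HG Hx Hy.
Qed.

End TubeBasics.

(** * The bracket and its dinaturality *)

Section Bracket.
Variables (K : numClosedFieldType) (C D : umfc K) (M : bimod C D).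
Implicit Types (a : irr C) (b : irr D) (c e f h : irr M) (F G H : efun M).

Lemma tbl a b c e f h k v v' w :
  @tb _ _ _ M a b c e f h (k *: v + v') w = k *: tb v w + tb v' w.
Proof. by rewrite ((tb_bilin a b c e f h).1 w). Qed.

Lemma tbr a b c e f h k v w w' :
  @tb _ _ _ M a b c e f h v (k *: w + w') = k *: tb v w + tb v w'.
Proof. by rewrite ((tb_bilin a b c e f h).2 v). Qed.

(** The simple summand of F given by a summand i of its object in C and a summand j of its object in
    D. *)
Definition emb F (i : ix (eA F)) (j : ix (eB F)) (m : M) : mor (T M (tag i) (tag j) m) (F m) :=
  locked ((ekap F m)^† ∘ bactm (ov i) (idm m) (ov j)).

Lemma embE F i j m : @emb F i j m = (ekap F m)^† ∘ bactm (ov i) (idm m) (ov j).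
Proof. by rewrite /emb -lock. Qed.

Lemma emb_enat F i j : @enat _ _ _ _ (T M (tag i) (tag j)) F (ov i) (ov j) (@emb F i j).
Proof. by move=> m; rewrite embE; apply: isE_bactm. Qed.

Lemma emb_isE F i j : isE (@emb F i j).
Proof. by do 2 eexists; apply: emb_enat. Qed.

Lemma emb_dag F i j m : (@emb F i j m)^† = bactm (ov i)^† (idm m) (ov j)^† ∘ ekap F m.
Proof. by rewrite embE dag_comp dagK bactm_dag dag_id. Qed.

Lemma emb_full F m : \sum_i \sum_j @emb F i j m ∘ (@emb F i j m)^† = idm (F m).
Proof.
transitivity ((ekap F m)^† ∘ (\sum_i \sum_j
    bactm (ov i ∘ (ov i)^†) (idm m) (ov j ∘ (ov j)^†)) ∘ ekap F m).
  rewrite comp_sumr comp_suml; apply: eq_bigr => i _.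
  rewrite comp_sumr comp_suml; apply: eq_bigr => j _.
  rewrite emb_dag embE -[idm m in RHS]comp1m bactm_comp.
  by rewrite -?compA.
under eq_bigr do rewrite -(lin_sum (bactm_lin3 _ _)) ov_full.
rewrite -(lin_sum (bactm_lin1 _ _)) ov_full bactm1 compm1.
exact: (ekap_unitary _ _).1.
Qed.

(* The bracket <<v, w>> for the objects A, B underlying the functor F. *)
Definition br F c e f h (v : mor (rep c) (F (rep e))) (w : mor (F (rep f)) (rep h)) : tube M :=
  \sum_i \sum_j tb ((@emb F i j _)^† ∘ v) (w ∘ @emb F i j _).

Lemma br_bilin F c e f h : bilin (@br F c e f h).
Proof.
split=> u; apply: lin_bigsum => i; apply: lin_bigsum => j k x y.
  by rewrite comp_linr tbl.
by rewrite comp_linl tbr.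
Qed.

Lemma brl F c e f h k v v' w : @br F c e f h (k *: v + v') w = k *: br v w + br v' w.
Proof. by rewrite ((br_bilin F c e f h).1 w). Qed.
Lemma brr F c e f h k v w w' : @br F c e f h v (k *: w + w') = k *: br v w + br v w'.
Proof. by rewrite ((br_bilin F c e f h).2 v). Qed.

Lemma br_kap F c e f h (v : mor (rep c) (F (rep e))) (w : mor (F (rep f)) (rep h)) :
  br v w = \sum_i \sum_j
    tb (bactm (ov i)^† (idm _) (ov j)^† ∘ (ekap F _ ∘ v))
       (w ∘ (ekap F _)^† ∘ bactm (ov i) (idm _) (ov j)).
Proof.
apply: eq_bigr => i _; apply: eq_bigr => j _.
by rewrite emb_dag embE -?compA.
Qed.

(* Dinaturality: the tube algebra is the coend of Hom(c, F e) ⊗ Hom(F f, h). *)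
Lemma br_nat F G t c e f h (v : mor (rep c) (F (rep e))) (w : mor (G (rep f)) (rep h)) :
  @isE _ _ _ _ F G t -> br v (w ∘ t (rep f)) = br (t (rep e) ∘ v) w.
Proof.
move=> [x [y Ht]]; rewrite !br_kap; pose U0 : lmodType K := tube M.
have tE m : t m ∘ (ekap F m)^† = (ekap G m)^† ∘ bactm x (idm m) y.
  apply: (unitary_injl (ekap_unitary G m)); rewrite compA Ht compA (ekap_unitary _ _).2.
  by rewrite comp1m -compA (ekap_unitary _ _).2 compm1.
pose B k s (p : mor (rep k) (eA G)) (p' : mor (eA F) (rep k))
    (q : mor (rep s) (eB G)) (q' : mor (eB F) (rep s)) :=
  tb (bactm p' (idm _) q' ∘ (ekap F _ ∘ v)) (w ∘ (ekap G _)^† ∘ bactm p (idm _) q).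
have Bp k s q q' : bilin (fun p p' => @B k s p p' q q').
  by split=> u l p p'; rewrite /B bactm_lin1 (comp_linl, comp_linr) (tbl, tbr).
have Bq k s p p' : bilin (@B k s p p').
  by split=> u l q q'; rewrite /B bactm_lin3 (comp_linl, comp_linr) (tbl, tbr).
(* As t is induced by x and y, moving it across the bracket means sliding y through the Casimir
   elements of D and x through those of C. *)
transitivity (\sum_(i : ix (eA F)) \sum_(j : ix (eB F))
    B _ _ (x ∘ ov i) (ov i)^† (y ∘ ov j) (ov j)^†).
  apply: eq_bigr => i _; apply: eq_bigr => j _; rewrite /B; congr tb.
  by rewrite -?compA (rea (tE _)) -?compA -bactm_comp comp1m.
transitivity (\sum_(j : ix (eB G)) \sum_(i : ix (eA F))
    B _ _ (x ∘ ov i) (ov i)^† (ov j) ((ov j)^† ∘ y)).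
  rewrite [RHS]exchange_big; apply: eq_bigr => i _; apply: esym.
  exact: (@ov_slide _ _ U0 _ _ y (fun s q q' => B _ s (x ∘ ov i) (ov i)^† q q')).
rewrite [RHS]exchange_big; apply: eq_bigr => j _.
transitivity (\sum_(i : ix (eA G)) B _ _ (ov i) ((ov i)^† ∘ x) (ov j) ((ov j)^† ∘ y)).
  apply: esym.
  exact: (@ov_slide _ _ U0 _ _ x (fun k p p' => B k _ p p' (ov j) ((ov j)^† ∘ y))).
apply: eq_bigr => i _; rewrite /B; congr tb.
by rewrite (rea (Ht _)) -[idm _ in LHS]comp1m bactm_comp -?compA.
Qed.

Lemma br_natV F G t c e f h (v : mor (rep c) (G (rep e))) (w : mor (F (rep f)) (rep h)) :
  @isE _ _ _ _ F G t -> br v (w ∘ (t (rep f))^†) = br ((t (rep e))^† ∘ v) w.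
Proof. by move=> Ht; apply: (br_nat v w (isE_dag Ht)). Qed.

Lemma br_T a b c e f h (v : mor (rep c) (T M a b (rep e))) (w : mor (T M a b (rep f)) (rep h)) :
  br v w = tb v w.
Proof.
rewrite br_kap; pose U0 : lmodType K := tube M.
pose B k s (p : mor (rep k) (rep a)) p' (q : mor (rep s) (rep b)) q' :=
  tb (bactm p' (idm _) q' ∘ v) (w ∘ bactm p (idm _) q).
have Bp k s q q' : bilin (fun p p' => @B k s p p' q q').
  by split=> u l p p'; rewrite /B bactm_lin1 (comp_linl, comp_linr) (tbl, tbr).
have Bq k s p p' : bilin (@B k s p p').
  by split=> u l q q'; rewrite /B bactm_lin3 (comp_linl, comp_linr) (tbl, tbr).
transitivity (\sum_(i : ix (rep a)) B _ _ (ov i) (ov i)^† (idm (rep b)) (idm _)).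
  apply: eq_bigr => i _.
  rewrite -(@ov_rep _ _ U0 b (fun s q q' => B _ s (ov i) (ov i)^† q q')) //.
  apply: eq_bigr => j _; rewrite /B /= dag_id.
  by rewrite -[v in RHS]comp1m -[w in RHS]compm1.
rewrite (@ov_rep _ _ U0 a (fun k p p' => B k _ p p' (idm _) (idm _))) // /B.
by rewrite !bactm1 -[v in RHS]comp1m -[w in RHS]compm1.
Qed.

(** Arbitrary dual bases give the same value as orthonormal ones, which is what the prescribed
    product formula quantifies over. *)
Lemma br_reduce F c e f h (v : mor (rep c) (F (rep e))) (w : mor (F (rep f)) (rep h))
    (P : forall k : irr C, dual_bases (rep k) (eA F))
    (Q : forall s : irr D, dual_bases (rep s) (eB F)) :
  tb_reduce (ekap F _ ∘ v) (w ∘ (ekap F _)^†) P Q = br v w.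
Proof.
rewrite br_kap /tb_reduce; pose U0 : lmodType K := tube M.
pose B k s (p : mor (rep k) (eA F)) (p' : mor (eA F) (rep k))
    (q : mor (rep s) (eB F)) (q' : mor (eB F) (rep s)) :=
  tb (bactm p' (idm _) q' ∘ (ekap F _ ∘ v)) (w ∘ (ekap F _)^† ∘ bactm p (idm _) q).
have Bp k s q q' : bilin (fun p p' => @B k s p p' q q').
  by split=> u l p p'; rewrite /B bactm_lin1 (comp_linl, comp_linr) (tbl, tbr).
have Bq k s p p' : bilin (@B k s p p').
  by split=> u l q q'; rewrite /B bactm_lin3 (comp_linl, comp_linr) (tbl, tbr).
transitivity (\sum_k \sum_(i < db_size (P k)) \sum_(j : ix (eB F))
    B k _ (db_vec (P k) i) (db_covec (P k) i) (ov j) (ov j)^†).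
  apply: eq_bigr => k _; rewrite exchange_big; apply: eq_bigr => i _.
  exact: (@ov_dual _ _ U0 _ Q (fun s => B k s (db_vec (P k) i) (db_covec (P k) i))).
under eq_bigr do rewrite exchange_big; rewrite exchange_big [RHS]exchange_big.
apply: eq_bigr => j _.
exact: (@ov_dual _ _ U0 _ P (fun k p p' => B k _ p p' (ov j) (ov j)^†)).
Qed.

Lemma br0r F c e f h (v : mor (rep c) (F (rep e))) : br v (0 : mor (F (rep f)) (rep h)) = 0.
Proof. exact: (lin_0 ((br_bilin F c e f h).2 v)). Qed.
Lemma br0l F c e f h (w : mor (F (rep f)) (rep h)) : br (0 : mor (rep c) (F (rep e))) w = 0.
Proof. exact: (lin_0 ((br_bilin F c e f h).1 w)). Qed.
Lemma br_sumr F c e f h (v : mor (rep c) (F (rep e))) I (r : seq I) P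
    (w : I -> mor (F (rep f)) (rep h)) :
  br v (\sum_(i <- r | P i) w i) = \sum_(i <- r | P i) br v (w i).
Proof. exact: (lin_sum ((br_bilin F c e f h).2 v)). Qed.
Lemma br_suml F c e f h (w : mor (F (rep f)) (rep h)) I (r : seq I) P
    (v : I -> mor (rep c) (F (rep e))) :
  br (\sum_(i <- r | P i) v i) w = \sum_(i <- r | P i) br (v i) w.
Proof. exact: (lin_sum ((br_bilin F c e f h).1 w)). Qed.
Lemma brZr F c e f h (v : mor (rep c) (F (rep e))) k (w : mor (F (rep f)) (rep h)) :
  br v (k *: w) = k *: br v w.
Proof. exact: (lin_Z ((br_bilin F c e f h).2 v)). Qed.
Lemma brZl F c e f h (v : mor (rep c) (F (rep e))) k (w : mor (F (rep f)) (rep h)) :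
  br (k *: v) w = k *: br v w.
Proof. exact: (lin_Z ((br_bilin F c e f h).1 w)). Qed.

End Bracket.

(** * Structure maps of the tube algebra *)

Lemma exchange_big3 (V : zmodType) (I J L : finType) (F : I -> J -> L -> V) :
  \sum_i \sum_j \sum_l F i j l = \sum_l \sum_i \sum_j F i j l.
Proof. by under eq_bigr do rewrite exchange_big; rewrite exchange_big. Qed.

Section TubeOperations.
Variables (K : numClosedFieldType) (C D : umfc K) (M : bimod C D).
Implicit Types (a : irr C) (b : irr D) (c e f h : irr M) (F G H : efun M).

(** The bracket over the composite functor decomposes a ⊗ a' and b' ⊗ b; the factors [dl] are the
    Kronecker deltas. *)
Definition tmul (x y : tube M) : tube M :=
  tube_lift idfun (fun a b c e f h v w =>
    tube_lift idfun (fun a' b' c' e' f' h' v' w' =>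
      @br _ _ _ M (ecomp (T M a b) (T M a' b')) c e' f' h
        (emor (T M a b) (v' ∘ dl e c') ∘ v) (w ∘ emor (T M a b) (dl h' f ∘ w'))) y) x.

Lemma tmul_linl y : linear (tmul^~ y).
Proof. exact: tube_lift_slin. Qed.

Lemma tmul_linr x : linear (tmul x).
Proof.
apply: lin_bigsum => -[[[a b] [c e]] [f h]].
apply: lin_bigsum => i; apply: lin_bigsum => j; apply: lin_scale.
exact: tube_lift_slin.
Qed.

Lemma tmul_tb a b c e f h a' b' c' e' f' h'
    (v : mor (rep c) (bact (rep a) (rep e) (rep b)))
    (w : mor (bact (rep a) (rep f) (rep b)) (rep h))
    (v' : mor (rep c') (bact (rep a') (rep e') (rep b')))
    (w' : mor (bact (rep a') (rep f') (rep b')) (rep h')) :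
  tmul (tb v w) (tb v' w') =
  @br _ _ _ M (ecomp (T M a b) (T M a' b')) c e' f' h
    (emor (T M a b) (v' ∘ dl e c') ∘ v) (w ∘ emor (T M a b) (dl h' f ∘ w')).
Proof.
have Hin (v1 : mor (rep c) (T M a b (rep e))) (w1 : mor (T M a b (rep f)) (rep h)) :
    bilin (fun v' w' => @br _ _ _ M (ecomp (T M a b) (T M a' b')) c e' f' h
        (emor (T M a b) (v' ∘ dl e c') ∘ v1) (w1 ∘ emor (T M a b) (dl h' f ∘ w'))).
  split=> u k p p'.
    by rewrite comp_linl emor_lin comp_linl brl.
  by rewrite comp_linr emor_lin comp_linr brr.
rewrite /tmul tube_lift_tb; first by rewrite tube_lift_tb //; apply: Hin.
split=> u k p p'; rewrite /tube_lift scaler_sumr -big_split;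
  apply: eq_bigr => -[[[a1 b1] [c1 e1]] [f1 h1]] _;
  rewrite /= /tens_lift scaler_sumr -big_split /=; apply: eq_bigr => i _;
  rewrite scaler_sumr -big_split /=; apply: eq_bigr => j _.
  by rewrite comp_linr brl scalerDr scalerA mulrC -scalerA.
by rewrite comp_linl brr scalerDr scalerA mulrC -scalerA.
Qed.

(** The composites t of embeddings of simple summands into F and G are induced transformations, so
    dinaturality collects t t^† in one leg of a bracket over the composite of F and G, and these sum
    to the identity. *)
Lemma tmul_br F G c e f h c' e' f' h'
    (v : mor (rep c) (F (rep e))) (w : mor (F (rep f)) (rep h))
    (v' : mor (rep c') (G (rep e'))) (w' : mor (G (rep f')) (rep h')) :
  tmul (br v w) (br v' w') =
  @br _ _ _ M (ecomp F G) c e' f' h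
    (emor F (v' ∘ dl e c') ∘ v) (w ∘ emor F (dl h' f ∘ w')).
Proof.
set V := emor F _ ∘ v; set W := w ∘ _.
pose E i j := @emb _ _ _ M F i j; pose E' i j := @emb _ _ _ M G i j.
pose t i j i' j' m := E i j (G m) ∘ emor (T M (tag i) (tag j)) (E' i' j' m).
have tE i j i' j' : isE (F := ecomp (T M (tag i) (tag j)) (T M (tag i') (tag j')))
    (G := ecomp F G) (t i j i' j').
  exact: (isE_comp (isE_whiskerr G (emb_isE i j))
    (isE_whiskerl (T M (tag i) (tag j)) (emb_isE i' j'))).
have tD i j i' j' m : (t i j i' j' m)^†
    = emor (T M (tag i) (tag j)) (emb i' j' m)^† ∘ (emb i j (G m))^†.
  by rewrite dag_comp emor_dag.
transitivity (\sum_i \sum_j \sum_i' \sum_j'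
    @br _ _ _ M (ecomp F G) c e' f' h V (W ∘ (t i j i' j' _ ∘ (t i j i' j' _)^†))).
  rewrite {1}/br (lin_sum (tmul_linl _)); apply: eq_bigr => i _.
  rewrite (lin_sum (tmul_linl _)); apply: eq_bigr => j _.
  rewrite {1}/br (lin_sum (tmul_linr _)); apply: eq_bigr => i' _.
  rewrite (lin_sum (tmul_linr _)); apply: eq_bigr => j' _.
  rewrite tmul_tb [in RHS]compA (br_natV _ _ (tE i j i' j')).
  have nE x y (u : mor x y) := isE_natural (@emb_isE _ _ _ M F i j) u.
  have nE' x y (u : mor x y) := isE_natural (isE_dag (@emb_isE _ _ _ M F i j)) u.
  rewrite tD /t /E /E' /V /W !emor_comp -?compA; congr br.
    by rewrite (rea (nE' _ _ _)) -?compA (rea (nE' _ _ _)) -?compA.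
  by rewrite (rea (nE _ _ _)) -?compA (rea (nE _ _ _)) -?compA.
rewrite -[W in RHS]compm1 -(emb_full F (G (rep f'))) !comp_sumr br_sumr; apply: eq_bigr => i _.
rewrite comp_sumr br_sumr; apply: eq_bigr => j _.
transitivity (@br _ _ _ M (ecomp F G) c e' f' h V (W ∘ (E i j _ ∘ (emor _ (idm _) ∘ (E i j _)^†))));
  last by rewrite emor_id comp1m.
rewrite -(emb_full G) emor_sum comp_suml !comp_sumr br_sumr; apply: eq_bigr => i' _.
rewrite emor_sum comp_suml !comp_sumr br_sumr; apply: eq_bigr => j' _.
by rewrite tD /t emor_comp -?compA.
Qed.

Definition teps (x : tube M) : K :=
  tube_lift (U := K^o) idfun (fun a b c e f h v w => scd (w ∘ emor (T M a b) (dl e f) ∘ v)) x.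

Lemma teps_lin : scalar teps.
Proof. exact: (@tube_lift_slin _ _ _ _ _ K^o). Qed.

Lemma teps_tb a b c e f h
    (v : mor (rep c) (T M a b (rep e))) (w : mor (T M a b (rep f)) (rep h)) :
  teps (tb v w) = scd (w ∘ emor (T M a b) (dl e f) ∘ v).
Proof.
rewrite /teps tube_lift_tb //; split=> u k x y.
  by rewrite comp_linr scd_lin.
by rewrite -!compA !comp_linl scd_lin.
Qed.

Lemma teps_sum I (r : seq I) P (x : I -> tube M) :
  teps (\sum_(i <- r | P i) x i) = \sum_(i <- r | P i) teps (x i).
Proof. exact: (@lin_sum _ _ K^o _ teps_lin). Qed.

Lemma scd_sum c h I (r : seq I) P (x : I -> mor (rep c : M) (rep h)) :
  scd (\sum_(i <- r | P i) x i) = \sum_(i <- r | P i) scd (x i).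
Proof. exact: (@lin_sum _ _ K^o _ (@scd_lin _ _ c h)). Qed.

Lemma teps_br F c e f h (v : mor (rep c) (F (rep e))) (w : mor (F (rep f)) (rep h)) :
  teps (br v w) = scd (w ∘ emor F (dl e f) ∘ v).
Proof.
rewrite -[v in RHS]comp1m -emb_full comp_suml comp_sumr scd_sum teps_sum.
apply: eq_bigr => i _; rewrite comp_suml comp_sumr scd_sum teps_sum.
apply: eq_bigr => j _; rewrite teps_tb -?compA; congr scd.
by rewrite (rea (isE_natural (emb_isE i j) _)) -?compA.
Qed.

Definition tcomul (x : tube M) : tens (tube M) (tube M) :=
  tube_lift idfun (fun a b c e f h v w => \sum_i \sum_k
    cas (i := k) (x := T M a b (rep i)) (fun p q => tb p w ⊠ tb v q)) x.

Lemma tcomul_lin : linear tcomul.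
Proof. exact: tube_lift_slin. Qed.

Lemma tcomul_tb a b c e f h
    (v : mor (rep c) (T M a b (rep e))) (w : mor (T M a b (rep f)) (rep h)) :
  tcomul (tb v w) = \sum_i \sum_k
    cas (i := k) (x := T M a b (rep i)) (fun p q => tb p w ⊠ tb v q).
Proof.
apply: tube_lift_tb; split=> u; apply: lin_bigsum => i; apply: lin_bigsum => k;
  apply: lin_bigsum => p s x y; by rewrite (tbl, tbr) (pure_linl, pure_linr).
Qed.

(** Expanding the first leg over the simple summands of F, the dagger of each embedding slides
    through the Casimir element into the second leg, which dinaturality turns into the term over
    that summand. *)
Lemma tcomul_br F c e f h (v : mor (rep c) (F (rep e))) (w : mor (F (rep f)) (rep h)) :
  tcomul (br v w) = \sum_i \sum_k
    cas (i := k) (x := F (rep i)) (fun p q => br p w ⊠ br v q).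
Proof.
transitivity (\sum_s \sum_t \sum_i \sum_k cas (i := k) (x := F (rep i))
   (fun p q => tb ((emb s t _)^† ∘ p) (w ∘ emb s t _) ⊠ br v q)); last first.
  rewrite exchange_big3; apply: eq_bigr => i _.
  rewrite exchange_big3; apply: eq_bigr => k _.
  rewrite exchange_big3; apply: eq_bigr => p _.
  rewrite /br (lin_sum (pure_linl _)); apply: eq_bigr => s _.
  by rewrite (lin_sum (pure_linl _)).
rewrite (lin_sum tcomul_lin); apply: eq_bigr => s _.
rewrite (lin_sum tcomul_lin); apply: eq_bigr => t _.
rewrite tcomul_tb; apply: eq_bigr => i _; apply: eq_bigr => k _.
pose U0 : lmodType K := tens (tube M) (tube M).
rewrite /cas -(@cas_slide _ _ U0 k _ _ (emb s t (rep i))^†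
  (fun p q => tb p (w ∘ emb s t (rep f)) ⊠ br v q)); last first.
  by split=> u l x y; rewrite (tbl, brr) (pure_linl, pure_linr).
by apply: eq_bigr => p _; rewrite (br_natV _ _ (emb_isE s t)) br_T.
Qed.

Definition tconj (x : tube M) : tube M :=
  tube_lift Num.conj (fun a b c e f h v w => tb w^† v^†) x.

Lemma tconj_slin : slin Num.conj tconj.
Proof. exact: tube_lift_slin. Qed.

Lemma tconj_tb a b c e f h
    (v : mor (rep c) (bact (rep a) (rep e) (rep b)))
    (w : mor (bact (rep a) (rep f) (rep b)) (rep h)) :
  tconj (tb v w) = tb w^† v^†.
Proof. by apply: tube_lift_tb; split=> u k x y; rewrite dag_antilin (tbl, tbr). Qed.

Lemma tconj_br F c e f h (v : mor (rep c) (F (rep e))) (w : mor (F (rep f)) (rep h)) :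
  tconj (br v w) = br w^† v^†.
Proof.
rewrite (slin_sum tconj_slin); apply: eq_bigr => i _.
rewrite (slin_sum tconj_slin); apply: eq_bigr => j _.
by rewrite tconj_tb !dag_comp dagK.
Qed.

End TubeOperations.

(** * Antipode *)

Section Antipode.
Variables (K : numClosedFieldType) (C D : umfc K) (M : bimod C D).
Implicit Types (a : irr C) (b : irr D) (c e f h i k : irr M) (F G H : efun M)
  (d : duality M).

Definition tanti (x : tube M) : tube M :=
  tube_lift idfun (fun a b c e f h v w =>
    (qdimM f / qdimM h) *: tb (flat w) (sharp v)) x.

Lemma tanti_lin : linear tanti.
Proof. exact: tube_lift_slin. Qed.

Lemma tanti_flat_sharp a b c e f h
    (v : mor (rep c) (bact (rep a) (rep e) (rep b)))
    (w : mor (bact (rep a) (rep f) (rep b)) (rep h)) :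
  tanti (tb v w) = (qdimM f / qdimM h) *: tb (flat w) (sharp v).
Proof.
apply: tube_lift_tb; split=> u l x y.
  by rewrite /sharp bactm_lin2 comp_linr tbr scalerDr !scalerA mulrC.
by rewrite /flat bactm_lin2 comp_linl tbl scalerDr !scalerA mulrC.
Qed.

Lemma tanti_tb a b c e f h (v : mor (rep c) (T M a b (rep e)))
    (w : mor (T M a b (rep f)) (rep h)) :
  tanti (tb v w) = (qdimM f / qdimM h) *:
    @br _ _ _ M (Td M a b) f h c e
      (emor (Td M a b) w ∘ (lcap a b (rep f))^†) (lcap a b (rep e) ∘ emor (Td M a b) v).
Proof. by rewrite tanti_flat_sharp br_T !lcapE. Qed.

Section Mate.
Variables (d d' : duality M) (t : forall m, mor (dG d' m) (dG d m)).
Hypothesis tE : isE t.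

(** The mate of t under the two dualities, built from the second pair of duality maps, cup^† and
    cap^†. *)
Definition mate m : mor (dQ d m) (dQ d' m) :=
  locked (emor (dQ d') (dcup d m)^† ∘ emor (dQ d') (t (dQ d m))
    ∘ (dcap d' (dQ d m))^†).

Lemma mate_isE : isE mate.
Proof.
have H := isE_comp (isE_unitr (dQ d')) (isE_comp (isE_whiskerl (dQ d') (isE_dag (dcupE d)))
  (isE_comp (isE_whiskerl (dQ d') (isE_whiskerr (dQ d) tE))
  (isE_comp (isE_assoc (dQ d') (dG d') (dQ d)) (isE_comp (isE_whiskerr (dQ d)
    (isE_dag (dcapE d'))) (isE_unitlV (dQ d)))))).
apply: isE_ext H _ => m; rewrite /mate -lock !comp1m compm1.
by rewrite -compA.
Qed.

Lemma mate_cap m : mate (dG d m) ∘ (dcap d m)^† = emor (dQ d') (t m) ∘ (dcap d' m)^†.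
Proof.
rewrite /mate -lock -?compA -dcap_natV.
have tn := congr1 (emor (dQ d')) (isE_natural tE (dcap d m)^†).
rewrite !emor_comp in tn; rewrite (rea tn) -?compA.
by rewrite (rea (esym (emor_comp _ _ _))) dzigV emor_id comp1m.
Qed.

Lemma mate_flat m n (w : mor (dG d m) n) :
  mate n ∘ (emor (dQ d) w ∘ (dcap d m)^†) = emor (dQ d') (w ∘ t m) ∘ (dcap d' m)^†.
Proof.
rewrite (rea (isE_natural mate_isE w)) -?compA mate_cap emor_comp -?compA.
by [].
Qed.

Lemma mate_sharp m n (v : mor n (dG d m)) :
  (dcap d m ∘ emor (dQ d) v) ∘ (mate n)^† = dcap d' m ∘ emor (dQ d') ((t m)^† ∘ v).
Proof.
apply: dag_inj; rewrite !dag_comp !emor_dag dagK mate_flat dag_comp !dagK.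
by [].
Qed.

End Mate.

(* Tested against the trace, which is nondegenerate, this is the trace property of
   d and of the duals of the simple summands of dG d. *)
Lemma mate_sum d m :
  \sum_i \sum_j (mate (d := d) (d' := dual_T M (tag i) (tag j)) (@emb _ _ _ M (dG d) i j) m)^†
     ∘ mate (d := d) (d' := dual_T M (tag i) (tag j)) (@emb _ _ _ M (dG d) i j) m
  = idm (dQ d m).
Proof.
apply/eqP; rewrite -subr_eq0; apply/eqP; apply: tr_nondegenerate => g.
rewrite compBr trB compm1; apply/eqP; rewrite subr_eq0; apply/eqP.
(* V and W are transposes of g and of the identity; thus tr g = tr(V W), which splits over the
   summands of dG d. *)
pose V : mor m (dG d (dQ d m)) := emor (dG d) g ∘ dcup d m.
pose W : mor (dG d (dQ d m)) m := (dcup d m)^†.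
have VE : dcap d _ ∘ emor (dQ d) V = g.
  by rewrite emor_comp compA dcap_nat -compA dzag compm1.
have WE : emor (dQ d) W ∘ (dcap d _)^† = idm _ by exact: dzagV.
transitivity (tr (V ∘ W)); last first.
  rewrite dtr emor_comp -?compA WE.
  by rewrite compm1 VE.
rewrite -[W]compm1 -(emb_full (dG d)) !comp_sumr !tr_sum; apply: eq_bigr => i _.
rewrite !comp_sumr !tr_sum; apply: eq_bigr => j _.
set t := @emb _ _ _ M (dG d) i j; set d' := dual_T M (tag i) (tag j).
have tE : isE (F := dG d') (G := dG d) t by exact: emb_isE.
set s := mate _ _.
transitivity (tr ((dcap d _ ∘ emor (dQ d) V ∘ s^†) ∘ (s ∘ (emor (dQ d) W ∘ (dcap d _)^†)))).
  by rewrite VE WE compm1 -?compA.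
rewrite (mate_sharp tE) (mate_flat tE) -?compA (rea (esym (emor_comp _ _ _))) compA.
by rewrite -dtr tr_cyclic [in RHS]compA [in RHS]tr_cyclic -?compA.
Qed.

(** The identity [mate_sum] is inserted in the second leg and one mate of each pair moves to the
    first by dinaturality; [mate_flat] and [mate_sharp] recognise the defining terms over the simple
    summands. *)
Lemma tanti_dual d c e f h (v : mor (rep c) (dG d (rep e))) (w : mor (dG d (rep f)) (rep h)) :
  tanti (br v w) = (qdimM f / qdimM h) *:
    br (emor (dQ d) w ∘ (dcap d (rep f))^†) (dcap d (rep e) ∘ emor (dQ d) v).
Proof.
set X := emor _ w ∘ _; set Y := _ ∘ emor _ v.
rewrite -[Y]compm1 -mate_sum comp_sumr br_sumr scaler_sumr (lin_sum tanti_lin).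
apply: eq_bigr => i _.
rewrite comp_sumr br_sumr scaler_sumr (lin_sum tanti_lin); apply: eq_bigr => j _.
rewrite tanti_tb; congr (_ *: _).
set d' := dual_T M (tag i) (tag j).
have tE : isE (F := dG d') (G := dG d) (@emb _ _ _ M (dG d) i j) by exact: emb_isE.
rewrite compA (br_nat _ _ (mate_isE tE)) (mate_flat tE) (mate_sharp tE).
by [].
Qed.

(** The dual of a composite is the composite of the duals in reverse order; together with
    [comp_sharp] this is the source of antimultiplicativity. *)
Lemma comp_flat (d1 d2 : duality M) m x y z (w : mor (dG d1 x) z) (u : mor y x)
    (w' : mor (dG d2 m) y) :
  emor (dQ (dual_comp d1 d2)) (w ∘ emor (dG d1) (u ∘ w')) ∘ (dcap (dual_comp d1 d2) m)^†
  = emor (dQ d2) (emor (dQ d1) w ∘ (dcap d1 x)^† ∘ u) ∘ (emor (dQ d2) w' ∘ (dcap d2 m)^†).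
Proof.
transitivity (emor (dQ d2) (emor (dQ d1) (w ∘ emor (dG d1) (u ∘ w')))
  ∘ (dcap d2 m ∘ emor (dQ d2) (dcap d1 (dG d2 m)))^†) => //.
rewrite dag_comp emor_dag (rea (esym (emor_comp _ _ _))) (emor_comp (dQ d1)) -?compA dcap_natV.
by rewrite (rea (esym (emor_comp _ _ _))) -?compA.
Qed.

Lemma comp_sharp (d1 d2 : duality M) m x y z (v : mor z (dG d1 x)) (u : mor x y)
    (v' : mor y (dG d2 m)) :
  dcap (dual_comp d1 d2) m ∘ emor (dQ (dual_comp d1 d2)) (emor (dG d1) (v' ∘ u) ∘ v)
  = dcap d2 m ∘ emor (dQ d2) v' ∘ emor (dQ d2) (u ∘ (dcap d1 x ∘ emor (dQ d1) v)).
Proof.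
transitivity (dcap d2 m ∘ emor (dQ d2) (dcap d1 (dG d2 m))
  ∘ emor (dQ d2) (emor (dQ d1) (emor (dG d1) (v' ∘ u) ∘ v))) => //.
rewrite -?compA -emor_comp (emor_comp (dQ d1)) (rea (dcap_nat _ _)) -?compA.
by rewrite -emor_comp.
Qed.

Lemma tanti_mul x y : tanti (tmul x y) = tmul (tanti y) (tanti x).
Proof.
move: x; apply: (@tube_ext _ _ _ M _ idfun).
- by move=> l x x'; rewrite tmul_linl tanti_lin.
- by move=> l x x'; rewrite tanti_lin tmul_linr.
move=> a b c e f h v w; move: y; apply: (@tube_ext _ _ _ M _ idfun).
- by move=> l x x'; rewrite tmul_linr tanti_lin.
- by move=> l x x'; rewrite tanti_lin tmul_linl.
move=> a' b' c' e' f' h' v' w'.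
rewrite tmul_tb !tanti_tb (lin_Z (tmul_linl _)) (lin_Z (tmul_linr _)) tmul_br scalerA.
rewrite (@tanti_dual (dual_comp (dual_T M a b) (dual_T M a' b'))) comp_flat comp_sharp.
(* For h' = f the weights multiply to d_f'/d_h; otherwise both sides vanish. *)
have [hf|hf] := eqVneq h' f.
  by have -> : qdimM h' = qdimM f; [rewrite hf | rewrite mulrA divfK ?qdimM_neq0].
by rewrite (dl_neq hf) comp0r emor0 comp0l br0l !scaler0.
Qed.

(* The maps p^* flat and (d_i / d_k) p sharp form dual bases of Hom(i, dQ d k). *)
Lemma flat_resolve d i k (g : mor (rep i) (dQ d (rep k))) :
  g = \sum_(p < onb_size k (dG d (rep i)))
    sc (((qdimM i / qdimM k) *: (dcap d (rep i) ∘ emor (dQ d) (onb p))) ∘ g)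
      *: (emor (dQ d) (onb p)^† ∘ (dcap d (rep i))^†).
Proof.
pose u := (dcup d (rep k))^† ∘ emor (dG d) g.
have gE : g = emor (dQ d) u ∘ (dcap d (rep i))^†.
  by rewrite emor_comp -?compA dcap_natV (rea (dzagV _ _)) comp1m.
rewrite {1}gE {1}(onb_coexp u) emor_sum comp_suml; apply: eq_bigr => p _.
rewrite emorZ compZl; congr (_ *: _).
(* The coefficient is a scalar on k on one side and on i on the other; comparing traces gives
   d_i/d_k. *)
apply: (mulIf (qdimM_neq0 k)); rewrite -tr_sc tr_cyclic dtr emor_comp -?compA -gE.
by rewrite compA tr_sc compZl (@lin_Z _ _ K^o _ (@sc_lin _ _ _)) mulrAC divfK ?qdimM_neq0 // mulrC.
Qed.

(** [flat_resolve] resolves the identity of dQ d k. Inserting this under dG d before the cup, a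
    zig-zag straightens every bent p. *)
Lemma flat_cup d k :
  \sum_i \sum_(p < onb_size k (dG d (rep i)))
    (qdimM i / qdimM k) *: (emor (dG d) (emor (dQ d) (onb p)^† ∘ (dcap d (rep i))^†) ∘ onb p)
  = dcup d (rep k).
Proof.
pose fl i (p : 'I_(onb_size k (dG d (rep i)))) := emor (dQ d) (onb p)^† ∘ (dcap d (rep i))^†.
pose sh i (p : 'I_(onb_size k (dG d (rep i)))) :=
  (qdimM i / qdimM k) *: (dcap d (rep i) ∘ emor (dQ d) (onb p)).
have E : \sum_i \sum_p fl i p ∘ sh i p = idm (dQ d (rep k)).
  rewrite -onb_full; apply: eq_bigr => i _.
  apply: (@cas_resolve _ _ _ i _ (fun v w => v ∘ w)).
    by split=> ? ? ? ?; [exact: comp_linl | exact: comp_linr].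
  by move=> g; rewrite {1}(flat_resolve g).
rewrite -[RHS]comp1m -emor_id -E emor_sum comp_suml; apply: eq_bigr => i _.
rewrite emor_sum comp_suml; apply: eq_bigr => p _.
rewrite /sh compZr emorZ compZl; congr (_ *: _); rewrite /fl !emor_comp -?compA.
by rewrite -dcup_nat (rea (dzig _ _)) comp1m.
Qed.

End Antipode.

(** * Weak Hopf axioms *)

Section WeakHopfAxioms.
Variables (K : numClosedFieldType) (C D : umfc K) (M : bimod C D).
Implicit Types (a : irr C) (b : irr D) (c e f h i k : irr M) (F G H : efun M)
  (d : duality M).

(** Stated with brackets, so that T a b can then be generalised to an arbitrary functor. *)
Lemma tube_ext_br (U : lmodType K) (s : {rmorphism K -> K}) (P Q : tube M -> U) :
  slin s P -> slin s Q ->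
  (forall a b c e f h (v : mor (rep c) (T M a b (rep e)))
    (w : mor (T M a b (rep f)) (rep h)), P (br v w) = Q (br v w)) ->
  forall x, P x = Q x.
Proof. by move=> HP HQ H; apply: (tube_ext HP HQ) => *; rewrite -br_T; apply: H. Qed.

Definition csum (U : zmodType) F
    (B : forall i k, mor (rep k) (F (rep i)) -> mor (F (rep i)) (rep k) -> U) : U :=
  \sum_i \sum_k cas (B i k).

Lemma eq_csum (U : zmodType) F
    (B B' : forall i k, mor (rep k) (F (rep i)) -> mor (F (rep i)) (rep k) -> U) :
  (forall i k p q, B i k p q = B' i k p q) -> csum B = csum B'.
Proof. by move=> E; apply: eq_bigr => i _; apply: eq_bigr => k _; apply: eq_bigr => p _. Qed.

Lemma csum_sum (U : zmodType) F (I : finType)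
    (B : I -> forall i k, mor (rep k) (F (rep i)) -> mor (F (rep i)) (rep k) -> U) :
  csum (fun i k p q => \sum_x B x i k p q) = \sum_x csum (B x).
Proof.
rewrite /csum /cas [RHS]exchange_big; apply: eq_bigr => i _.
by rewrite [RHS]exchange_big; apply: eq_bigr => k _; rewrite exchange_big.
Qed.

Lemma csum_exchange (U : zmodType) F G
    (B : forall i k, mor (rep k) (F (rep i)) -> mor (F (rep i)) (rep k) ->
      forall j l, mor (rep l) (G (rep j)) -> mor (G (rep j)) (rep l) -> U) :
  csum (fun i k p q => csum (B i k p q)) =
  csum (fun j l r s => csum (fun i k p q => B i k p q j l r s)).
Proof.
transitivity (csum (fun i k p q => \sum_j \sum_l \sum_r B i k p q j l (onb r) (onb r)^†)) => //.
rewrite csum_sum; apply: eq_bigr => j _; rewrite csum_sum; apply: eq_bigr => l _.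
by rewrite csum_sum.
Qed.

Lemma csum_lin (U V : lmodType K) (s : {rmorphism K -> K}) (L : U -> V) F
    (B : forall i k, mor (rep k) (F (rep i)) -> mor (F (rep i)) (rep k) -> U) :
  slin s L -> L (csum B) = csum (fun i k p q => L (B i k p q)).
Proof.
move=> HL; rewrite (slin_sum HL); apply: eq_bigr => i _.
by rewrite (slin_sum HL); apply: eq_bigr => k _; rewrite (slin_sum HL).
Qed.

Lemma csum_dl (U : zmodType) F f
    (B : forall i k, mor (rep k) (F (rep i)) -> mor (F (rep i)) (rep k) -> U) :
  (forall i k p q, i != f -> B i k p q = 0) -> csum B = \sum_k cas (B f k).
Proof.
move=> H; rewrite /csum (bigD1 f) //= [X in _ + X]big1 ?addr0 // => i fi.
by apply: big1 => k _; apply: big1 => p _; apply: H.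
Qed.

(** Contracting the second leg of the Casimir element with v returns v in the first; only k = c
    contributes. *)
Lemma cas_eval (U : lmodType K) (m : M) c (v : mor (rep c) m)
    (B : forall k, mor (rep k) m -> U) : (forall k, linear (B k)) ->
  \sum_k cas (fun p q => scd (q ∘ v) *: B k p) = B c v.
Proof.
move=> HB; rewrite (bigD1 c) //= [X in _ + X]big1 ?addr0 => [|k kc].
  rewrite [in RHS](onb_exp v) (lin_sum (HB c)); apply: eq_bigr => p _.
  by rewrite (lin_Z (HB c)) scd_sc.
by apply: big1 => p _; rewrite scd_neq 1?eq_sym // scale0r.
Qed.

Lemma cas_coeval (U : lmodType K) (m : M) h (w : mor m (rep h))
    (B : forall k, mor m (rep k) -> U) : (forall k, linear (B k)) ->
  \sum_k cas (fun p q => scd (w ∘ p) *: B k q) = B h w.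
Proof.
move=> HB; rewrite (bigD1 h) //= [X in _ + X]big1 ?addr0 => [|k kc].
  rewrite [in RHS](onb_coexp w) (lin_sum (HB h)); apply: eq_bigr => p _.
  by rewrite (lin_Z (HB h)) scd_sc.
by apply: big1 => p _; rewrite scd_neq // scale0r.
Qed.

Lemma tcomul_csum F c e f h (v : mor (rep c) (F (rep e))) (w : mor (F (rep f)) (rep h)) :
  tcomul (br v w) = csum (fun i k p q => br p w ⊠ br v q).
Proof. exact: tcomul_br. Qed.

Lemma sw_comul (U : lmodType K) (s : {rmorphism K -> K}) F c e f h
    (v : mor (rep c) (F (rep e))) (w : mor (F (rep f)) (rep h)) (B : tube M -> tube M -> U) :
  sbilin s B -> sw (tcomul (br v w)) B = csum (fun i k p q => B (br p w) (br v q)).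
Proof.
move=> HB; rewrite tcomul_csum (csum_lin _ (sw_slin HB.2)).
by apply: eq_csum => i k p q; rewrite (sw_pure _ _ HB).
Qed.

(** The associator has identity components, so dinaturality along it identifies the two brackets. *)
Lemma br_assoc F G H c e f h (v : mor (rep c) (F (G (H (rep e)))))
    (w : mor (F (G (H (rep f)))) (rep h)) :
  @br _ _ _ M (ecomp (ecomp F G) H) c e f h v w
  = @br _ _ _ M (ecomp F (ecomp G H)) c e f h v w.
Proof.
have := @br_nat _ _ _ M (ecomp (ecomp F G) H) (ecomp F (ecomp G H)) _ c e f h v w (isE_assoc F G H).
by rewrite comp1m compm1.
Qed.

Lemma tmulA : associative (@tmul _ _ _ M).
Proof.
move=> x y z; move: x; apply: (@tube_ext_br _ idfun).
- by move=> l x x'; rewrite tmul_linl.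
- by move=> l x x'; rewrite !tmul_linl.
move=> a b c e f h; move: (T M a b) => F v w; move: y; apply: (@tube_ext_br _ idfun).
- by move=> l x x'; rewrite tmul_linl tmul_linr.
- by move=> l x x'; rewrite tmul_linr tmul_linl.
move=> a' b' c' e' f' h'; move: (T M a' b') => G v' w'.
move: z; apply: (@tube_ext_br _ idfun).
- by move=> l x x'; rewrite !tmul_linr.
- by move=> l x x'; rewrite tmul_linr.
move=> a'' b'' c'' e'' f'' h''; move: (T M a'' b'') => H v'' w''.
by rewrite !tmul_br br_assoc /=; congr br; rewrite !emor_comp -?compA.
Qed.

(* The summand id_y ⊗ id_x of the unit; it is 0 if y and x do not lie in a
   common component. *)
Definition ut (y x : irr M) : tube M := @br _ _ _ M (eid M) y y x x (idm _) (idm _).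

Definition tone : tube M := \sum_y \sum_x ut y x.

Lemma tmul_utl (y x : irr M) F c e f h (v : mor (rep c) (F (rep e))) (w : mor (F (rep f)) (rep h)) :
  tmul (ut y x) (br v w) = br (v ∘ dl y c) (dl h x ∘ w).
Proof.
rewrite tmul_br.
have := @br_nat _ _ _ M (ecomp (eid M) F) F _ y e f x (v ∘ dl y c) (dl h x ∘ w) (isE_unitl F).
by rewrite /= !compm1 !comp1m.
Qed.

Lemma tmul_utr (y x : irr M) F c e f h (v : mor (rep c) (F (rep e))) (w : mor (F (rep f)) (rep h)) :
  tmul (br v w) (ut y x) = br (emor F (dl e y) ∘ v) (w ∘ emor F (dl x f)).
Proof.
rewrite tmul_br.
have := @br_nat _ _ _ M (ecomp F (eid M)) F _ c y x h (emor F (dl e y) ∘ v) (w ∘ emor F (dl x f)) (isE_unitr F).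
by rewrite !comp1m !compm1.
Qed.

Lemma br_dl_suml F c e f h (v : mor (rep c) (F (rep e))) (w : mor (F (rep f)) (rep h)) :
  \sum_y br (v ∘ dl y c) w = br v w.
Proof.
rewrite (bigD1 c) //= dl_id compm1 big1 ?addr0 // => y yc.
by rewrite dl_neq // comp0r br0l.
Qed.

Lemma br_dl_sumr F c e f h (v : mor (rep c) (F (rep e))) (w : mor (F (rep f)) (rep h)) :
  \sum_x br v (dl h x ∘ w) = br v w.
Proof.
rewrite (bigD1 h) //= dl_id comp1m big1 ?addr0 // => x xh.
by rewrite dl_neq 1?eq_sym // comp0l br0r.
Qed.

Lemma tmul1l : left_id tone (@tmul _ _ _ M).
Proof.
apply: (@tube_ext_br _ idfun) => [||a b c e f h]; first exact: tmul_linr.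
  by [].
move: (T M a b) => F v w; rewrite (lin_sum (tmul_linl _)).
under eq_bigr => y _.
  rewrite (lin_sum (tmul_linl _)).
  under eq_bigr do rewrite tmul_utl.
  rewrite br_dl_sumr; over.
exact: br_dl_suml.
Qed.

Lemma tmul1r : right_id tone (@tmul _ _ _ M).
Proof.
apply: (@tube_ext_br _ idfun) => [||a b c e f h]; first exact: tmul_linl.
  by [].
move: (T M a b) => F v w; rewrite (lin_sum (tmul_linr _)).
rewrite (bigD1 e) //= (lin_sum (tmul_linr _)) (bigD1 f) //= tmul_utr !dl_id !emor_id.
rewrite comp1m compm1 !big1 ?addr0 // => [y ye|x xf].
  rewrite (lin_sum (tmul_linr _)) big1 // => x _.
  by rewrite tmul_utr dl_neq 1?eq_sym // emor0 comp0l br0l.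
by rewrite tmul_utr (@dl_neq _ _ x) // emor0 comp0r br0r.
Qed.

Lemma tcomul_ut (y x : irr M) : tcomul (ut y x) = \sum_i ut i x ⊠ ut y i.
Proof.
rewrite tcomul_csum; apply: eq_bigr => i _; pose U0 : lmodType K := tens (tube M) (tube M).
pose B k (p : mor (rep k) (eid M (rep i))) (q : mor (eid M (rep i)) (rep k)) :=
  br p (idm (rep x)) ⊠ br (F := eid M) (idm (rep y)) q.
transitivity (\sum_k B k (dl k i) (dl i k)).
  apply: eq_bigr => k _; apply: (@cas_rep _ _ U0 k i (B k)).
  by split=> u l p q; rewrite /B (brl, brr) (pure_linl, pure_linr).
rewrite (bigD1 i) //= /B !dl_id big1 ?addr0 // => k ki.
by rewrite dl_neq // br0l (lin_0 (pure_linl _)).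
Qed.

Lemma sw_comul1 (U : lmodType K) (B : tube M -> tube M -> U) : bilin B ->
  sw (tcomul tone) B = \sum_y \sum_x \sum_i B (ut i x) (ut y i).
Proof.
move=> HB; rewrite (lin_sum (@tcomul_lin _ _ _ M)) (lin_sum (sw_lin HB.2)); apply: eq_bigr => y _.
rewrite (lin_sum (@tcomul_lin _ _ _ M)) (lin_sum (sw_lin HB.2)); apply: eq_bigr => x _.
rewrite tcomul_ut (lin_sum (sw_lin HB.2)); apply: eq_bigr => i _.
by rewrite (@sw_pure _ idfun).
Qed.

End WeakHopfAxioms.

Section WeakHopfAlgebra.
Variables (K : numClosedFieldType) (C D : umfc K) (M : bimod C D).
Implicit Types (a : irr C) (b : irr D) (c e f h i k : irr M) (F G H : efun M)
  (d : duality M).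

Lemma swc_lin (U : lmodType K) (B : tube M -> tube M -> U) :
  (forall v, linear (B v)) -> linear (fun x => sw (tcomul x) B).
Proof. by move=> HB; apply: lin_comp (sw_lin HB) (@tcomul_lin _ _ _ M). Qed.

Lemma tcomulA (x : tube M) :
  sw (tcomul x) (fun x1 x2 => sw (tcomul x1) (fun x11 x12 => x11 ⊠ (x12 ⊠ x2)))
  = sw (tcomul x) (fun x1 x2 => sw (tcomul x2) (fun x21 x22 => x1 ⊠ (x21 ⊠ x22))).
Proof.
have L2 (u v : tube M) : linear (fun x2 : tube M => u ⊠ (v ⊠ x2)).
  exact: lin_comp (pure_linr u) (pure_linr v).
have L1 (u x2 : tube M) : linear (fun v : tube M => u ⊠ (v ⊠ x2)).
  exact: lin_comp (pure_linr u) (pure_linl x2).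
have B1 : bilin (fun x1 x2 : tube M => sw (tcomul x1) (fun x11 x12 => x11 ⊠ (x12 ⊠ x2))).
  split=> u; first by apply: swc_lin => v; apply: L1.
  by apply: sw_param_lin => v w; apply: L2.
have B2 : bilin (fun x1 x2 : tube M => sw (tcomul x2) (fun x21 x22 => x1 ⊠ (x21 ⊠ x22))).
  split=> u; first by apply: sw_param_lin => v w; apply: pure_linl.
  by apply: swc_lin => v; apply: L2.
move: x; apply: (@tube_ext_br _ _ _ _ _ idfun).
- exact: swc_lin B1.2.
- exact: swc_lin B2.2.
move=> a b c e f h; move: (T M a b) => F v w.
rewrite !(@sw_comul _ _ _ _ _ idfun) //.
transitivity (csum (fun i k p q => csum (fun j l r s => br r w ⊠ (br p s ⊠ br v q)))).
  apply: eq_csum => i k p q; rewrite (@sw_comul _ _ _ _ _ idfun) //.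
  by split=> u; [exact: pure_linl | exact: L1].
rewrite csum_exchange; apply: eq_csum => i k p q; rewrite (@sw_comul _ _ _ _ _ idfun) //.
by split=> u; [exact: L1 | exact: L2].
Qed.

Lemma teps_tcomul_l (x : tube M) : sw (tcomul x) (fun x1 x2 => teps x1 *: x2) = x.
Proof.
have HB : bilin (fun x1 x2 : tube M => teps x1 *: x2).
  by split=> u; [apply: lin_scalel; apply: teps_lin | apply: (lin_scale _ (@lin_id _ _))].
move: x; apply: (@tube_ext_br _ _ _ _ _ idfun) => //; first exact: swc_lin HB.2.
move=> a b c e f h; move: (T M a b) => F v w; rewrite (@sw_comul _ _ _ _ _ idfun) //.
rewrite (csum_dl (f := f)) => [|i k p q fi]; last first.
  by rewrite teps_br dl_neq // emor0 comp0r comp0l (lin_0 (@scd_lin _ _ _ _ : linear (_ : _ -> K^o))) scale0r.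
rewrite -[RHS](@cas_coeval _ _ _ M _ _ _ w (fun k q => br v q)); last first.
  by move=> k; exact: (br_bilin _ _ _ _ _).2.
apply: eq_bigr => k _; apply: eq_bigr => p _.
by rewrite teps_br dl_id emor_id compm1.
Qed.

Lemma teps_tcomul_r (x : tube M) : sw (tcomul x) (fun x1 x2 => teps x2 *: x1) = x.
Proof.
have HB : bilin (fun x1 x2 : tube M => teps x2 *: x1).
  by split=> u; [apply: (lin_scale _ (@lin_id _ _)) | apply: lin_scalel; apply: teps_lin].
move: x; apply: (@tube_ext_br _ _ _ _ _ idfun) => //; first exact: swc_lin HB.2.
move=> a b c e f h; move: (T M a b) => F v w; rewrite (@sw_comul _ _ _ _ _ idfun) //.
rewrite (csum_dl (f := e)) => [|i k p q fi]; last first.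
  by rewrite teps_br dl_neq 1?eq_sym // emor0 comp0r comp0l (lin_0 (@scd_lin _ _ _ _ : linear (_ : _ -> K^o))) scale0r.
rewrite -[RHS](@cas_eval _ _ _ M _ _ _ v (fun k p => br p w)); last first.
  by move=> k; exact: (br_bilin _ _ _ _ _).1.
apply: eq_bigr => k _; apply: eq_bigr => p _.
by rewrite teps_br dl_id emor_id compm1.
Qed.

Lemma bilin_tmul2 (x1 x2 : tube M) : bilin (fun y1 y2 => tmul x1 y1 ⊠ tmul x2 y2).
Proof.
split=> u; first exact: lin_comp (pure_linl _) (tmul_linr _).
exact: lin_comp (pure_linr _) (tmul_linr _).
Qed.

(** The left side has one Casimir element of the composite of F and G, the right side one of each.
    Resolving the identity of G j as a sum of r r^† through the labels l, and sliding F r^† through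
    the Casimir element from F(G j) to F l, converts one into the other. *)
Lemma tcomulM (x y : tube M) :
  tcomul (tmul x y) = sw (tcomul x) (fun x1 x2 => sw (tcomul y) (fun y1 y2 =>
        tmul x1 y1 ⊠ tmul x2 y2)).
Proof.
have HB y' : bilin (fun x1 x2 : tube M => sw (tcomul y') (fun y1 y2 => tmul x1 y1 ⊠ tmul x2 y2)).
  split=> u; apply: sw_param_lin => v w.
    exact: lin_comp (pure_linl _) (tmul_linl _).
  exact: lin_comp (pure_linr _) (tmul_linl _).
move: x; apply: (@tube_ext_br _ _ _ _ _ idfun).
- exact: lin_comp (@tcomul_lin _ _ _ M) (tmul_linl y).
- exact: swc_lin (HB y).2.
move=> a b c e f h; move: (T M a b) => F v w; move: y; apply: (@tube_ext_br _ _ _ _ _ idfun).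
- exact: lin_comp (@tcomul_lin _ _ _ M) (tmul_linr _).
- apply: sw_param_lin => x1 x2; apply: swc_lin => y1; exact: (bilin_tmul2 _ _).2.
move=> a' b' c' e' f' h'; move: (T M a' b') => G v' w'.
rewrite tmul_br tcomul_csum (@sw_comul _ _ _ _ _ idfun); last exact: HB.
set V := emor F _ ∘ v; set W := w ∘ _.
pose U0 : lmodType K := tens (tube M) (tube M).
pose X i k (P : mor (rep k) (ecomp F G (rep i))) (Q : mor (ecomp F G (rep i)) (rep k)) : U0 :=
  @br _ _ _ M (ecomp F G) _ _ _ _ P W ⊠ @br _ _ _ M (ecomp F G) _ _ _ _ V Q.
have HX i k : bilin (@X i k).
  by split=> u l p q; rewrite /X (brl, brr) (pure_linl, pure_linr).
transitivity (csum (fun i k p q => csum (fun j l r s =>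
  X j k (emor F (r ∘ dl i l) ∘ p) (q ∘ emor F (dl l i ∘ s))))); last first.
  apply: eq_csum => i k p q; rewrite (@sw_comul _ _ _ _ _ idfun); last exact: bilin_tmul2.
  by apply: eq_csum => j l r s; rewrite !tmul_br.
rewrite csum_exchange {1}/csum; apply: eq_bigr => j _.
transitivity (\sum_l \sum_(r < onb_size l (G (rep j))) \sum_k
    cas (fun P Q => X j k (emor F (onb r ∘ (onb r)^†) ∘ P) Q)).
  under [RHS]eq_bigr do rewrite exchange_big.
  rewrite [RHS]exchange_big; apply: eq_bigr => k _.
  under [RHS]eq_bigr do rewrite exchange_big.
  rewrite [RHS]exchange_big; apply: eq_bigr => p _.
  transitivity (X j k (onb p) (onb p)^†) => //.
  rewrite -{1}[onb p]comp1m -[idm _](emor_id F) -onb_full emor_sum comp_suml.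
  rewrite (lin_sum ((HX j k).1 _)); apply: eq_bigr => l _.
  by rewrite emor_sum comp_suml (lin_sum ((HX j k).1 _)).
apply: eq_bigr => l _; apply: eq_bigr => r _.
rewrite (csum_dl (f := l)) => [|i k p q il]; last first.
  by rewrite dl_neq // comp0r emor0 comp0l (lin_0 ((HX j k).1 _)).
apply: eq_bigr => k _.
have := @cas_slide _ _ U0 k _ _ (emor F (onb r)^†)
  (fun P Q => X j k (emor F (onb r) ∘ P) Q).
rewrite dl_id compm1 comp1m => E; rewrite [RHS]E; last first.
  by split=> u n p q; [rewrite comp_linr ((HX j k).1 _) | rewrite ((HX j k).2 _)].
by apply: eq_bigr => p _; rewrite emor_comp -compA.
Qed.

Lemma tmul_ut2 (y x y' x' : irr M) :
  tmul (ut y x) (ut y' x') = if (y == y') && (x == x') then ut y x else 0.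
Proof.
rewrite tmul_utl; have [->|yy] := eqVneq y y'; last by rewrite dl_neq // comp0r br0l.
have [->|xx] := eqVneq x x'; first by rewrite !dl_id !comp1m.
by rewrite (@dl_neq _ _ x') 1?eq_sym // comp0l br0r.
Qed.

Lemma sum_tmul_ut2 (U : zmodType) (B : tube M -> irr M -> U) (y x : irr M) :
  (forall i, B 0 i = 0) ->
  \sum_y' \sum_x' B (tmul (ut y x) (ut y' x')) y' = B (ut y x) y.
Proof.
move=> B0; rewrite (bigD1 y) //= (bigD1 x) //= tmul_ut2 !eqxx /=.
rewrite !big1 ?addr0 // => [y' yy|x' xx].
  by rewrite big1 // => x' _; rewrite tmul_ut2 eq_sym (negbTE yy).
by rewrite tmul_ut2 eqxx eq_sym (negbTE xx).
Qed.

Lemma sum_tmul_ut2r (U : zmodType) (B : tube M -> irr M -> U) (y x : irr M) :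
  (forall i, B 0 i = 0) ->
  \sum_y' \sum_x' B (tmul (ut y' x') (ut y x)) y' = B (ut y x) y.
Proof.
move=> B0; rewrite (bigD1 y) //= (bigD1 x) //= tmul_ut2 !eqxx /=.
rewrite !big1 ?addr0 // => [y' yy|x' xx].
  by rewrite big1 // => x' _; rewrite tmul_ut2 (negbTE yy).
by rewrite tmul_ut2 eqxx (negbTE xx).
Qed.

Lemma tcomul_tone :
  sw (tcomul (tone M)) (fun u v => sw (tcomul u) (fun u1 u2 => u1 ⊠ (u2 ⊠ v)))
  = \sum_(y' : irr M) \sum_(x : irr M) \sum_(y : irr M) \sum_i ut i x ⊠ (ut y i ⊠ ut y' y).
Proof.
rewrite sw_comul1; last first.
  split=> u.
    by apply: swc_lin => v; exact: lin_comp (pure_linr _) (pure_linl _).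
  by apply: sw_param_lin => v w; exact: lin_comp (pure_linr _) (pure_linr _).
apply: eq_bigr => y' _; apply: eq_bigr => x _; apply: eq_bigr => y _.
have HB : bilin (fun u1 u2 : tube M => u1 ⊠ (u2 ⊠ ut y' y)).
  by split=> u; [exact: pure_linl | exact: lin_comp (pure_linr _) (pure_linl _)].
rewrite tcomul_ut (lin_sum (sw_lin HB.2)); apply: eq_bigr => i _.
by rewrite (@sw_pure _ idfun).
Qed.

(** m is the product in one weak unit axiom and its opposite in the other; the orthogonal
    idempotents [ut] make the two copies of Δ(1) agree along their middle labels. *)
Lemma sw_tone2 (m : tube M -> tube M -> tube M) :
  (forall v, linear (m^~ v)) -> (forall v, linear (m v)) ->
  (forall (U : zmodType) (B : tube M -> irr M -> U) (y x : irr M),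
    (forall i, B 0 i = 0) ->
    \sum_y' \sum_x' B (m (ut y x) (ut y' x')) y' = B (ut y x) y) ->
  sw (tcomul (tone M)) (fun u v => sw (tcomul u) (fun u1 u2 => u1 ⊠ (u2 ⊠ v)))
  = sw (tcomul (tone M)) (fun u v => sw (tcomul (tone M)) (fun u' v' => u ⊠ (m v u' ⊠ v'))).
Proof.
move=> ml mr Hm.
have HB u v : bilin (fun u' v' => u ⊠ (m v u' ⊠ v')).
  split=> z; first exact: lin_comp (pure_linr _) (lin_comp (pure_linl _) (mr _)).
  exact: lin_comp (pure_linr _) (pure_linr _).
rewrite tcomul_tone sw_comul1; last first.
  split=> z; apply: sw_param_lin => u v; first exact: pure_linl.
  exact: lin_comp (pure_linr _) (lin_comp (pure_linl _) (ml _)).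
rewrite [RHS]exchange_big [LHS]exchange_big; apply: eq_bigr => x _.
rewrite exchange_big3 [LHS]exchange_big3; apply: eq_bigr => l _; apply: eq_bigr => i _.
rewrite sw_comul1 //; apply: eq_bigr => j _; rewrite exchange_big.
rewrite (Hm _ (fun t k => ut i x ⊠ (t ⊠ ut j k))) // => k.
by rewrite (lin_0 (pure_linl _)) (lin_0 (pure_linr _)).
Qed.

Lemma tcomul1l :
  sw (tcomul (tone M)) (fun u v => sw (tcomul u) (fun u1 u2 => u1 ⊠ (u2 ⊠ v)))
  = sw (tcomul (tone M)) (fun u v => sw (tcomul (tone M)) (fun u' v' =>
      u ⊠ (tmul v u' ⊠ v'))).
Proof.
by apply: (sw_tone2 (m := @tmul _ _ _ M)) => [v|v|U B y x];
  [exact: tmul_linl | exact: tmul_linr | exact: sum_tmul_ut2].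
Qed.

Lemma tcomul1r :
  sw (tcomul (tone M)) (fun u v => sw (tcomul u) (fun u1 u2 => u1 ⊠ (u2 ⊠ v)))
  = sw (tcomul (tone M)) (fun u v => sw (tcomul (tone M)) (fun u' v' =>
      u ⊠ (tmul u' v ⊠ v'))).
Proof.
by apply: (sw_tone2 (m := fun x y => @tmul _ _ _ M y x)) => [v|v|U B y x];
  [exact: tmul_linr | exact: tmul_linl | exact: sum_tmul_ut2r].
Qed.

Lemma bilin_eps2 (x z : tube M) :
  bilin (fun y1 y2 => teps (tmul x y1) * teps (tmul y2 z) : K^o).
Proof.
split=> u l p q.
  by rewrite tmul_linr teps_lin mulrDl -mulrA.
by rewrite tmul_linl teps_lin mulrDr mulrCA.
Qed.

Lemma bilin_eps2r (x z : tube M) :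
  bilin (fun y1 y2 => teps (tmul x y2) * teps (tmul y1 z) : K^o).
Proof.
split=> u l p q.
  by rewrite tmul_linl teps_lin mulrDr mulrCA.
by rewrite tmul_linr teps_lin mulrDl -mulrA.
Qed.

Lemma scd0 c h : scd (0 : mor (rep c : M) (rep h)) = 0.
Proof. exact: (@lin_0 _ _ K^o _ (@scd_lin _ _ c h)). Qed.

(** The counit of a triple product is one nested scalar. Contracting the second leg of the Casimir
    element with G(X) v' splits it into two. *)
Lemma teps_tmulMl (x y z : tube M) :
  teps (tmul (tmul x y) z)
  = sw (U := K^o) (tcomul y) (fun y1 y2 => teps (tmul x y1) * teps (tmul y2 z)).
Proof.
pose U0 : lmodType K := K^o.
move: x; apply: (@tube_ext_br _ _ _ _ U0 idfun).
- by move=> l p q; rewrite !tmul_linl teps_lin.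
- apply: sw_param_lin => y1 y2 l p q.
  by rewrite tmul_linl teps_lin mulrDl -mulrA.
move=> a b c e f h; move: (T M a b) => F v w.
move: z; apply: (@tube_ext_br _ _ _ _ U0 idfun).
- by move=> l p q; rewrite !tmul_linr teps_lin.
- apply: sw_param_lin => y1 y2 l p q.
  by rewrite tmul_linr teps_lin mulrDr mulrCA.
move=> a'' b'' c'' e'' f'' h''; move: (T M a'' b'') => H v'' w''.
move: y; apply: (@tube_ext_br _ _ _ _ U0 idfun).
- by move=> l p q; rewrite !tmul_linr !tmul_linl teps_lin.
- exact: (swc_lin (U := U0) (bilin_eps2 _ _).2).
move=> a' b' c' e' f' h'; move: (T M a' b') => G v' w'.
rewrite (@sw_comul _ _ _ _ U0 idfun); last exact: bilin_eps2.
(* The morphism that the factor z inserts inside G, with the label i left free for the Casimir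
   sum. *)
pose X i := dl h'' i ∘ w'' ∘ emor H (dl e'' f'') ∘ v'' ∘ dl e' c''.
transitivity (csum (U := K) (fun i k (p : mor (rep k) (G (rep i))) (q : mor (G (rep i)) (rep k)) =>
  scd (w ∘ emor F (dl h' f ∘ w' ∘ emor G (dl i f') ∘ p ∘ dl e k) ∘ v)
  * scd (q ∘ (emor G (X i) ∘ v')))).
  rewrite (csum_dl (f := f')) => [|i k p q fi]; last first.
    by rewrite (dl_neq fi) emor0 comp0r !comp0l emor0 comp0r comp0l scd0 mul0r.
  pose B k (p : mor (rep k) (G (rep f'))) : U0 := scd (w ∘ emor F (dl h' f ∘ w' ∘ p ∘ dl e k) ∘ v).
  have BL k : linear (@B k).
    by move=> l p q; rewrite /B comp_linr comp_linl emor_lin comp_linr comp_linl scd_lin.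
  transitivity (B c' (emor G (X f') ∘ v')).
    by rewrite !tmul_br teps_br /B /X /= !emor_comp -?compA.
  rewrite -(cas_eval _ BL); apply: eq_bigr => k _; apply: eq_bigr => p _.
  by rewrite dl_id emor_id compm1 mulrC.
apply: eq_csum => i k p q; rewrite !tmul_br !teps_br /X /=.
by congr (_ * _); congr scd; rewrite !emor_comp -?compA.
Qed.

(** Here the first leg of the Casimir element is contracted, with w' G(X). *)
Lemma teps_tmulMr (x y z : tube M) :
  teps (tmul (tmul x y) z)
  = sw (U := K^o) (tcomul y) (fun y1 y2 => teps (tmul x y2) * teps (tmul y1 z)).
Proof.
pose U0 : lmodType K := K^o.
move: x; apply: (@tube_ext_br _ _ _ _ U0 idfun).
- by move=> l p q; rewrite !tmul_linl teps_lin.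
- apply: sw_param_lin => y1 y2 l p q.
  by rewrite tmul_linl teps_lin mulrDl -mulrA.
move=> a b c e f h; move: (T M a b) => F v w.
move: z; apply: (@tube_ext_br _ _ _ _ U0 idfun).
- by move=> l p q; rewrite !tmul_linr teps_lin.
- apply: sw_param_lin => y1 y2 l p q.
  by rewrite tmul_linr teps_lin mulrDr mulrCA.
move=> a'' b'' c'' e'' f'' h''; move: (T M a'' b'') => H v'' w''.
move: y; apply: (@tube_ext_br _ _ _ _ U0 idfun).
- by move=> l p q; rewrite !tmul_linr !tmul_linl teps_lin.
- exact: (swc_lin (U := U0) (bilin_eps2r _ _).2).
move=> a' b' c' e' f' h'; move: (T M a' b') => G v' w'.
rewrite (@sw_comul _ _ _ _ U0 idfun); last exact: bilin_eps2r.
pose X i := dl h'' f' ∘ w'' ∘ emor H (dl e'' f'') ∘ v'' ∘ dl i c''.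
transitivity (csum (U := K) (fun i k (p : mor (rep k) (G (rep i))) (q : mor (G (rep i)) (rep k)) =>
  scd (w ∘ emor F (dl k f ∘ q ∘ (emor G (dl e' i) ∘ (v' ∘ dl e c'))) ∘ v)
  * scd (w' ∘ emor G (X i) ∘ p))).
  rewrite (csum_dl (f := e')) => [|i k p q fi]; last first.
    by rewrite (@dl_neq _ _ e') 1?eq_sym // emor0 comp0l comp0r emor0 comp0r comp0l scd0 mul0r.
  pose B k (q : mor (G (rep e')) (rep k)) : U0 :=
    scd (w ∘ emor F (dl k f ∘ q ∘ (v' ∘ dl e c')) ∘ v).
  have BL k : linear (@B k).
    by move=> l p q; rewrite /B comp_linr comp_linl emor_lin comp_linr comp_linl scd_lin.
  transitivity (B h' (w' ∘ emor G (X e'))).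
    by rewrite !tmul_br teps_br /B /X /= !emor_comp -?compA.
  rewrite -(cas_coeval _ BL); apply: eq_bigr => k _; apply: eq_bigr => p _.
  by rewrite dl_id emor_id comp1m mulrC.
apply: eq_csum => i k p q; rewrite !tmul_br !teps_br /X /=.
by congr (_ * _); congr scd; rewrite !emor_comp -?compA.
Qed.

End WeakHopfAlgebra.

(** * The antipode axioms *)

Section AntipodeAxioms.
Variables (K : numClosedFieldType) (C D : umfc K) (M : bimod C D).
Implicit Types (a : irr C) (b : irr D) (c e f h i k : irr M) (F G H : efun M)
  (d : duality M).

Lemma br_ut_r (y : irr M) c h (g : mor (rep c) (rep h)) :
  @br _ _ _ M (eid M) y y c h (idm _) g = scd g *: ut y c.
Proof.
have [E|ch] := eqVneq c h; last by rewrite (schur g ch) scd0 br0r scale0r.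
by case: h / E g => g; rewrite {1}(scdE g) brZr dl_id.
Qed.

Lemma br_ut_l (y : irr M) c e (g : mor (rep c) (rep e)) :
  @br _ _ _ M (eid M) c e y y g (idm _) = scd g *: ut c y.
Proof.
have [E|ch] := eqVneq c e; last by rewrite (schur g ch) scd0 br0l scale0r.
by case: e / E g => g; rewrite {1}(scdE g) brZl dl_id.
Qed.

Lemma tantir (x : tube M) :
  sw (tcomul x) (fun x1 x2 => tmul x1 (tanti x2))
  = sw (tcomul (tone M)) (fun u v => teps (tmul u x) *: v).
Proof.
have HB : bilin (fun x1 x2 : tube M => tmul x1 (tanti x2)).
  by split=> u; [exact: tmul_linl | exact: lin_comp (tmul_linr u) (@tanti_lin _ _ _ M)].
have HB' y : bilin (fun u v : tube M => teps (tmul u y) *: v).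
  split=> u; last exact: lin_scale (@lin_id _ _).
  by apply: lin_scalel => l p q; rewrite tmul_linl teps_lin.
move: x; apply: (@tube_ext_br _ _ _ _ _ idfun); first exact: swc_lin HB.2.
  apply: sw_param_lin => u v; apply: lin_scalel => l p q.
  by rewrite tmul_linr teps_lin.
move=> a b c e f h; rewrite -[T M a b]/(dG (dual_T M a b)); move: (dual_T M a b) => d v w.
rewrite (@sw_comul _ _ _ _ _ idfun) // sw_comul1 //.
pose Z := w ∘ emor (dG d) (dl e f ∘ (dcap d (rep e) ∘ emor (dQ d) v)).
(* By [flat_cup] the weighted basis sum is the cup. Dinaturality along it then reduces to the
   identity functor, and a zig-zag leaves the scalar of w v. *)
transitivity (\sum_k @br _ _ _ M (ecomp (dG d) (dQ d)) k k c h (dcup d (rep k)) Z).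
  rewrite /csum exchange_big; apply: eq_bigr => k _; rewrite -flat_cup br_suml.
  apply: eq_bigr => i _; rewrite br_suml; apply: eq_bigr => p _.
  rewrite (@tanti_dual _ _ _ _ d) (lin_Z (tmul_linr _)) tmul_br brZl; congr (_ *: _).
  by rewrite dl_id compm1.
apply: eq_bigr => y _.
have := @br_nat _ _ _ M (eid M) (ecomp (dG d) (dQ d)) _ y y c h (idm _) Z (dcupE d).
rewrite compm1 => <-.
have -> : Z ∘ dcup d (rep c) = w ∘ emor (dG d) (dl e f) ∘ v.
  by rewrite /Z !emor_comp -?compA -dcup_nat (rea (dzig _ _)) comp1m.
rewrite br_ut_r (bigD1 h) //= (bigD1 c) //= tmul_utl teps_br !dl_id compm1 comp1m.
rewrite !big1 ?addr0 // => [x xh|i ic].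
  rewrite big1 // => i _; rewrite tmul_utl teps_br (@dl_neq _ _ h) 1?eq_sym //.
  by rewrite !comp0l scd0 scale0r.
by rewrite tmul_utl teps_br (dl_neq ic) !comp0r scd0 scale0r.
Qed.

(** For matching labels, tr(w v) = tr(v w) is d_h times the scalar on the left and, by the trace
    property, d_f times the bent scalar on the right. *)
Lemma scd_sharp_flat d c e f h (v : mor (rep c) (dG d (rep e))) (w : mor (dG d (rep f)) (rep h)) :
  scd (w ∘ emor (dG d) (dl e f) ∘ v) = (qdimM f / qdimM h)
    * scd (dcap d (rep e) ∘ (emor (dQ d) (v ∘ dl h c ∘ w) ∘ (dcap d (rep f))^†)).
Proof.
have [E|ef] := eqVneq e f; last first.
  by rewrite dl_neq // emor0 comp0r comp0l scd0 scd_neq 1?eq_sym // mulr0.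
case: f / E w => w; rewrite dl_id emor_id compm1.
have [E|ch] := eqVneq c h; last first.
  by rewrite scd_neq // dl_neq 1?eq_sym // comp0r comp0l emor0 comp0l comp0r scd0 mulr0.
case: h / E w => w; rewrite !scd_sc; apply: (mulIf (qdimM_neq0 c)).
rewrite -tr_sc mulrAC divfK ?qdimM_neq0 // mulrC -tr_sc dl_id compm1 compA -dtr.
by rewrite tr_cyclic.
Qed.

(** The p p^† sum to the identity, leaving the cap alone in the second leg; dinaturality along it
    leaves a scalar. [tantim] uses this form again. *)
Lemma tantil_br d c e f h (v : mor (rep c) (dG d (rep e))) (w : mor (dG d (rep f)) (rep h)) :
  csum (fun i k p q => tmul (tanti (br p w)) (br v q))
  = scd (w ∘ emor (dG d) (dl e f) ∘ v) *: \sum_(x : irr M) ut f x.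
Proof.
pose V := emor (dQ d) (v ∘ dl h c ∘ w) ∘ (dcap d (rep f))^†.
rewrite scd_sharp_flat -/V.
rewrite -scalerA [in RHS]scaler_sumr scaler_sumr; apply: eq_bigr => i _.
have := @br_nat _ _ _ M (ecomp (dQ d) (dG d)) (eid M) _ f e i i V (idm _) (dcapE d).
rewrite br_ut_l comp1m => <-.
rewrite -[dcap d (rep i)]compm1 -[idm _](emor_id (dQ d)) -onb_full emor_sum comp_sumr br_sumr.
rewrite scaler_sumr; apply: eq_bigr => k _.
rewrite emor_sum comp_sumr br_sumr scaler_sumr; apply: eq_bigr => p _.
rewrite (@tanti_dual _ _ _ _ d) (lin_Z (tmul_linl _)) tmul_br; congr (_ *: _).
by rewrite dl_id comp1m /V !emor_comp -?compA.
Qed.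

Lemma tantil (x : tube M) :
  sw (tcomul x) (fun x1 x2 => tmul (tanti x1) x2)
  = sw (tcomul (tone M)) (fun u v => teps (tmul x v) *: u).
Proof.
have HB : bilin (fun x1 x2 : tube M => tmul (tanti x1) x2).
  by split=> u; [exact: lin_comp (tmul_linl u) (@tanti_lin _ _ _ M) | exact: tmul_linr].
have HB' y : bilin (fun u v : tube M => teps (tmul y v) *: u).
  split=> u; first exact: lin_scale (@lin_id _ _).
  by apply: lin_scalel => l p q; rewrite tmul_linr teps_lin.
move: x; apply: (@tube_ext_br _ _ _ _ _ idfun); first exact: swc_lin HB.2.
  apply: sw_param_lin => u v; apply: lin_scalel => l p q.
  by rewrite tmul_linl teps_lin.
move=> a b c e f h; rewrite -[T M a b]/(dG (dual_T M a b)); move: (dual_T M a b) => d v w.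
rewrite (@sw_comul _ _ _ _ _ idfun) // sw_comul1 // tantil_br scaler_sumr.
rewrite [RHS](bigD1 e) //= [X in _ = _ + X]big1 ?addr0 => [|y ye].
  apply: eq_bigr => x _; rewrite (bigD1 f) //= [X in _ = _ + X]big1 ?addr0 => [|i fi].
    by rewrite tmul_utr teps_br !dl_id !emor_id !comp1m compm1.
  by rewrite tmul_utr teps_br (dl_neq fi) emor0 comp0r !comp0l scd0 scale0r.
apply: big1 => x _; apply: big1 => i _.
by rewrite tmul_utr teps_br (@dl_neq _ _ e) 1?eq_sym // emor0 comp0l comp0r scd0 scale0r.
Qed.

(** Exchanging the two Casimir sums isolates S(x1) x2, a scalar times a sum of [ut] by [tantil_br].
    These select j = f, and contraction with w restores S(x). *)
Lemma tantim (x : tube M) :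
  sw (tcomul x) (fun x1 y => sw (tcomul y) (fun x2 x3 =>
      tmul (tmul (tanti x1) x2) (tanti x3))) = tanti x.
Proof.
have HB x1 : bilin (fun x2 x3 : tube M => tmul (tmul (tanti x1) x2) (tanti x3)).
  split=> u; first exact: lin_comp (tmul_linl _) (tmul_linr _).
  exact: lin_comp (tmul_linr _) (@tanti_lin _ _ _ M).
have HB' : bilin (fun x1 y : tube M => sw (tcomul y) (fun x2 x3 =>
      tmul (tmul (tanti x1) x2) (tanti x3))).
  split=> u; last exact: swc_lin (HB _).2.
  apply: sw_param_lin => v w.
  exact: lin_comp (tmul_linl _) (lin_comp (tmul_linl _) (@tanti_lin _ _ _ M)).
move: x; apply: (@tube_ext_br _ _ _ _ _ idfun); [exact: swc_lin HB'.2 | exact: tanti_lin | ].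
move=> a b c e f h; rewrite -[T M a b]/(dG (dual_T M a b)); move: (dual_T M a b) => d v w.
rewrite (@sw_comul _ _ _ _ _ idfun) //.
transitivity (csum (fun j l r s => tmul (csum (fun i k p q => tmul (tanti (br p w)) (br r q)))
    (tanti (@br _ _ _ M (dG d) c e j l v s)))).
  transitivity (csum (fun i k p q => csum (fun j l r s =>
     tmul (tmul (tanti (br p w)) (br r q)) (tanti (@br _ _ _ M (dG d) c e j l v s))))).
    by apply: eq_csum => i k p q; rewrite (@sw_comul _ _ _ _ _ idfun) //; apply: HB.
  rewrite csum_exchange; apply: eq_csum => j l r s.
  by apply: esym; apply: (@csum_lin _ _ _ _ _ _ idfun _ _ _ (tmul_linl _)).
pose B j l (s : mor (dG d (rep j)) (rep l)) : tube M := (qdimM j / qdimM l) *: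
  br (emor (dQ d) s ∘ (dcap d (rep j))^† ∘ dl f j) (dcap d (rep e) ∘ emor (dQ d) v).
transitivity (csum (fun j l r s => scd (w ∘ emor (dG d) (dl j f) ∘ r) *: B j l s)).
  apply: eq_csum => j l r s; rewrite tantil_br (lin_Z (tmul_linl _)); congr (_ *: _).
  rewrite (@tanti_dual _ _ _ _ d) (lin_Z (tmul_linr _)); congr (_ *: _).
  rewrite (lin_sum (tmul_linl _)) -[RHS]br_dl_sumr; apply: eq_bigr => x _.
  by rewrite tmul_utl.
rewrite (csum_dl (f := f)) => [|j l r s fj]; last first.
  by rewrite (dl_neq fj) emor0 comp0r comp0l scd0 scale0r.
rewrite (@tanti_dual _ _ _ _ d); transitivity (B f h w); last by rewrite /B dl_id compm1.
rewrite -(@cas_coeval _ _ _ M _ _ _ w (B f)) => [|l].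
  by apply: eq_bigr => l _; apply: eq_bigr => p _; rewrite dl_id emor_id compm1.
move=> k p q; rewrite /B emor_lin !comp_linl brl scalerDr !scalerA.
by rewrite [_ * k]mulrC.
Qed.

End AntipodeAxioms.

(** * Involution *)

Section Star.
Variables (K : numClosedFieldType) (C D : umfc K) (M : bimod C D).
Implicit Types (a : irr C) (b : irr D) (c e f h i k : irr M) (F G H : efun M)
  (d : duality M).

Definition tstar (x : tube M) : tube M := tanti (tconj x).

Lemma tstar_slin : slin Num.conj tstar.
Proof. by move=> l x y; rewrite /tstar tconj_slin tanti_lin. Qed.

Lemma qdimM_conj c : (qdimM c)^* = qdimM c.
Proof. by apply: conj_Creal; rewrite ger0_real // ltW // qdimM_gt0. Qed.

Lemma tstar_dual d c e f h (v : mor (rep c) (dG d (rep e))) (w : mor (dG d (rep f)) (rep h)) :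
  tstar (br v w) = (qdimM e / qdimM c) *:
    br (emor (dQ d) v^† ∘ (dcap d (rep e))^†) (dcap d (rep f) ∘ emor (dQ d) w^†).
Proof. by rewrite /tstar tconj_br (@tanti_dual _ _ _ _ d). Qed.

(** The second bending may be taken in the reversed duality, where it undoes the first by zig-zags;
    the weights d_e/d_c and d_c/d_e cancel. *)
Lemma tstarK : involutive tstar.
Proof.
apply: (@tube_ext_br _ _ _ _ _ idfun) => [l x y|//|a b c e f h].
  by rewrite !tstar_slin /= conjCK.
rewrite -[T M a b]/(dG (dual_T M a b)); move: (dual_T M a b) => d v w.
rewrite tstar_dual (slin_Z tstar_slin) (@tstar_dual (dual_rev d)) scalerA.
rewrite rmorphM fmorphV /= !qdimM_conj mulrA divfK ?qdimM_neq0 // divff ?qdimM_neq0 // scale1r.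
rewrite /= !dag_comp !emor_dag !dagK !emor_comp -?compA -dcup_nat.
by rewrite (rea (dzig _ _)) comp1m (rea (esym (dcup_natV _ _))) -?compA dzigV compm1.
Qed.

Lemma tconjM (x y : tube M) : tconj (tmul x y) = tmul (tconj x) (tconj y).
Proof.
move: x; apply: (@tube_ext_br _ _ _ _ _ Num.conj).
- by move=> l x x'; rewrite tmul_linl tconj_slin.
- by move=> l x x'; rewrite tconj_slin tmul_linl.
move=> a b c e f h; move: (T M a b) => F v w; move: y; apply: (@tube_ext_br _ _ _ _ _ Num.conj).
- by move=> l x x'; rewrite tmul_linr tconj_slin.
- by move=> l x x'; rewrite tconj_slin tmul_linr.
move=> a' b' c' e' f' h'; move: (T M a' b') => G v' w'.
rewrite tmul_br !tconj_br tmul_br !dag_comp !emor_dag !dag_comp !dl_dag.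
by rewrite (emor_dag F (dl h' f ∘ w')) dag_comp dl_dag.
Qed.

Lemma tstarM (x y : tube M) : tstar (tmul x y) = tmul (tstar y) (tstar x).
Proof. by rewrite /tstar tconjM tanti_mul. Qed.

(** Bending an orthonormal basis of Hom(k, dG i) gives, with weight d_i/d_k, dual bases of Hom(i, dQ
    k), so the involution carries Casimir elements to Casimir elements. *)
Lemma tcomul_star (x : tube M) :
  tcomul (tstar x) = sw (tcomul x) (fun x1 x2 => tstar x1 ⊠ tstar x2).
Proof.
have HB : sbilin Num.conj (fun x1 x2 : tube M => tstar x1 ⊠ tstar x2).
  by split=> u l p q; rewrite tstar_slin (pure_linl, pure_linr).
move: x; apply: (@tube_ext_br _ _ _ _ _ Num.conj).
- by move=> l p q; rewrite tstar_slin tcomul_lin.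
- by move=> l p q; rewrite tcomul_lin (sw_slin HB.2).
move=> a b c e f h; rewrite -[T M a b]/(dG (dual_T M a b)); move: (dual_T M a b) => d v w.
rewrite (sw_comul _ _ HB) tstar_dual (lin_Z (@tcomul_lin _ _ _ M)) tcomul_csum.
set V := emor _ v^† ∘ _; set W := _ ∘ emor _ w^†.
pose U0 : lmodType K := tens (tube M) (tube M).
pose X i k (P : mor (rep k) (dQ d (rep i))) (Q : mor (dQ d (rep i)) (rep k)) : U0 :=
  (qdimM e / qdimM c) *: (br P W ⊠ br V Q).
have HX i k : bilin (@X i k).
  by split=> u l p q; rewrite /X (brl, brr) (pure_linl, pure_linr) scalerDr !scalerA mulrC.
rewrite (@csum_lin _ _ _ _ _ _ idfun _ _ _ (lin_scale (qdimM e / qdimM c) (@lin_id _ _))).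
rewrite -[LHS]/(csum X) /csum exchange_big; apply: eq_bigr => i _; apply: eq_bigr => k _.
rewrite -(@cas_resolve _ _ _ i _ (X k i) _ _ _ (HX k i) (@flat_resolve _ _ _ _ d i k)).
apply: eq_bigr => p _; rewrite !tstar_dual dagK.
rewrite (lin_Z (pure_linl _)) (lin_Z (pure_linr _)) (lin_Z ((HX k i).2 _)).
by [].
Qed.

End Star.

(** * Positivity and the faithful representation *)

Section PositiveForm.
Variables (K : numClosedFieldType) (C D : umfc K) (M : bimod C D).
Implicit Types (a : irr C) (b : irr D) (c e f h : irr M) (F G H : efun M)
  (d : duality M).

(** Indices r and s exist only if a and b occur in the unit objects. *)
Definition eta a b (r : 'I_(onb_size a (munit : C))) (s : 'I_(onb_size b (munit : D))) (m : M) :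
    mor (T M a b m) m :=
  locked (bun m ∘ bactm (onb r) (idm m) (onb s)).

Lemma eta_enat a b r s : @enat _ _ _ _ (T M a b) (eid M) (onb r) (onb s) (@eta a b r s).
Proof.
move=> m; rewrite /eta -lock /= compA (bun_unitary m).1 comp1m compm1.
by [].
Qed.

(* The coefficient of the unit objects: it is positive on nonzero x^* x. *)
Definition tphi (x : tube M) : K := tube_lift (U := K^o) idfun
  (fun a b c e f h v w => \sum_r \sum_s
     scd (@eta a b r s (rep e) ∘ v) * scd (w ∘ (@eta a b r s (rep f))^†)) x.

Lemma tphi_lin : scalar tphi.
Proof. exact: (@tube_lift_slin _ _ _ _ _ K^o). Qed.

Lemma tphi_tb a b c e f h
    (v : mor (rep c) (T M a b (rep e))) (w : mor (T M a b (rep f)) (rep h)) :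
  tphi (tb v w) = \sum_r \sum_s
    scd (@eta a b r s (rep e) ∘ v) * scd (w ∘ (@eta a b r s (rep f))^†).
Proof.
rewrite /tphi tube_lift_tb //; split=> u; apply: lin_bigsum => r; apply: lin_bigsum => s l x y.
  by rewrite comp_linr scd_lin mulrDl -mulrA.
by rewrite comp_linl scd_lin mulrDr mulrCA.
Qed.

Definition tau F (i : ix (eA F)) (j : ix (eB F)) r s (m : M) : mor (F m) m :=
  @eta (tag i) (tag j) r s m ∘ (emb i j m)^†.

Lemma tau_enat F i j r s :
  @enat _ _ _ _ F (eid M) (onb r ∘ (ov i)^†) (onb s ∘ (ov j)^†) (@tau F i j r s).
Proof. exact: enat_comp (eta_enat r s) (enat_dag (emb_enat i j)). Qed.

Lemma tphi_br F c e f h (v : mor (rep c) (F (rep e))) (w : mor (F (rep f)) (rep h)) :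
  tphi (br v w) = \sum_i \sum_j \sum_r \sum_s
    scd (@tau F i j r s (rep e) ∘ v) * scd (w ∘ (@tau F i j r s (rep f))^†).
Proof.
rewrite (@lin_sum _ _ K^o _ tphi_lin); apply: eq_bigr => i _.
rewrite (@lin_sum _ _ K^o _ tphi_lin); apply: eq_bigr => j _.
rewrite tphi_tb; apply: eq_bigr => r _; apply: eq_bigr => s _.
by rewrite /tau dag_comp dagK -?compA.
Qed.

Lemma unit_exp (E : monoidal K) (A : E) (g : mor A munit) :
  g = \sum_(i : ix A) \sum_(r < onb_size (tag i) (munit : E))
        sc ((onb r)^† ∘ (g ∘ ov i)) *: (onb r ∘ (ov i)^†).
Proof.
rewrite -[LHS]compm1 -ov_full comp_sumr; apply: eq_bigr => i _.
rewrite compA {1}(onb_exp (g ∘ ov i)) comp_suml; apply: eq_bigr => r _.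
by rewrite compZl.
Qed.

(** By [unit_exp], every induced transformation from F to the identity functor is a combination of
    the [tau]. *)
Lemma enat_unit_zero F (f : mor (eA F) munit) (g : mor (eB F) munit) t : @enat _ _ _ _ F (eid M) f g t ->
  (forall i j r s m, @tau F i j r s m = 0) -> forall m, t m = 0.
Proof.
move=> Ht H0 m; apply: (unitary_injl (unitary_dag (bun_unitary m))).
have -> := Ht m; rewrite comp0r (unit_exp f) (unit_exp g).
rewrite (lin_sum (bactm_lin1 _ _)) comp_suml big1 // => i _.
rewrite (lin_sum (bactm_lin1 _ _)) comp_suml big1 // => r _.
rewrite (lin_sum (bactm_lin3 _ _)) comp_suml big1 // => j _.
rewrite (lin_sum (bactm_lin3 _ _)) comp_suml big1 // => s _.
rewrite (lin_Z (bactm_lin1 _ _)) (lin_Z (bactm_lin3 _ _)) !compZl.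
have := tau_enat r s m; rewrite H0 comp0r => <-.
by rewrite !scaler0.
Qed.

Section Cap.
Variables (a : irr C) (b : irr D).

(** Transposition leads to transformations from T a' b' to T a b, where Schur's lemma applies to the
    inducing morphisms ([tau_cap], [tau_neq]). *)
Lemma transpose_T a' b' (f : mor (_ ⊗ _) munit) (g : mor (_ ⊗ _) munit) (t : forall m, mor (ecomp (Td M a b) (T M a' b') m) m) :
  @enat _ _ _ _ (ecomp (Td M a b) (T M a' b')) (eid M) f g t ->
  exists u w, @enat _ _ _ _ (T M a' b') (T M a b) u w
    (fun m => emor (T M a b) (t m) ∘ cup a b (T M a' b' m)).
Proof.
move=> Ht; have tE : isE (F := ecomp (Td M a b) (T M a' b')) (G := eid M) t by exists f, g.
have H := isE_comp (isE_unitr (T M a b)) (isE_comp (isE_whiskerl (T M a b) tE)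
  (isE_comp (isE_assoc (T M a b) (Td M a b) (T M a' b'))
  (isE_comp (isE_whiskerr (T M a' b') (dcupE (dual_T M a b))) (isE_unitlV (T M a' b'))))).
by apply: isE_ext H _ => m; rewrite compm1 !comp1m.
Qed.

Lemma untranspose (x : M) (n : M) (t : mor (Td M a b x) n) :
  t = lcap a b n ∘ emor (Td M a b) (emor (T M a b) t ∘ cup a b x).
Proof.
rewrite emor_comp compA; have -> := @dcap_nat _ _ _ _ (dual_T M a b) _ _ t.
by rewrite -compA cup_cap compm1.
Qed.

Lemma tau_cap (i : ix (eA (ecomp (Td M a b) (T M a b)))) j r s :
  exists l : K, forall m, @tau (ecomp (Td M a b) (T M a b)) i j r s m = l *: lcap a b m.
Proof.
have [f [g Hfg]] := transpose_T (tau_enat r s).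
exists (sc f * sc g) => m; rewrite [LHS](untranspose (tau r s m)).
have -> : emor (T M a b) (tau r s m) ∘ cup a b (T M a b m) = (sc f * sc g) *: idm _.
  have := Hfg m; rewrite /= comp1m compm1 => ->.
  rewrite (scE (rep_simple a) f) (scE (rep_simple b) g).
  rewrite (lin_Z (bactm_lin1 _ _)) (lin_Z (bactm_lin3 _ _)) scalerA bactm1.
  by rewrite !sc_scale //; apply: rep_simple.
by rewrite emorZ emor_id compZr compm1.
Qed.

Lemma tau_neq a' b' (i : ix (eA (ecomp (Td M a b) (T M a' b')))) j r s m :
  (a != a') || (b != b') -> @tau (ecomp (Td M a b) (T M a' b')) i j r s m = 0.
Proof.
move=> ab; have [f [g Hfg]] := transpose_T (tau_enat r s).
rewrite [LHS](untranspose (tau r s m)).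
have -> : emor (T M a b) (tau r s m) ∘ cup a b (T M a' b' m) = 0.
  have := Hfg m; rewrite /= comp1m compm1 => ->.
  have [aa|aa] := eqVneq a a'; last by rewrite (schur f) 1?eq_sym // (lin_0 (bactm_lin1 _ _)).
  rewrite aa eqxx /= in ab; rewrite (schur g) 1?eq_sym //.
  exact: (lin_0 (bactm_lin3 _ _)).
by rewrite emor0 comp0r.
Qed.

Definition tau_coef i j r s : K := sval (cid (@tau_cap i j r s)).

Definition tnorm : K := \sum_i \sum_j \sum_r \sum_s `|@tau_coef i j r s| ^+ 2.

Lemma tau_coefE i j r s m :
  @tau (ecomp (Td M a b) (T M a b)) i j r s m = @tau_coef i j r s *: lcap a b m.
Proof. exact: (svalP (cid (@tau_cap i j r s))). Qed.

(** If N were zero, all [tau] and hence [cap] would vanish; the zig-zag would then annihilate the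
    basis vector p. *)
Lemma tnorm_gt0 c e (p : 'I_(onb_size c (T M a b (rep e)))) : 0 < tnorm.
Proof.
have sum_eq0 (I : finType) (F : I -> K) : (forall i, 0 <= F i) ->
    \sum_i F i = 0 -> forall i, F i = 0.
  by move=> F0 /(psumr_eq0P (fun i _ => F0 i)) H i; apply: H.
rewrite lt_neqAle; apply/andP; split; last first.
  by do 4 (apply: sumr_ge0 => ? _); rewrite exprn_ge0.
apply/eqP => /esym N0.
have t0 i j r s m : @tau (ecomp (Td M a b) (T M a b)) i j r s m = 0.
  rewrite tau_coefE; suff -> : @tau_coef i j r s = 0 by rewrite scale0r.
  have N1 := sum_eq0 _ _ _ N0 i; have N2 := sum_eq0 _ _ _ (N1 _) j.
  have N3 := sum_eq0 _ _ _ (N2 _ _) r; have N4 := sum_eq0 _ _ _ (N3 _ _ _) s.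
  apply/eqP; rewrite -normr_eq0 -sqrf_eq0; apply/eqP; apply: N4 => ?;
    do ?(apply: sumr_ge0 => ? _); exact: exprn_ge0.
have c0 : lcap a b (rep e) = 0 := enat_unit_zero (@lcap_enat _ _ _ M a b) t0 (rep e).
have := onb_orth p p; rewrite eqxx scale1r -[onb p]comp1m -(cap_cup a b (rep e)) c0.
rewrite emor0 !comp0l comp0r => /esym H.
by have := simple_id_neq0 (rep_simple c); rewrite H eqxx.
Qed.

End Cap.

Definition hform (x y : tube M) : K := tphi (tmul (tstar x) y).

Lemma hform_linr x : scalar (hform x).
Proof. by move=> l y z; rewrite /hform tmul_linr tphi_lin. Qed.

Lemma hform_linl l (x x' y : tube M) :
  hform (l *: x + x') y = l^* * hform x y + hform x' y.
Proof. by rewrite /hform tstar_slin tmul_linl tphi_lin. Qed.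

Lemma hform_tb a b c e f h a' b' c' e' f' h'
    (v : mor (rep c) (T M a b (rep e))) (w : mor (T M a b (rep f)) (rep h))
    (v' : mor (rep c') (T M a' b' (rep e'))) (w' : mor (T M a' b' (rep f')) (rep h')) :
  hform (tb v w) (tb v' w') = (qdimM e / qdimM c) *
    \sum_i \sum_j \sum_r \sum_s
      scd (@tau (ecomp (Td M a b) (T M a' b')) i j r s (rep e')
           ∘ (emor (Td M a b) (v' ∘ dl c c' ∘ v^†) ∘ (lcap a b (rep e))^†))
      * scd (lcap a b (rep f) ∘ emor (Td M a b) (w^† ∘ dl h' h ∘ w')
           ∘ (@tau (ecomp (Td M a b) (T M a' b')) i j r s (rep f'))^†).
Proof.
rewrite /hform -!br_T (@tstar_dual _ _ _ _ (dual_T M a b)) (lin_Z (tmul_linl _)) tmul_br.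
rewrite (@lin_Z _ _ K^o _ tphi_lin) tphi_br; congr (_ * _).
apply: eq_bigr => i _; apply: eq_bigr => j _; apply: eq_bigr => r _; apply: eq_bigr => s _.
congr (_ * _); congr scd.
  by rewrite (rea (esym (emor_comp _ _ _))) -?compA.
by rewrite -(compA (dcap _ _)) -emor_comp -?compA.
Qed.

Lemma scdZ c e l (g : mor (rep c : M) (rep e)) : scd (l *: g) = l * scd g.
Proof. exact: (@lin_Z _ _ K^o _ (@scd_lin _ _ c e)). Qed.

Lemma hform_T a b c e f h c' e' f' h'
    (v : mor (rep c) (T M a b (rep e))) (w : mor (T M a b (rep f)) (rep h))
    (v' : mor (rep c') (T M a b (rep e'))) (w' : mor (T M a b (rep f')) (rep h')) :
  hform (tb v w) (tb v' w') = (qdimM e / qdimM c) * (tnorm a b *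
      (scd (lcap a b (rep e')
           ∘ (emor (Td M a b) (v' ∘ dl c c' ∘ v^†) ∘ (lcap a b (rep e))^†))
      * scd (lcap a b (rep f)
           ∘ (emor (Td M a b) (w^† ∘ dl h' h ∘ w') ∘ (lcap a b (rep f'))^†)))).
Proof.
rewrite hform_tb; congr (_ * _); rewrite !mulr_suml; apply: eq_bigr => i _.
rewrite mulr_suml; apply: eq_bigr => j _; rewrite mulr_suml; apply: eq_bigr => r _.
rewrite mulr_suml; apply: eq_bigr => s _.
rewrite !tau_coefE compZl scdZ dagZ compZr scdZ normCK mulrACA -?compA.
by [].
Qed.

Lemma sharp_flat_neq d c e c' e' (u : mor (rep c) (dG d (rep e))) (v : mor (rep c') (dG d (rep e'))) :
  (c != c') || (e != e') ->
  scd (dcap d (rep e') ∘ (emor (dQ d) (v ∘ dl c c' ∘ u^†) ∘ (dcap d (rep e))^†)) = 0.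
Proof.
case/orP=> [cc|ee]; last by rewrite scd_neq.
by rewrite (dl_neq cc) comp0r comp0l emor0 comp0l comp0r scd0.
Qed.

(** Times d_e this is tr(q p^†) by the trace property, and tr(p^† q) by cyclicity. *)
Lemma sharp_flat_onb d c e (p q : 'I_(onb_size c (dG d (rep e)))) :
  scd (dcap d (rep e) ∘ (emor (dQ d) (onb q ∘ dl c c ∘ (onb p)^†) ∘ (dcap d (rep e))^†))
  = (p == q)%:R * (qdimM c / qdimM e).
Proof.
apply: (mulIf (qdimM_neq0 e)); rewrite scd_sc -tr_sc compA -dtr dl_id compm1 tr_cyclic.
by rewrite onb_orth trZ mulrA divfK ?qdimM_neq0.
Qed.

Definition bidx (l : tube_label M) : finType :=
  let: ((a, b), (c, e), (f, h)) := l in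
  ('I_(onb_size c (T M a b (rep e))) * 'I_(onb_size h (T M a b (rep f))))%type.

Definition bvec (l : tube_label M) : bidx l -> tube M :=
  match l return bidx l -> tube M with
  | ((a, b), (c, e), (f, h)) => fun t =>
      tb (onb t.1 : mor (rep c) (T M a b (rep e))) ((onb t.2)^† : mor (T M a b (rep f)) (rep h))
  end.

Definition bnorm (l : tube_label M) : K :=
  let: ((a, b), (c, e), (f, h)) := l in
  tnorm a b * (qdimM h / qdimM f).

Lemma hform_bvec_neq l l' t t' : l != l' -> hform (@bvec l t) (@bvec l' t') = 0.
Proof.
case: l t => [[[a b] [c e]] [f h]] [p q]; case: l' t' => [[[a' b'] [c' e']] [f' h']] [p' q'] /=.
rewrite !xpair_eqE !negb_and -!orbA => ll.
have [ab|] := boolP ((a != a') || (b != b')).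
  rewrite hform_tb big1 ?mulr0 // => i _; rewrite big1 // => j _; rewrite big1 // => r _.
  by rewrite big1 // => s _; rewrite tau_neq // comp0l scd0 mul0r.
rewrite negb_or !negbK => /andP[/eqP Ea /eqP Eb]; rewrite Ea Eb !eqxx /= in ll.
case: a' / Ea in p' q' *; case: b' / Eb in p' q' *; rewrite hform_T dagK.
have [ce|] := boolP ((c != c') || (e != e')).
  by rewrite (@sharp_flat_neq (dual_T M a b)) // mul0r !mulr0.
rewrite negb_or !negbK => /andP[/eqP Ec /eqP Ee]; rewrite Ec Ee !eqxx /= in ll.
by rewrite (@sharp_flat_neq (dual_T M a b) h' f' h f) ?mulr0 // orbC (eq_sym f') (eq_sym h').
Qed.

Lemma hform_bvec l t t' : hform (@bvec l t) (@bvec l t') = (t == t')%:R * bnorm l.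
Proof.
case: l t t' => [[[a b] [c e]] [f h]] [p q] [p' q'] /=; rewrite hform_T dagK.
rewrite !(@sharp_flat_onb (dual_T M a b)) xpair_eqE [q' == q]eq_sym.
rewrite -mulnb natrM.
have [e0 c0 f0] := And3 (qdimM_neq0 e) (qdimM_neq0 c) (qdimM_neq0 f).
by field; rewrite e0 c0 f0.
Qed.

Lemma bnorm_gt0 l (t : bidx l) : 0 < bnorm l.
Proof.
case: l t => [[[a b] [c e]] [f h]] [p q] /=.
by rewrite mulr_gt0 ?(tnorm_gt0 p) // divr_gt0 ?qdimM_gt0.
Qed.

Lemma bvec_span (x : tube M) :
  exists k : {l : tube_label M & bidx l} -> K, x = \sum_j k j *: bvec (tagged j).
Proof.
move: x; pose P (x : tube M) := exists k : {l : tube_label M & bidx l} -> K, x = \sum_j k j *: bvec (tagged j).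
have P0 : P 0 by exists (fun=> 0); rewrite big1 // => j _; rewrite scale0r.
have PD l x y : P x -> P y -> P (l *: x + y).
  move=> [k ->] [k' ->]; exists (fun j => l * k j + k' j).
  rewrite scaler_sumr -big_split; apply: eq_bigr => j _.
  by rewrite scalerDl scalerA.
have Psum (I : finType) (F : I -> tube M) (k : I -> K) :
    (forall i, P (F i)) -> P (\sum_i k i *: F i).
  by move=> PF; apply: (big_ind P) => // [y z|i _];
    [rewrite -{2}[y]scale1r; apply: PD | rewrite -[_ *: _]addr0; apply: PD].
have Pb l (t : bidx l) : P (bvec t).
  exists (fun j => (j == Tagged (fun l => bidx l) t)%:R).
  rewrite (bigD1 (Tagged (fun l => bidx l) t)) //= eqxx scale1r big1 ?addr0 // => j /negbTE ->.
  by rewrite scale0r.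
apply: tube_ind => // a b c e f h v w.
rewrite (onb_exp (v : mor (rep c) (T M a b (rep e)))) (lin_sum ((tb_bilin _ _ _ _ _ _).1 _)).
under eq_bigr do rewrite (lin_Z ((tb_bilin _ _ _ _ _ _).1 _)).
apply: (Psum) => p.
rewrite (onb_coexp (w : mor (T M a b (rep f)) (rep h))) (lin_sum ((tb_bilin _ _ _ _ _ _).2 _)).
under eq_bigr do rewrite (lin_Z ((tb_bilin _ _ _ _ _ _).2 _)).
by apply: (Psum) => q; apply: (Pb ((a, b), (c, e), (f, h)) (p, q)).
Qed.

End PositiveForm.

Section Representation.
Variables (K : numClosedFieldType) (C D : umfc K) (M : bimod C D).

Let J : finType := {l : tube_label M & bidx l}.

Lemma hform_gram (j j' : J) :
  hform (bvec (tagged j)) (bvec (tagged j')) = (j == j')%:R * bnorm (tag j).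
Proof.
case: j j' => [l t] [l' t'] /=; have [E|ll] := eqVneq l l'.
  by case: l' / E t' => t'; rewrite hform_bvec eq_Tagged.
rewrite hform_bvec_neq //; have /negbTE -> : Tagged (fun l => bidx l) t != Tagged (fun l => bidx l) t'.
  by apply: contra ll => /eqP /(congr1 tag) /= ->.
by rewrite mul0r.
Qed.

Lemma hform_exp (k k' : J -> K) :
  hform (\sum_j k j *: bvec (tagged j)) (\sum_j k' j *: bvec (tagged j))
  = \sum_j (k j)^* * k' j * bnorm (tag j).
Proof.
have hl (z : tube M) : slin (U := tube M) (V := K^o) Num.conj (fun x => hform x z).
  by move=> l x y; rewrite hform_linl.
rewrite (slin_sum (hl _)); apply: eq_bigr => j _; rewrite (slin_Z (hl _)).
rewrite (@lin_sum _ _ K^o _ (hform_linr _)) (bigD1 j) //=.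
rewrite (@lin_Z _ _ K^o _ (hform_linr _)) hform_gram eqxx mul1r big1 ?addr0 => [|i ij].
  exact: mulrA.
by rewrite (@lin_Z _ _ K^o _ (hform_linr _)) hform_gram eq_sym (negbTE ij) mul0r scaler0.
Qed.

Lemma hform_herm (x y : tube M) : hform y x = (hform x y)^*.
Proof.
have [k ->] := bvec_span x; have [k' ->] := bvec_span y; rewrite !hform_exp rmorph_sum.
apply: eq_bigr => j _; rewrite !rmorphM /= conjCK [(k' j)^* * _]mulrC; congr (_ * _).
by apply/esym/conj_Creal; rewrite ger0_real // ltW // (bnorm_gt0 (tagged j)).
Qed.

Lemma hform_gt0 (x : tube M) : x != 0 -> 0 < hform x x.
Proof.
have [k ->] := bvec_span x => x0; rewrite hform_exp.
have P j : 0 <= (k j)^* * k j * bnorm (tag j).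
  apply: mulr_ge0; first by rewrite mulrC mul_conjC_ge0.
  exact/ltW/(bnorm_gt0 (tagged j)).
rewrite lt_neqAle sumr_ge0 // andbT eq_sym; apply: contra x0 => /eqP.
move/(psumr_eq0P (fun j _ => P j)) => H; apply/eqP; apply: big1 => j _.
have /eqP := H j isT; rewrite mulf_eq0 (gt_eqF (bnorm_gt0 (tagged j))) orbF mulrC mul_conjC_eq0.
by move/eqP ->; rewrite scale0r.
Qed.

Lemma faithful_rep : exists n (rho : tube M -> 'M[K]_n),
  [/\ linear rho, injective rho, rho (tone M) = 1%:M,
      forall x y, rho (tmul x y) = rho x *m rho y
    & forall x, rho (tstar x) = (map_mx Num.conj (rho x))^T].
Proof.
have [b [bo bs]] := orthonormal_basis_exists (@hform_linr _ _ _ M) hform_herm hform_gt0.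
exists _, (fun z => \matrix_(i, j) hform (b i) (tmul z (b j))); split.
- by move=> l x y; apply/matrixP => i j; rewrite !mxE tmul_linl hform_linr.
- move=> x y /matrixP E.
  have H z : tmul x z = tmul y z.
    rewrite (bs z) !(lin_sum (tmul_linr _)); apply: eq_bigr => j _.
    rewrite !(lin_Z (tmul_linr _)); congr (_ *: _).
    rewrite [LHS]bs [RHS]bs; apply: eq_bigr => i _.
    by have := E i j; rewrite !mxE => ->.
  by rewrite -(tmul1r x) H tmul1r.
- by apply/matrixP => i j; rewrite !mxE tmul1l bo.
- move=> x y; apply/matrixP => i j; rewrite !mxE -tmulA {1}(bs (tmul y (b j))).
  rewrite (lin_sum (tmul_linr _)) (@lin_sum _ _ K^o _ (hform_linr _)); apply: eq_bigr => k _.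
  by rewrite (lin_Z (tmul_linr _)) (@lin_Z _ _ K^o _ (hform_linr _)) !mxE mulrC.
(* Adjointness is (x b_i)^* b_j = b_i^* (x^* b_j). *)
move=> x; apply/matrixP => i j; rewrite !mxE -hform_herm /hform tstarM tmulA.
by [].
Qed.

End Representation.

(** * The unit over common components *)

Section Unit.
Variables (K : numClosedFieldType) (C D : umfc K) (M : bimod C D).

(** The inclusions of the summands 1_i also resolve the identity of the unit object, hence compute
    the same Casimir elements. *)
Lemma cas_unit (U : lmodType K) (E : umfc K)
    (B : forall k : irr E, mor (rep k) munit -> mor munit (rep k) -> U) :
  (forall k, bilin (B k)) ->
  \sum_(t : ix (munit : E)) B _ (ov t) (ov t)^† = \sum_i B (uirr i) (uinc i) (uinc i)^†.
Proof.
move=> HB; rewrite -(ix_sum (fun k p => B k (onb p) (onb p)^†)).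
transitivity (\sum_k \sum_i B k (uinc i ∘ dl k (uirr i)) (dl (uirr i) k ∘ (uinc i)^†)).
  apply: eq_bigr => k _; apply: esym; apply: (cas_resolve (HB k)) => f.
  rewrite -{1}[f]comp1m -(orth_sum_full (uinc_sum E)) comp_suml; apply: eq_bigr => i _.
  by rewrite -compA {1}(scdE ((uinc i)^† ∘ f)) compZr /scd compA.
rewrite exchange_big; apply: eq_bigr => i _; rewrite (bigD1 (uirr i)) //= dl_id.
rewrite compm1 comp1m big1 ?addr0 // => k ki.
by rewrite dl_neq // comp0r (lin_0 ((HB k).1 _)).
Qed.

Lemma comp_unit_isom (i : uidx C) (j : uidx D) (m : M) :
  (comp_unit i j m)^† ∘ comp_unit i j m = idm _.
Proof.
have [u1 _] := bun_unitary m; rewrite /comp_unit -bunE dag_comp -?compA (compA _ (bun m)) u1.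
rewrite comp1m bactm_dag -bactm_comp dag_id comp1m.
by rewrite !(orth_sum_isom (uinc_sum _)) bactm1.
Qed.

(** The isometry u has u u^† an idempotent scalar, as x is simple. So u is zero or unitary, and in
    the latter case it places x in the component. *)
Lemma comp_unit_eq0 (i : uidx C) (j : uidx D) (x : irr M) :
  ~ in_component i j (rep x) -> comp_unit i j (rep x) = 0.
Proof.
move=> H; set u := comp_unit _ _ _.
have uu : u^† ∘ u = idm _ := comp_unit_isom i j (rep x).
have E := scE (rep_simple x) (u ∘ u^†).
have [l0|l0] := eqVneq (sc (u ∘ u^†)) 0; first by apply: dag_eq0r; rewrite E l0 scale0r.
case: H; exists (rep x), u^†, u; split=> //; rewrite E.
suff -> : sc (u ∘ u^†) = 1 by rewrite scale1r.
apply: (mulfI l0); rewrite mulr1 -(sc_comp (rep_simple x)).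
by rewrite -compA (compA u^†) uu comp1m.
Qed.

Lemma tone_unit : tone M = tube_unit M.
Proof.
have utE (y x : irr M) : ut y x = \sum_(i : uidx C) \sum_(j : uidx D)
    tb (comp_unit i j (rep y))^† (comp_unit i j (rep x)).
  rewrite /ut br_kap; pose U0 : lmodType K := tube M.
  pose B (k : irr C) (s : irr D) (p : mor (rep k) munit) p' (q : mor (rep s) munit) q' : U0 :=
    tb (bactm p' (idm _) q' ∘ (bun (rep y))^†) (bun (rep x) ∘ bactm p (idm _) q).
  have Bp k s q q' : bilin (fun p p' => @B k s p p' q q').
    by split=> u l p p'; rewrite /B bactm_lin1 (comp_linl, comp_linr) (tbl, tbr).
  have Bq k s p p' : bilin (@B k s p p').
    by split=> u l q q'; rewrite /B bactm_lin3 (comp_linl, comp_linr) (tbl, tbr).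
  transitivity (\sum_(t : ix (munit : C)) \sum_(j : uidx D)
     B _ _ (ov t) (ov t)^† (uinc j) (uinc j)^†).
    apply: eq_bigr => t _.
    rewrite -(@cas_unit U0 D (fun s q q' => B _ s (ov t) (ov t)^† q q')) //.
    by apply: eq_bigr => s _; rewrite /B /= compm1 dagK comp1m.
  rewrite exchange_big [RHS]exchange_big; apply: eq_bigr => j _.
  rewrite (@cas_unit U0 C (fun k p p' => B k _ p p' (uinc j) (uinc j)^†)) //.
  by apply: eq_bigr => i _; rewrite /B /comp_unit !bunE dag_comp bactm_dag dag_id.
rewrite /tone /tube_unit; under eq_bigr do under eq_bigr do rewrite utE.
under eq_bigr do rewrite -exchange_big3.
rewrite exchange_big; apply: eq_bigr => i _; rewrite exchange_big; apply: eq_bigr => j _.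
rewrite exchange_big [RHS]big_mkcond; apply: eq_bigr => x _ /=.
case: asboolP => [xi|/comp_unit_eq0 ->]; last first.
  by apply: big1 => y _; rewrite (lin_0 ((tb_bilin _ _ _ _ _ _).2 _)).
rewrite [RHS]big_mkcond; apply: eq_bigr => y _.
case: asboolP => [//|/comp_unit_eq0 ->].
by rewrite dag0 (lin_0 ((tb_bilin _ _ _ _ _ _).1 _)).
Qed.

End Unit.

(** * Assembly and agreement with the prescribed formulas *)

Section MainResult.
Variables (K : numClosedFieldType) (C D : umfc K) (M : bimod C D).

Definition tube_wha : wha_data (tube M) :=
  WHAData (tone M) (@tmul _ _ _ M) (@teps _ _ _ M) (@tcomul _ _ _ M) (@tanti _ _ _ M)
    (@tstar _ _ _ M).

Lemma tube_weak_hopf : is_weak_hopf tube_wha.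
Proof.
split=> /=.
- exact: tmul_linl.
- exact: tmul_linr.
- exact: teps_lin.
- exact: tcomul_lin.
- exact: tanti_lin.
- exact: tmulA.
- exact: tmul1l.
- exact: tmul1r.
- exact: tcomulA.
- exact: teps_tcomul_l.
- exact: teps_tcomul_r.
- exact: tcomulM.
- exact: tcomul1l.
- exact: tcomul1r.
- exact: teps_tmulMl.
- exact: teps_tmulMr.
- exact: tantir.
- exact: tantil.
- exact: tantim.
Qed.

Lemma tube_cstar_weak_hopf : is_cstar_weak_hopf tube_wha.
Proof.
split=> /=.
- exact: tube_weak_hopf.
- exact: tstar_slin.
- exact: tstarK.
- exact: tstarM.
- exact: tcomul_star.
- exact: faithful_rep.
Qed.

Lemma tmul_spec : tube_mul_spec (@tmul _ _ _ M).
Proof.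
split=> [a a' b b' c e f h e' f' v w v' w' P Q|a a' b b' c e f h c' e' f' h' v w v' w'].
  pose G := ecomp (T M a b) (T M a' b').
  have kE m : ekap G m = bassoc (rep a) (rep a') m (rep b') (rep b).
    by rewrite /= basE bactm1 !compm1.
  rewrite tmul_tb !dl_id compm1 comp1m -(@br_reduce _ _ _ M G _ _ _ _ _ _ P Q) !kE.
  by congr tb_reduce; rewrite compA.
case/orP=> lab; rewrite tmul_tb; last by rewrite (dl_neq lab) comp0r emor0 comp0l br0l.
by rewrite (@dl_neq _ _ h') 1?eq_sym // comp0l emor0 comp0r br0r.
Qed.

Lemma teps_spec : tube_counit_spec (@teps _ _ _ M).
Proof.
split=> [a b e h v w|a b c e f h v w lab].
  by rewrite teps_tb dl_id emor_id compm1 scd_sc -scE //; apply: rep_simple.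
rewrite teps_tb; case/orP: lab => [ef|ch]; last by rewrite scd_neq // scale0r.
by rewrite dl_neq // emor0 comp0r comp0l scd0 scale0r.
Qed.

Lemma tcomul_spec : tube_comul_spec (@tcomul _ _ _ M).
Proof.
move=> a b c e f h v w P; rewrite tcomul_tb; apply: eq_bigr => i _; apply: eq_bigr => k _.
apply: esym; apply: (@cas_dual _ M (tens (tube M) (tube M)) k _
  (fun p q => tb p w ⊠ tb v q) (P i k)).
by split=> u l x y; rewrite (tbl, tbr) (pure_linl, pure_linr).
Qed.

Lemma tstar_spec : tube_star_spec (@tstar _ _ _ M).
Proof. by move=> a b c e f h v w; rewrite /tstar tconj_tb tanti_flat_sharp. Qed.

End MainResult.

Local Open Scope complex_scope.

Theorem proposition13 (R : realType) (C D : umfc R[i]) (M : bimod C D) :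
  exists H : wha_data (tube M),
    is_cstar_weak_hopf H
    /\ [/\ hone H = tube_unit M,
           tube_mul_spec (hmul H),
           tube_counit_spec (hcounit H),
           tube_comul_spec (hcomul H)
         & tube_anti_spec (hanti H) /\ tube_star_spec (hstar H)].
Proof.
exists (tube_wha M); split; first exact: tube_cstar_weak_hopf.
split=> /=; [exact: tone_unit | exact: tmul_spec | exact: teps_spec | exact: tcomul_spec | ].
by split; [exact: tanti_flat_sharp | exact: tstar_spec].
Qed.
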